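(* Let $n\ge 2$, let $D\subseteq\mathbb{C}$ be a domain, let $\mathcal{F}$ be a family of holomorphic curves $f:D\to\mathbb{P}^n$, and let $H_1,\dots,H_{2n+1}$ be hyperplanes in general position in $\mathbb{P}^n$. Suppose that (a) for each $f\in\mathcal{F}$, $f(D)\cap H_k=\emptyset$ for all $k=1,\dots,n+1$; and that there exists an integer $t$ with $n+2\le t<2n+1$ such that (b) for each pair $f,g\in\mathcal{F}$, $f^{-1}(H_k)=g^{-1}(H_k)$ for each $k$ with $n+2\le k\le t$; (c) for each $f\in\mathcal{F}$ and each $k\in\{t+1,\dots,2n+1\}$, $f(D)\not\subset H_k$; and, for each compact set $K\subset D$, the volumes of $f^{-1}(H_k)\cap K$, viewing $f^{-1}(H_k)$ as divisors, are uniformly bounded for all $k=t+1,\dots,2n+1$ and all $f\in\mathcal{F}$ (i.e. there is a finite bound depending only on $K$). Then the family $\mathcal{F}$ is normal.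
   Context: Fix a system of homogeneous coordinates $[w_0:\cdots:w_n]$ on the complex projective space $\mathbb{P}^n$. A hyperplane is a set $H=\{[w_0:\cdots:w_n] : \sum_{l=0}^n a_lw_l=0\}$ with $(a_0,\dots,a_n)\in\mathbb{C}^{n+1}$ non-zero. Hyperplanes $H_1,\dots,H_q$ with $q\ge n+1$ are in general position if $\bigcap_{k\in R}H_k=\emptyset$ for every $R\subset\{1,\dots,q\}$ with $|R|=n+1$. A holomorphic curve of $D$ into $\mathbb{P}^n$ is a holomorphic mapping $f:D\to\mathbb{P}^n$. A reduced representation of $f$ on $D$ is a holomorphic map $\widetilde f=(f_0,\dots,f_n):D\to\mathbb{C}^{n+1}$ whose components have no common zero and such that $f(z)=[f_0(z):\cdots:f_n(z)]$ for all $z\in D$; every holomorphic curve on a planar domain $D$ has one. Put $\widetilde f^*H:=a_0f_0+\cdots+a_nf_n$. When $f(D)\not\subset H$, the volume of $f^{-1}(H)\cap K$ (viewing $f^{-1}(H)$ as a divisor) is the number of zeros, counted with multiplicity, of $\widetilde f^*H$ in $K$; it does not depend on the choice of reduced representation $\widetilde f$. A family $\mathcal{F}\subset\operatorname{Hol}(D,\mathbb{P}^n)$ is normal if it is relatively compact in $\operatorname{Hol}(D,\mathbb{P}^n)$, the space of holomorphic maps $D\to\mathbb{P}^n$ with the compact-open topology. *)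

(* Defs.v *)
From HB Require Import structures.
From mathcomp Require Import all_boot all_order all_algebra.
From mathcomp Require Import all_classical all_reals all_analysis.
From mathcomp Require Import complex.

Set Implicit Arguments.
Unset Strict Implicit.
Unset Printing Implicit Defensive.

Import Order.TTheory GRing.Theory Num.Theory.
Import numFieldNormedType.Exports.

Local Open Scope classical_set_scope.
Local Open Scope ring_scope.
Local Open Scope complex_scope.
Local Open Scope quotient_scope.

(* R[i] as a normed space over itself, so that derivable f z 1, for f : R[i] ->
   R[i], is complex differentiability of f at z. *)
HB.instance Definition _ (R : rcfType) := NormedModule.copy R[i] R[i]^o.

Section ComplexAnalysis.
Context {R : realType}.
Notation C := R[i].

Definition domain (D : set C) := [/\ D !=set0, open D & connected D].

Definition holomorphic_at (g : C -> C) (z : C) :=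
  \forall w \near z, derivable g w 1.

Definition zero_order (g : C -> C) (z : C) (m : nat) :=
  exists h : C -> C, [/\ holomorphic_at h z, h z != 0 &
    \forall w \near z, g w = (w - z) ^+ m * h w].

(* There is at most one m with zero_order g z m. There is none, and the value is
   +oo, exactly when g is not holomorphic near z or vanishes identically there.
   The value is 0 when g is holomorphic near z and g z != 0. *)
Definition multiplicity (g : C -> C) (z : C) : \bar R :=
  ereal_inf [set m%:R%:E | m in zero_order g z].

Definition zeros_count (g : C -> C) (K : set C) : \bar R :=
  \esum_(z in K) multiplicity g z.

End ComplexAnalysis.

Section ProjectiveSpace.
Context {R : realType} {n : nat}.
Notation C := R[i].

Definition nonzero_vectors : set 'rV[C]_n.+1 := [set w | w != 0].

Definition collinear (u v : nonzero_vectors) : bool :=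
  `[< exists c : C, c != 0 /\ \val v = c *: \val u >].

Lemma collinear_equiv : equiv_class_of collinear.
Proof.
split=> [u|u v|v u w].
- by apply/asboolP; exists 1; rewrite oner_neq0 scale1r.
- apply/asboolP/asboolP => -[c [c0 ->]]; exists c^-1;
    by rewrite invr_eq0 c0 scalerA mulVf ?scale1r.
- move=> /asboolP[c [c0 vE]] /asboolP[d [d0 wE]]; apply/asboolP.
  by exists (d * c); rewrite mulf_neq0 // wE vE scalerA.
Qed.

Definition collinear_rel := EquivRelPack collinear_equiv.

End ProjectiveSpace.
Arguments collinear_rel R n : clear implicits.

Definition projective (R : realType) (n : nat) :=
  quotient_topology {eq_quot (collinear_rel R n)}.

HB.instance Definition _ (R : realType) (n : nat) :=
  Topological.copy (projective R n)
    (quotient_topology {eq_quot (collinear_rel R n)}).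
HB.instance Definition _ (R : realType) (n : nat) :=
  Quotient.copy (projective R n) {eq_quot (collinear_rel R n)}.

Section HolomorphicCurves.
Context {R : realType} {n : nat}.
Notation C := R[i].
Notation P := (projective R n).

(* p = [w_0 : ... : w_n]. *)
Definition has_coordinates (p : P) (w : 'rV[C]_n.+1) :=
  exists2 u : nonzero_vectors, \val u = w & p = \pi_P u.

Definition linear_form (a w : 'rV[C]_n.+1) : C := \sum_(l < n.+1) a 0 l * w 0 l.

Definition hyperplane (a : 'rV[C]_n.+1) : set P :=
  [set p | exists2 w, has_coordinates p w & linear_form a w = 0].

Definition general_position (q : nat) (H : 'I_q -> set P) :=
  forall Q : {set 'I_q}, #|Q| = n.+1 -> \bigcap_(k in [set` Q]) H k = set0.

(* The standard chart domain {w_i != 0} and the chart functions w_j / w_i on it;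
   both are independent of the representative. *)
Definition chart_domain (i : 'I_n.+1) : set P :=
  [set p | \val (repr p : nonzero_vectors) 0 i != 0].
Definition chart (i j : 'I_n.+1) (p : P) : C :=
  let w := \val (repr p : nonzero_vectors) in w 0 j / w 0 i.

(* f is continuous, and holomorphic when read in the standard charts. The
   extension valL_ by a constant value outside of D is only there to make the
   chart expressions functions on C; for an open D it is irrelevant. *)
Definition holomorphic_curve (D : set C) (f : D -> P) :=
  continuous f /\
  forall (z : D) (i : 'I_n.+1), chart_domain i (f z) ->
    forall j, holomorphic_at (chart i j \o valL_ (f z) f) (\val z).

Definition reduced_representation (D : set C) (f : D -> P)
    (ft : C -> 'rV[C]_n.+1) :=
  [/\ forall z l, D z -> derivable (fun w => ft w 0 l) z 1,
      forall z, D z -> exists l, ft z 0 l != 0 &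
      forall z : D, has_coordinates (f z) (ft (\val z))].

Definition pullback (ft : C -> 'rV[C]_n.+1) (a : 'rV[C]_n.+1) : C -> C :=
  fun z => linear_form a (ft z).

(* M bounds the volume of f^{-1}(H) `&` K, for the hyperplane H of coefficients
   a; the count does not depend on the reduced representation. *)
Definition volume_le (D : set C) (f : D -> P) (a : 'rV[C]_n.+1) (K : set C)
    (M : R) :=
  forall ft, reduced_representation f ft ->
    (zeros_count (pullback ft a) K <= M%:E)%E.

End HolomorphicCurves.

(* Its coercion to Type is the space Hol(D, P^n), which carries the subspace
   topology of the compact-open topology. *)
Definition Hol (R : realType) (n : nat) (D : set R[i]) :
    set {compact-open, D -> projective R n} :=
  [set f | holomorphic_curve (f : D -> projective R n)].
Arguments Hol {R} n D.

Definition curve (R : realType) (n : nat) (D : set R[i]) (f : Hol n D) :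
  D -> projective R n := \val f.

Definition normal_family (R : realType) (n : nat) (D : set R[i])
  (F : set (Hol n D)) := precompact F.

(* Main.v *)
Require Import Defs.
From HB Require Import structures.
From mathcomp Require Import all_boot all_order all_algebra.
From mathcomp Require Import all_classical all_reals all_analysis.
From mathcomp Require Import complex lra ring zify.

Set Implicit Arguments.
Unset Strict Implicit.
Unset Printing Implicit Defensive.

Import Order.TTheory GRing.Theory Num.Theory.
Import numFieldNormedType.Exports.

Local Open Scope classical_set_scope.
Local Open Scope ring_scope.
Local Open Scope complex_scope.

Import ComplexField.Normc.
Local Notation Re := complex.Re.
Local Notation Im := complex.Im.

(** Normality means that every ultrafilter U on the curves that contains the
family F converges to a holomorphic curve ([precompact_of_limits]). The first n+1
hyperplanes are used as coordinate hyperplanes. The curves omit them, so that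
their coordinates phi_i are functions without zeros, and the other n hyperplanes
are given by forms in the phi_i.

If one coordinate phi_i leads near z, that is, if it bounds all the others up to
a constant for almost every curve, then the ratios phi_k / phi_i are bounded
holomorphic functions without zeros and converge along U near z. By Hurwitz's
theorem a coordinate that leads at one point of the domain D leads at all of them
as soon as each point has some leading coordinate ([leading_connected]), and the
limits of the ratios are the affine coordinates of the limit curve
([limit_curve_cvg]). It remains to find a leading coordinate at each point.

The zero set of a form is in some cases common to all curves, and then it is all
of D or consists of isolated points; in the other cases it has a bounded number
of points in each compact set, and then these points cluster along U at isolated
points only ([avoided_of_bounded]). So around each point, apart from isolated ones, the n
forms vanish nowhere or identically on some disc, for almost every curve. At an
isolated point some coordinate leads because one leads on a circle around it, and
the maximum principle applies to the ratios ([tame_of_punctured]).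

The heart of the proof is the remaining case ([bloch_cartan]), a normality
criterion of Bloch and Cartan. If no coordinate leads, then the derivative of the
curves in the Fubini-Study metric, here replaced by the [gauge] of the logarithms
of the coordinates, is unbounded ([marty]). One applies Zalcman's rescaling not to
the coordinates but to their K-th roots, where K tends to infinity so slowly that
the gauge of the roots is still unbounded ([zalcman_point]). The limits F_i are
entire, without zeros or identically 0, and not all of their ratios are constant.
Under K-th roots the modulus of a sum tends to the largest of the moduli of its
terms, unless the terms cancel. So the limit of the K-th root of a form that does
not cancel has the modulus of a dominant F_i, and by the maximum principle it has
this modulus on the whole plane. By Liouville's theorem there are two points where
different classes of coordinates dominate ([two_dominant_classes]), so each form
cancels at one of the two points. General position bounds the number of forms that
cancel at a point by the number of dominant coordinates minus one
([cancel_count]). There are n forms, but the two classes are disjoint and contain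
n + 1 coordinates at most, which leaves n - 1 cancellations: a contradiction.

The complex analysis is developed from Goursat's theorem. The bound of a
holomorphic function at the centre of a disc by its maximum on a circle
([center_le_circle]) gives the Cauchy estimates, and from these follow the
theorems on limits, zeros and maxima. *)

(** * The modulus, discs and complex derivatives *)

(** Derivatives as first-order estimates: the form in which they are computed and
passed to limits below. *)
Lemma is_deriveP (K : numFieldType) (f : K -> K) (z d : K) :
  is_derive z 1 f d <-> forall e, 0 < e -> \forall w \near z,
    `|f w - f z - d * (w - z)| <= e * `|w - z|.
Proof.
pose q h := h^-1 *: ((f \o shift z) (h *: (1 : K)) - f z).
have qE h : h != 0 -> f (h + z) - f z - d * h = (q h - d) * h.
  by move=> h0; rewrite /q /= [_ *: 1]mulr1 mulrBl [_ *: _]mulrC mulfVK.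
have -> : is_derive z 1 f d <-> q h @[h --> 0^'] --> d.
  split=> [[df <-]|qd]; first exact: df.
  by split; [apply/cvg_ex; exists d|exact: (cvg_lim _ qd)].
split=> [/cvgrPdistC_lt qd e /qd /nbhs_normP[r /= r0 rP]|H].
  apply/nbhs_normP; exists r => //= w wr.
  have [->|wz] := eqVneq w z; first by rewrite !subrr mulr0 subrr normr0 mulr0.
  have wz0 : w - z != 0 by rewrite subr_eq0.
  have := qE _ wz0; rewrite subrK => ->; rewrite normrM ler_wpM2r//.
  apply/ltW.
  have wr' : `|0 - (w - z)| < r by rewrite sub0r normrN distrC.
  exact: rP wr' wz0.
apply/cvgrPdistC_le => e /H/nbhs_normP[r /= r0 rP].
apply/nbhs_normP; exists r => //= h hr h0.
have hr' : `|z - (h + z)| < r.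
  by move: hr; rewrite /= opprD addrCA subrr addr0 => /(le_lt_trans _); apply; rewrite -[X in `|X|]sub0r.
by have := rP _ hr'; rewrite /= addrK qE// normrM ler_pM2r ?normr_gt0.
Qed.

Lemma exists_argmax (R : realDomainType) (I : finType) (i0 : I) (f : I -> R) :
  exists i, forall k, f k <= f i.
Proof.
exists [arg max_(j > i0) f j]%O => k.
by case: Order.TotalTheory.arg_maxP => // j _ /(_ k); exact.
Qed.

Section Modulus.
Context {R : realType}.
Notation C := R[i].
Implicit Types (x y z w c : C) (r e : R).

Lemma normc_norm z : `|z| = (normc z)%:C.
Proof. by case: z => a b; reflexivity. Qed.

Lemma real_complexM r e : (r * e)%:C = r%:C * e%:C.
Proof. exact: rmorphM. Qed.

Lemma normc_ge0 z : 0 <= normc z.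
Proof. by case: z => a b; exact: sqrtr_ge0. Qed.

Lemma normc_eq0 z : (normc z == 0) = (z == 0).
Proof.
by apply/eqP/eqP => [/eq0_normc//|->]; exact: normc0.
Qed.

Lemma normc_gt0 z : (0 < normc z) = (z != 0).
Proof. by rewrite lt_def normc_ge0 andbT normc_eq0. Qed.

Lemma normc_le0 z : normc z <= 0 -> z = 0.
Proof. by move=> z0; apply/eqP; rewrite -normc_eq0 eq_le z0 normc_ge0. Qed.

Lemma normc_small z : (forall e, 0 < e -> normc z <= e) -> z = 0.
Proof.
by move=> H; apply: normc_le0; apply/ler_addgt0Pr => e e0; rewrite add0r; exact: H.
Qed.

Lemma normc_add z w : normc (z + w) <= normc z + normc w.
Proof. exact: le_normcD. Qed.

Lemma normc_sub_sym z w : normc (z - w) = normc (w - z).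
Proof. by rewrite -normcN opprB. Qed.

Lemma normc_sub z w : normc (z - w) <= normc z + normc w.
Proof. by rewrite -[normc w]normcN; exact: le_normcD. Qed.

Lemma normc_trans y x z : normc (x - z) <= normc (x - y) + normc (y - z).
Proof. by have := normc_add (x - y) (y - z); rewrite subrKA. Qed.

Lemma normc_dist z w : normc z - normc w <= normc (z - w).
Proof. by rewrite lerBlDr; have := normc_add (z - w) w; rewrite subrK. Qed.

Lemma normc_real r : normc r%:C = `|r|.
Proof. by rewrite /normc /= expr0n /= addr0 sqrtr_sqr. Qed.

Lemma normcX z n : normc (z ^+ n) = normc z ^+ n.
Proof.
by elim: n => [|n IH]; rewrite ?expr0 ?normc1// !exprS normcM IH.
Qed.

Lemma normcRe z : `|Re z| <= normc z.
Proof. by rewrite -lecR -normc_norm; exact: normc_ge_Re. Qed.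

Lemma normcIm z : `|Im z| <= normc z.
Proof.
case: z => a b /=; rewrite -sqrtr_sqr ler_sqrt ?lerDr ?sqr_ge0//.
by rewrite addr_ge0// sqr_ge0.
Qed.

Lemma normc_le_ReIm z : normc z <= `|Re z| + `|Im z|.
Proof.
rewrite {1}(complexE z) (le_trans (normc_add _ _))// normcM !normc_real.
have -> : normc 'i%C = 1 :> R.
  by rewrite /normc /= expr0n /= add0r expr1n sqrtr1.
by rewrite mul1r.
Qed.

Definition disc c r : set C := [set w | normc (w - c) < r].

Lemma disc_center c r : 0 < r -> disc c r c.
Proof. by rewrite /disc /= subrr normc0. Qed.

Lemma disc_le c r e : r <= e -> disc c r `<=` disc c e.
Proof. by move=> re z /= zr; exact: lt_le_trans re. Qed.

Lemma disc_in z c r : disc z (r - normc (z - c)) `<=` disc c r.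
Proof. by move=> w; rewrite /disc /=; have := normc_trans z w c; lra. Qed.

Lemma nbhsCP z (A : set C) :
  nbhs z A <-> exists2 e, 0 < e & disc z e `<=` A.
Proof.
split=> [/nbhs_ballP[[e e'] /=]|[e e0 eA]].
  rewrite ltcE /= => /andP[/eqP -> e0] eA; exists e => // w we; apply: eA.
  by rewrite -ball_normE /= normc_norm ltcR normc_sub_sym.
apply/nbhs_ballP; exists e%:C => /=; first by rewrite ltcR.
move=> w; rewrite -ball_normE /= normc_norm ltcR normc_sub_sym => we.
exact: eA.
Qed.

Lemma open_disc c r : open (disc c r).
Proof.
rewrite openE => z /= zr; apply/nbhsCP; exists (r - normc (z - c)).
  by rewrite subr_gt0.
exact: disc_in.
Qed.

Lemma openCP (A : set C) : open A -> forall z, A z ->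
  exists2 e, 0 < e & disc z e `<=` A.
Proof. by rewrite openE => oA z /oA/nbhsCP. Qed.

Lemma cvgCP (T : Type) (F : set_system T) {FF : Filter F} (x : T -> C) l :
  x t @[t --> F] --> l <->
  forall e, 0 < e -> \forall t \near F, normc (x t - l) < e.
Proof.
split=> [/cvgrPdistC_lt xl e e0|xl].
  have := xl e%:C; rewrite ltcR => /(_ e0); apply: filterS => t.
  by rewrite normc_norm ltcR.
apply/cvgrPdistC_lt => -[e e'] /=; rewrite ltcE /= => /andP[/eqP -> e0].
by apply: filterS (xl e e0) => t; rewrite normc_norm ltcR.
Qed.

Lemma cvg_normc (T : Type) (F : set_system T) {FF : Filter F} (x : T -> C) l :
  x t @[t --> F] --> l -> normc (x t) @[t --> F] --> normc l.
Proof.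
move=> /cvgCP xl; apply/cvgrPdistC_lt => e /xl; apply: filterS => t.
rewrite ltr_norml; have := normc_dist (x t) l; have := normc_dist l (x t).
by rewrite (normc_sub_sym l); lra.
Qed.

Lemma continuousCP (f : C -> C) z : {for z, continuous f} <->
  forall e, 0 < e -> exists2 d, 0 < d &
    forall w, normc (w - z) < d -> normc (f w - f z) < e.
Proof.
split=> [/cvgCP fz e /fz/nbhsCP[d d0 dP]|fz]; first by exists d.
apply/(@cvgCP _ (nbhs z)) => e /fz[d d0 dP].
by apply/nbhsCP; exists d.
Qed.

Lemma is_deriveCP (f : C -> C) z d : is_derive z 1 f d <->
  forall e, 0 < e -> exists2 r, 0 < r & forall w, normc (w - z) < r ->
    normc (f w - f z - d * (w - z)) <= e * normc (w - z).
Proof.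
split=> [/is_deriveP H e e0|H].
  have := H e%:C; rewrite ltcR => /(_ e0)/nbhsCP[r r0 rP]; exists r => // w wr.
  by have := rP w wr; rewrite !normc_norm -real_complexM lecR.
apply/is_deriveP => -[e e'] /=; rewrite ltcE /= => /andP[/eqP -> e0].
have [r r0 rP] := H e e0; apply/nbhsCP; exists r => // w /rP.
by rewrite !normc_norm -real_complexM lecR.
Qed.

End Modulus.

(** * Ultrafilter limits and compactness *)

Lemma cvg_bigsum (K : numFieldType) (V : normedModType K) (T J : Type)
    (F : set_system T) {FF : Filter F} (s : seq J) (f : J -> T -> V) (l : J -> V) :
  (forall j, f j t @[t --> F] --> l j) ->
  \sum_(j <- s) f j t @[t --> F] --> \sum_(j <- s) l j.
Proof.
move=> fl; elim: s => [|j s IH].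
  rewrite big_nil (_ : (fun t => \sum_(j <- [::]) f j t) = fun=> 0); first exact: cvg_cst.
  by apply/funext => t; rewrite big_nil.
rewrite big_cons (_ : (fun t => _) = fun t => f j t + \sum_(j <- s) f j t).
  exact: cvgD (fl j) IH.
by apply/funext => t; rewrite big_cons.
Qed.

Section UltrafilterLimits.
Context {R : realType}.
Notation C := R[i].

(** Limits along an ultrafilter replace the extraction of subsequences. *)
Lemma ultra_bounded_cvgR (T : Type) (U : set_system T) {UU : UltraFilter U}
    (x : T -> R) (M : R) :
  (\forall t \near U, `|x t| <= M) -> exists l : R, x t @[t --> U] --> l.
Proof.
move=> xM.
have : (x @ U) `[(- M), M]%classic.
  by apply: filterS xM => t; rewrite /= in_itv /= ler_norml.
move=> /(@segment_compact R (- M) M _ _)[l [_ lU]]; exists l.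
apply/cvgrPdistC_lt => e e0.
have [near_l|far] := in_ultra_setVsetC [set t | `|x t - l| < e] UU.
  exact: near_l.
have far' : U [set t | e <= `|x t - l|].
  by apply: filterS far => t /= far; rewrite leNgt; apply/negP.
have : nbhs l (ball l e) by exact: nbhsx_ballx.
move=> le; have [y [/= ey]] := lU [set y | e <= `|y - l|] _ far' le; rewrite /ball /= distrC => ye.
by move: ey; rewrite leNgt ye.
Qed.

Lemma ultra_bounded_cvg (T : Type) (U : set_system T) {UU : UltraFilter U}
    (x : T -> C) (M : R) :
  (\forall t \near U, normc (x t) <= M) -> exists l : C, x t @[t --> U] --> l.
Proof.
move=> xM.
have [] := @ultra_bounded_cvgR T U UU (fun t => Re (x t)) M.
  by apply: filterS xM => t; apply: le_trans; exact: normcRe.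
move=> a /cvgrPdistC_lt xa.
have [] := @ultra_bounded_cvgR T U UU (fun t => Im (x t)) M.
  by apply: filterS xM => t; apply: le_trans; exact: normcIm.
move=> b /cvgrPdistC_lt xb.
exists (a +i* b); apply/cvgCP => e e0.
have e20 : 0 < e / 2 by rewrite divr_gt0.
move: (xa _ e20) (xb _ e20); apply: filterS2 => t ha hb.
apply: le_lt_trans (normc_le_ReIm _) _; move: ha hb.
by case: (x t) => p q /=; lra.
Qed.

Definition cdisc (c : C) (r : R) : set C := [set w | normc (w - c) <= r].

Lemma compact_cdisc (c : C) (r : R) : compact (cdisc c r).
Proof.
rewrite compact_ultra => U UU Ur.
have [l Ul] : exists l : C, id t @[t --> U] --> l.
  apply: (@ultra_bounded_cvg C U UU id (r + normc c)).
  apply: filterS Ur => w; rewrite /cdisc /= => wc.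
  by have := normc_add (w - c) c; rewrite subrK; lra.
exists l; split; last exact: Ul.
rewrite /cdisc /=.
rewrite leNgt; apply/negP => rl.
have [|w [/= wr wl]] := @filter_ex _ U _
  (cdisc c r `&` [set w | normc (w - l) < normc (l - c) - r]).
  by apply: filterI => //; move/cvgCP: Ul; apply; rewrite subr_gt0.
by have := normc_trans w l c; rewrite (normc_sub_sym l w); move: wr wl; rewrite /cdisc /=; lra.
Qed.

Lemma cvgC_unique (T : Type) (U : set_system T) {UU : ProperFilter U}
    (x : T -> C) (l l' : C) : x t @[t --> U] --> l -> x t @[t --> U] --> l' -> l = l'.
Proof.
move=> xl xl'; have hC : hausdorff_space C by exact: norm_hausdorff.
exact: etrans (esym (cvg_lim hC xl)) (cvg_lim hC xl').
Qed.

Lemma cvg_normc_le (T : Type) (U : set_system T) {UU : ProperFilter U}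
    (x : T -> C) (l : C) (M : R) :
  x t @[t --> U] --> l -> (\forall t \near U, normc (x t) <= M) -> normc l <= M.
Proof.
move=> /cvg_normc xl xM; apply: (cvgr_to_le xl).
exact: xM.
Qed.

Lemma cvg_normc_ge (T : Type) (U : set_system T) {UU : ProperFilter U}
    (x : T -> C) (l : C) (M : R) :
  x t @[t --> U] --> l -> (\forall t \near U, M <= normc (x t)) -> M <= normc l.
Proof.
move=> /cvg_normc xl xM; apply: (cvgr_to_ge xl).
exact: xM.
Qed.

(** The two halves of a locally constant predicate are relatively open, so one
of them is empty. *)
Lemma connected_locally_constant (S : set C) (P : C -> Prop) : connected S ->
  (forall z, S z -> exists2 e, 0 < e &
    forall w, S w -> normc (w - z) < e -> (P z <-> P w)) ->
  forall z, S z -> P z -> forall w, S w -> P w.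
Proof.
move=> cS loc z Sz Pz w Sw.
pose near_in (Q : C -> Prop) := \bigcup_(y in [set y | S y /\ Q y])
  \bigcup_(e in [set e | 0 < e /\     forall w, S w -> normc (w - y) < e -> (P y <-> P w)]) disc y e.
have oU Q : open (near_in Q).
  by apply: bigcup_open => y _; apply: bigcup_open => e _; exact: open_disc.
have inU Q y : S y -> Q y -> near_in Q y.
  move=> Sy Qy; exists y => //=; have [e e0 eP] := loc y Sy.
  by exists e => //=; exact: disc_center.
have nearP y : S y -> near_in P y -> P y.
  by move=> Sy [x [Sx Px] [e [e0 eP] /= xe]]; exact/(eP y Sy xe).
have nearN y : S y -> near_in (fun y => ~ P y) y -> ~ P y.
  by move=> Sy [x [Sx Px] [e [e0 eP] /= xe]] /(eP y Sy xe).
suff : S `&` [set y | P y] = S by move=> /seteqP[_ /(_ w Sw)[]].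
apply: cS; first by exists z.
  exists (near_in P); first exact: oU.
  apply/seteqP; split=> y [Sy Py]; split=> //; [exact: inU|exact: nearP].
exists (~` near_in (fun y => ~ P y)); first exact/open_closedC/oU.
apply/seteqP; split=> y [Sy Py]; split=> //; first by move=> /(nearN y Sy).
by apply: contrapT => nPy; apply: Py; exact: inU.
Qed.

(** Compactness against a filter: a property that holds near every point of K,
for almost all parameters, holds on K for almost all parameters. *)
Lemma compact_near_all (T : Type) (F : set_system T) {FF : Filter F}
    (K : set C) (Q : T -> C -> Prop) : compact K ->
  (forall z, K z -> exists2 e, 0 < e &
    \forall t \near F, forall w, normc (w - z) < e -> Q t w) ->
  \forall t \near F, forall w, K w -> Q t w.
Proof.
move=> /compact_near_coveringP cK loc.
have := cK T F Q FF; apply=> z Kz; have [e e0 eP] := loc z Kz.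
exists (disc z e, [set t | forall w, normc (w - z) < e -> Q t w]).
  by split => //=; apply/nbhsCP; exists e.
by move=> [w t] /= [wz h]; exact: h.
Qed.

Lemma EVT_compactC (K : set C) (f : C -> R) : K !=set0 -> compact K ->
  (forall z, K z -> {for z, continuous f}) ->
  exists2 c, K c & forall z, K z -> f z <= f c.
Proof.
move=> K0 cK cf; have [|c Kc cmax] := @compact_EVT_max _ R f K K0 cK.
  by apply/subspace_continuousP => z Kz; apply: cvg_within_filter (cf z Kz).
exists c; first by move: Kc; rewrite inE.
by move=> z Kz; apply: cmax; rewrite inE.
Qed.

End UltrafilterLimits.

(** * Integrals along segments *)

Section SegmentIntegrals.
Context {R : realType}.
Notation C := R[i].
Implicit Types (a b c z w d : C) (f F G : C -> C) (S : set C).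

Definition seg a b : set C :=
  [set z | exists2 t : R, 0 <= t <= 1 & z = a + t%:C * (b - a)].

(** Derivatives relative to S, because on a segment every continuous function has
a primitive in this sense. *)
Definition deriv_on S F z d := forall e, 0 < e -> exists2 r : R, 0 < r &
  forall w, S w -> normc (w - z) < r ->
    normc (F w - F z - d * (w - z)) <= e * normc (w - z).

Definition antider_on S F f := forall z, S z -> deriv_on S F z (f z).

Lemma seg_l a b : seg a b a.
Proof. by exists 0; rewrite ?lexx ?ler01// mul0r addr0. Qed.

Lemma seg_r a b : seg a b b.
Proof. by exists 1; rewrite ?lexx ?ler01// mul1r addrC subrK. Qed.

Lemma seg_sym a b : seg a b = seg b a.
Proof.
suff sub c d : seg c d `<=` seg d c by apply/seteqP; split; exact: sub.
move=> z [t /andP[t0 t1] ->]; exists (1 - t); first by apply/andP; split; lra.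
by rewrite rmorphB rmorph1; ring.
Qed.

Lemma seg_dist a b z : seg a b z -> normc (z - a) <= normc (b - a).
Proof.
move=> [t /andP[t0 t1] ->]; rewrite addrAC subrr add0r normcM normc_real ger0_norm//.
by rewrite ler_piMl// normc_ge0.
Qed.

Lemma seg_sub a b c d : seg a b c -> seg a b d -> seg c d `<=` seg a b.
Proof.
move=> [s /andP[s0 s1] ->] [t /andP[t0 t1] ->] z [u /andP[u0 u1] ->].
exists (s + u * (t - s)); last by rewrite rmorphD rmorphM rmorphB; ring.
by apply/andP; split; nra.
Qed.

Lemma antider_onW S S' F f : S' `<=` S -> antider_on S F f -> antider_on S' F f.
Proof.
move=> S'S SF z /S'S Sz e e0; have [r r0 rP] := SF z Sz e e0.
by exists r => // w /S'S; exact: rP.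
Qed.

Lemma antider_onB S F G f g : antider_on S F f -> antider_on S G g ->
  antider_on S (fun z => F z - G z) (fun z => f z - g z).
Proof.
move=> SF SG z Sz e e0; have e20 : 0 < e / 2 by rewrite divr_gt0.
have [r r0 rP] := SF z Sz _ e20; have [s s0 sP] := SG z Sz _ e20.
exists (Num.min r s); first by rewrite lt_min r0.
move=> w Sw; rewrite lt_min => /andP[wr ws].
have -> : F w - G w - (F z - G z) - (f z - g z) * (w - z) =
  (F w - F z - f z * (w - z)) - (G w - G z - g z * (w - z)) by ring.
apply: le_trans (normc_sub _ _) _; move: (rP w Sw wr) (sP w Sw ws); lra.
Qed.

Lemma is_derive_antider S F f : (forall z, S z -> is_derive z 1 F (f z)) ->
  antider_on S F f.
Proof.
move=> dF z Sz e e0; have /is_deriveCP/(_ e e0)[r r0 rP] := dF z Sz.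
by exists r => // w _; exact: rP.
Qed.

Lemma Re_comb z w d (r : R) :
  Re z - Re w - Re d * r = Re (z - w - d * r%:C).
Proof. by case: z w d => [? ?] [? ?] [? ?] /=; ring. Qed.

(** The real mean value theorem, applied to the component of F along the
direction of F b - F a; this keeps the constant 1. *)
Lemma mean_value_seg a b F f (M : R) : antider_on (seg a b) F f ->
  (forall z, seg a b z -> normc (f z) <= M) ->
  normc (F b - F a) <= M * normc (b - a).
Proof.
move=> dF fM; pose p (t : R) := a + t%:C * (b - a).
pose k := (F b - F a)^*%C.
pose u (t : R) := Re (k * F (p t)).
pose du (t : R) := Re (k * (f (p t) * (b - a))).
have pseg t : 0 <= t <= 1 -> seg a b (p t) by move=> ht; exists t.
have pB s t : p s - p t = (s - t)%:C * (b - a).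
  by rewrite /p rmorphB; ring.
have du_eps t : 0 <= t <= 1 -> forall e, 0 < e -> exists2 r : R, 0 < r &
    forall s, 0 <= s <= 1 -> `|s - t| < r ->
    `|u s - u t - du t * (s - t)| <= e * `|s - t|.
  move=> ht e e0; pose m := (normc k + 1) * (normc (b - a) + 1).
  have k0 := normc_ge0 k; have ba0 := normc_ge0 (b - a).
  have m0 : 0 < m by rewrite /m mulr_gt0//; lra.
  have em0 : 0 < e / m by rewrite divr_gt0.
  have [r r0 rP] := dF _ (pseg t ht) _ em0.
  exists (r / (normc (b - a) + 1)); first by rewrite divr_gt0//; lra.
  move=> s hs st; have ba1 : 0 < normc (b - a) + 1 by lra.
  have nst : normc (p s - p t) = `|s - t| * normc (b - a).
    by rewrite pB normcM normc_real.
  have pst : normc (p s - p t) < r.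
    rewrite nst; move: st; rewrite ltr_pdivlMr// mulrDr mulr1.
    by have := normr_ge0 (s - t); lra.
  have := rP _ (pseg s hs) pst.
  have -> : u s - u t - du t * (s - t) =
      Re (k * (F (p s) - F (p t) - f (p t) * (p s - p t))).
    by rewrite /u /du Re_comb pB; congr Re; ring.
  move=> H; apply: le_trans (normcRe _) _; rewrite normcM.
  apply: (@le_trans _ _ (normc k * (e / m * (`|s - t| * normc (b - a))))).
    by rewrite ler_wpM2l// -nst.
  rewrite [X in X <= _](_ : _ = e * `|s - t| * ((normc k * normc (b - a)) / m)).
    rewrite ler_piMr ?mulr_ge0 ?(ltW e0)// ler_pdivrMr// mul1r /m; nra.
  by ring.
have [||t] := @MVT_segment R u du 0 1 ler01.
- move=> t; rewrite in_itv /= => /andP[t0 t1]; apply/is_deriveP => e e0.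
  have ht : 0 <= t <= 1 by rewrite !ltW.
  have [r r0 rP] := du_eps t ht e e0.
  have q0 : 0 < Num.min r (Num.min t (1 - t)) by rewrite !lt_min r0 t0 subr_gt0.
  near=> s; apply: rP.
    have : `|t - s| < Num.min r (Num.min t (1 - t)) by near: s; exact: nbhsx_ballx.
    rewrite !lt_min !ltr_norml => /andP[_ /andP[/andP[? ?] /andP[? ?]]].
    by apply/andP; split; lra.
  have : `|t - s| < Num.min r (Num.min t (1 - t)) by near: s; exact: nbhsx_ballx.
  by rewrite !lt_min distrC => /andP[].
- apply/subspace_continuousP => t; rewrite /= in_itv /= => ht.
  apply/cvgrPdist_le => e e0.
  have [r r0 rP] := du_eps t ht 1 ltr01.
  pose q := Num.min r (e / (`|du t| + 1)).
  have du1 : 0 < `|du t| + 1 by have := normr_ge0 (du t); lra.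
  have q0 : 0 < q by rewrite lt_min r0 divr_gt0.
  rewrite near_withinE; near=> s => /=; rewrite in_itv /= => hs.
  have : `|t - s| < q by near: s; exact: nbhsx_ballx.
  rewrite distrC lt_min ltr_pdivlMr// => /andP[sr sq].
  have := rP s hs sr; rewrite mul1r => H.
  rewrite distrC; have -> : u s - u t = (u s - u t - du t * (s - t)) + du t * (s - t) by ring.
  apply: le_trans (ler_normD _ _) _; rewrite normrM; nra.
rewrite in_itv /= subr0 mulr1 => ht duE.
have uE : u 1 - u 0 = normc (F b - F a) ^+ 2.
  have -> : u 1 = Re (k * F b) by rewrite /u /p rmorph1 mul1r addrC subrK.
  have -> : u 0 = Re (k * F a) by rewrite /u /p rmorph0 mul0r addr0.
  rewrite /k.
  case: (F b) (F a) => [x y] [x' y'] /=; rewrite sqr_sqrtr ?addr_ge0 ?sqr_ge0//.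
  by ring.
have : normc (F b - F a) ^+ 2 <= normc (F b - F a) * (M * normc (b - a)).
  rewrite -uE duE; apply: le_trans (ler_norm _) _; apply: le_trans (normcRe _) _.
  have -> : normc (F b - F a) = normc k.
    by rewrite /k; case: (F b - F a) => x y /=; rewrite sqrrN.
  rewrite !normcM ler_wpM2l ?normc_ge0// ler_wpM2r ?normc_ge0//.
  exact/fM/pseg.
have [-> _|n0] := eqVneq (normc (F b - F a)) 0.
  by rewrite mulr_ge0 ?normc_ge0// (le_trans (normc_ge0 _) (fM a (seg_l a b))).
by rewrite expr2 ler_pM2l// lt_def n0 normc_ge0.
Unshelve. all: by end_near. Qed.

End SegmentIntegrals.

Section Goursat.
Context {R : realType}.
Notation C := R[i].
Implicit Types (a b c z w d : C) (f F G : C -> C) (S O : set C).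

(** Extending p by constants turns the end points into interior ones, where the
fundamental theorem of calculus applies. *)
Lemma continuous_antiderivative01 (p : R -> R) :
  (forall t, 0 <= t <= 1 -> {for t, continuous p}) ->
  exists P : R -> R, forall t, 0 <= t <= 1 -> forall e, 0 < e ->
    exists2 r : R, 0 < r & forall s, 0 <= s <= 1 -> `|s - t| < r ->
      `|P s - P t - p t * (s - t)| <= e * `|s - t|.
Proof.
move=> pc; pose clamp (t : R) : R := Num.max 0 (Num.min t 1).
have clamp01 t : 0 <= clamp t <= 1.
  by rewrite /clamp le_max lexx ge_max ler01 ge_min lexx orbT.
have clampE t : 0 <= t <= 1 -> clamp t = t.
  by move=> /andP[t0 t1]; rewrite /clamp min_l// max_r.
pose q := p \o clamp.
have qc : continuous q.
  move=> t; apply: continuous_comp; last exact/pc/clamp01.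
  apply: continuous_max; first exact: cvg_cst.
  by apply: continuous_min; [exact: cvg_id|exact: cvg_cst].
have iq : lebesgue_measure.-integrable `[(-1 : R), 2] (EFin \o q).
  apply: continuous_compact_integrable; first exact: segment_compact.
  exact: continuous_subspaceT.
exists (fun x => \int[lebesgue_measure]_(t in `[(-1 : R), x]) q t).
move=> t t01 e e0; have /andP[t0 t1] := t01.
have t2 : t < 2 by lra.
have tN1 : -1 < t by lra.
have [dP PE] := continuous_FTC1_closed t2 iq tN1 (qc t).
rewrite derive1E /= [q t](_ : _ = p t) in PE; last by rewrite /q /= clampE.
have /is_deriveP/(_ e e0)/nbhs_normP[r /= r0 rP] := DeriveDef dP PE.
by exists r => // s _ st; apply: rP; rewrite /= distrC.
Qed.

Lemma seg_antider a b f : (forall z, seg a b z -> {for z, continuous f}) ->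
  exists F, antider_on (seg a b) F f.
Proof.
move=> fc; have [->|ab] := eqVneq b a.
  exists (cst 0) => z [t _ ->] e e0; exists 1 => // w [s _ ->] _.
  by rewrite /= !subrr !mulr0 !subrr !mulr0 subrr normc0 mulr0.
have ba0 : b - a != 0 by rewrite subr_eq0.
have nba0 : 0 < normc (b - a) by rewrite normc_gt0.
pose p (t : R) := a + t%:C * (b - a).
have pB s t : p s - p t = (s - t)%:C * (b - a) by rewrite /p rmorphB; ring.
have fpc (t : R) : 0 <= t <= 1 -> forall e : R, 0 < e -> \forall s \near t,
    normc (f (p s) - f (p t)) < e.
  move=> ht e e0; have pt : seg a b (p t) by exists t.
  have /continuousCP/(_ e e0)[d d0 dP] := fc _ pt.
  apply/nbhs_normP; exists (d / normc (b - a)); first by rewrite /= divr_gt0.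
  move=> s /=; rewrite distrC => st; apply: dP.
  by rewrite pB normcM normc_real -ltr_pdivlMr.
have [|P PP] := @continuous_antiderivative01 (fun t => Re (f (p t))).
  move=> t ht; apply/cvgrPdist_lt => e e0; near=> s.
  rewrite distrC; apply: le_lt_trans (_ : normc (f (p s) - f (p t)) < e).
    by have := normcRe (f (p s) - f (p t)); case: (f (p s)) (f (p t)) => [? ?] [? ?].
  by near: s; exact: fpc.
have [|Q QP] := @continuous_antiderivative01 (fun t => Im (f (p t))).
  move=> t ht; apply/cvgrPdist_lt => e e0; near=> s.
  rewrite distrC; apply: le_lt_trans (_ : normc (f (p s) - f (p t)) < e).
    by have := normcIm (f (p s) - f (p t)); case: (f (p s)) (f (p t)) => [? ?] [? ?].
  by near: s; exact: fpc.
pose tau z := Re ((z - a) / (b - a)).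
have tauE t : tau (p t) = t by rewrite /tau /p addrAC subrr add0r mulfK.
exists (fun z => (b - a) * (P (tau z) +i* Q (tau z))).
move=> z [t ht ->] e e0; rewrite -/(p t).
have e20 : 0 < e / 2 by rewrite divr_gt0.
have [r r0 rP] := PP t ht _ e20; have [s s0 sP] := QP t ht _ e20.
exists (Num.min r s * normc (b - a)); first by rewrite mulr_gt0// lt_min r0.
move=> w [u hu ->]; rewrite -/(p u) !tauE pB normcM normc_real ltr_pM2r// lt_min.
move=> /andP[/(rP u hu) hP /(sP u hu) hQ].
have -> : (b - a) * (P u +i* Q u) - (b - a) * (P t +i* Q t) -
    f (p t) * ((u - t)%:C * (b - a)) =
    ((P u - P t - Re (f (p t)) * (u - t)) +i*
     (Q u - Q t - Im (f (p t)) * (u - t))) * (b - a).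
  rewrite -mulrBr mulrA [X in _ - X]mulrC -mulrBr [RHS]mulrC; congr (_ * _).
  by case: (f (p t)) => x y; apply/eqP; rewrite eq_complex /=; apply/andP; split; apply/eqP; ring.
rewrite normcM mulrA ler_pM2r//; apply: le_trans (normc_le_ReIm _) _ => /=.
by move: hP hQ; lra.
Unshelve. all: by end_near. Qed.

(** The integral of f along the segment from a to b, for f continuous there. *)
Definition seg_int f a b : C :=
  xget 0 [set v | exists2 F, antider_on (seg a b) F f & v = F b - F a].

Lemma seg_intE a b F f : antider_on (seg a b) F f -> seg_int f a b = F b - F a.
Proof.
move=> dF; rewrite /seg_int; case: xgetP => [v _ [G dG ->]|none]; last first.
  by have := none (F b - F a) (ex_intro2 _ _ F dF erefl).
have := mean_value_seg (antider_onB dF dG).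
move=> /(_ 0); rewrite mul0r => H; have {}H : normc (F b - G b - (F a - G a)) <= 0.
  by apply: H => z _; rewrite subrr normc0.
by apply/eqP; rewrite -subr_eq0 -[0]oppr0 -(normc_le0 H); apply/eqP; ring.
Qed.

Definition continuous_on S f := forall z, S z -> {for z, continuous f}.

Lemma seg_int_sym a b f : continuous_on (seg a b) f ->
  seg_int f b a = - seg_int f a b.
Proof.
move=> /seg_antider[F dF]; rewrite (seg_intE dF).
by rewrite (@seg_intE b a F) ?opprB// seg_sym.
Qed.

Lemma seg_int_split a b c f : seg a b c -> continuous_on (seg a b) f ->
  seg_int f a b = seg_int f a c + seg_int f c b.
Proof.
move=> abc /seg_antider[F dF]; rewrite (seg_intE dF).
rewrite (@seg_intE a c F); last first.
  by apply: antider_onW dF; apply: seg_sub => //; exact: seg_l.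
rewrite (@seg_intE c b F); first by ring.
by apply: antider_onW dF; apply: seg_sub => //; exact: seg_r.
Qed.

(** Integrals are estimated only by comparison with a function g whose primitive
is known. *)
Lemma seg_int_near a b F f g (M : R) : continuous_on (seg a b) f ->
  antider_on (seg a b) F g ->
  (forall z, seg a b z -> normc (f z - g z) <= M) ->
  normc (seg_int f a b - (F b - F a)) <= M * normc (b - a).
Proof.
move=> /seg_antider[G dG] dF fg; rewrite (seg_intE dG).
have -> : G b - G a - (F b - F a) = G b - F b - (G a - F a) by ring.
exact: mean_value_seg (antider_onB dG dF) fg.
Qed.

End Goursat.

(** * Goursat's theorem and primitives *)

Section Triangles.
Context {R : realType}.
Notation C := R[i].
Implicit Types (a b c z w d : C) (f F G : C -> C) (S O : set C).

Definition convexC O := forall a b, O a -> O b -> seg a b `<=` O.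

Definition tri_int f (T : C * C * C) : C :=
  let: (a, b, c) := T in seg_int f a b + seg_int f b c + seg_int f c a.

Definition tri_in O (T : C * C * C) := let: (a, b, c) := T in [/\ O a, O b & O c].

Definition perimeter (T : C * C * C) : R :=
  let: (a, b, c) := T in normc (a - b) + normc (b - c) + normc (c - a).

Definition mid a b : C := (a + b) / 2.

Definition sub_triangles (T : C * C * C) : seq (C * C * C) :=
  let: (a, b, c) := T in
  [:: (a, mid a b, mid c a); (mid a b, b, mid b c); (mid c a, mid b c, c);
      (mid b c, mid c a, mid a b)].

Lemma mid_seg a b : seg a b (mid a b).
Proof.
exists (1 / 2); first by apply/andP; split; lra.
rewrite /mid rmorphM rmorph1 fmorphV rmorph_nat.
by field.
Qed.

Lemma normc_half z : normc (z / 2) = normc z / 2.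
Proof.
by rewrite normcM normcV -[2 : C](rmorph_nat (real_complex R)) normc_real normr_nat.
Qed.

Lemma sub_triangles_perimeter T U : U \in sub_triangles T ->
  perimeter U = perimeter T / 2.
Proof.
case: T => [[a b] c]; rewrite !inE => /or4P[] /eqP -> /=;
  rewrite !mulrDl -!normc_half; congr (_ + _ + _);
  first [by congr normc; rewrite /mid; field
    | by rewrite -[LHS]normcN; congr normc; rewrite /mid; field].
Qed.

Lemma sub_triangles_in O T U : convexC O -> tri_in O T ->
  U \in sub_triangles T -> tri_in O U.
Proof.
case: T => [[a b] c] cO [Oa Ob Oc].
have [Oab Obc Oca] : [/\ O (mid a b), O (mid b c) & O (mid c a)].
  by split; [apply: (cO a b)|apply: (cO b c)|apply: (cO c a)] => //; exact: mid_seg.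
by rewrite !inE => /or4P[] /eqP -> /=.
Qed.

Lemma sub_triangles_vertex T U : U \in sub_triangles T ->
  normc (U.1.1 - T.1.1) <= perimeter T.
Proof.
case: T => [[a b] c] /=.
have := normc_ge0 (a - b); have := normc_ge0 (b - c); have := normc_ge0 (c - a).
rewrite !inE => p1 p2 p3 /or4P[] /eqP -> /=.
- by rewrite subrr normc0; lra.
- have -> : mid a b - a = - ((a - b) / 2) by rewrite /mid; field.
  by rewrite normcN normc_half; lra.
- have -> : mid c a - a = (c - a) / 2 by rewrite /mid; field.
  by rewrite normc_half; lra.
have -> : mid b c - a = (c - a) / 2 - (a - b) / 2 by rewrite /mid; field.
by apply: le_trans (normc_sub _ _) _; rewrite !normc_half; lra.
Qed.

Lemma tri_int_split f O T : convexC O -> continuous_on O f -> tri_in O T ->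
  tri_int f T = \sum_(U <- sub_triangles T) tri_int f U.
Proof.
case: T => [[a b] c] cO fc [Oa Ob Oc].
have segc x y : O x -> O y -> continuous_on (seg x y) f.
  by move=> Ox Oy z /(cO _ _ Ox Oy); exact: fc.
have Om x y : O x -> O y -> O (mid x y) by move=> Ox Oy; exact/(cO _ _ Ox Oy)/mid_seg.
rewrite !big_cons big_nil /= addr0.
rewrite (seg_int_split (mid_seg a b)) ?(seg_int_split (mid_seg b c))
  ?(seg_int_split (mid_seg c a)); try exact: segc.
rewrite (@seg_int_sym _ (mid c a) (mid a b)); last by apply: segc; exact: Om.
rewrite (@seg_int_sym _ (mid a b) (mid b c)); last by apply: segc; exact: Om.
rewrite (@seg_int_sym _ (mid b c) (mid c a)); last by apply: segc; exact: Om.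
by ring.
Qed.

Lemma tri_int_large f O T : convexC O -> continuous_on O f -> tri_in O T ->
  exists2 U, U \in sub_triangles T &
    normc (tri_int f T) <= 4 * normc (tri_int f U).
Proof.
move=> cO fc OT; apply: contrapT => small.
have {}small U : U \in sub_triangles T ->
    4 * normc (tri_int f U) < normc (tri_int f T).
  by move=> UT; rewrite ltNge; apply/negP => h; apply: small; exists U.
have := tri_int_split cO fc OT.
case: T OT small => [[a b] c] OT.
rewrite !big_cons big_nil addr0.
set T := (a, b, c); set T1 := (a, _, _); set T2 := (_, b, _).
set T3 := (_, _, c); set T4 := (_, _, _) => small E.
have := small T1; have := small T2; have := small T3; have := small T4.
rewrite !inE !eqxx !orbT => /(_ isT) h4 /(_ isT) h3 /(_ isT) h2 /(_ isT) h1.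
have := normc_add (tri_int f T1) (tri_int f T2 + (tri_int f T3 + tri_int f T4)).
have := normc_add (tri_int f T2) (tri_int f T3 + tri_int f T4).
have := normc_add (tri_int f T3) (tri_int f T4).
by rewrite -E; lra.
Qed.

(** In an open convex set of this kind, shrinking triangles cluster inside the
set; discs and half-planes are of this kind. *)
Definition exhausted O := forall a b c, O a -> O b -> O c ->
  exists S, [/\ S `<=` O, convexC S, closed S & [/\ S a, S b & S c]].

End Triangles.

Section Derivation.
Context {R : realType}.
Notation C := R[i].
Implicit Types (z k : C) (f g : C -> C).

Lemma deriv_cst k z : is_derive z 1 (fun => k) (0 : C).
Proof. exact: (@is_derive_cst C C C k z 1). Qed.

Lemma deriv_id z : is_derive z 1 (fun w => w) (1 : C).
Proof. exact: (@is_derive_id C C z 1). Qed.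

Lemma deriv_add f g z (df dg : C) : is_derive z 1 f df -> is_derive z 1 g dg ->
  is_derive z 1 (fun w => f w + g w) (df + dg).
Proof. move=> hf hg; exact: (@is_deriveD C C C f g z 1 df dg hf hg). Qed.

Lemma deriv_sub f g z (df dg : C) : is_derive z 1 f df -> is_derive z 1 g dg ->
  is_derive z 1 (fun w => f w - g w) (df - dg).
Proof. move=> hf hg; exact: (@is_deriveB C C C f g z 1 df dg hf hg). Qed.

Lemma deriv_mul f g z (df dg : C) : is_derive z 1 f df -> is_derive z 1 g dg ->
  is_derive z 1 (fun w => f w * g w) (f z * dg + g z * df).
Proof. move=> hf hg; exact: (@is_deriveM C C f g z 1 df dg hf hg). Qed.

Lemma deriv_inv f z (df : C) : is_derive z 1 f df -> f z != 0 ->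
  is_derive z 1 (fun w => (f w)^-1) (- f z ^- 2 * df).
Proof.
move=> hf f0; have fd : derivable f z 1 by case: hf.
have := @derivableP _ _ _ _ _ _ (@derivableV C C f z 1 f0 fd).
by rewrite (@deriveV C C f z 1 f0 fd) derive_val.
Qed.

Lemma deriv_scale k f z (df : C) : is_derive z 1 f df ->
  is_derive z 1 (fun w => k * f w) (k * df).
Proof.
by move=> hf; have := deriv_mul (deriv_cst k z) hf; rewrite mulr0 addr0.
Qed.

Lemma is_derive_compC f (g : C -> C) z (df dg : C) : is_derive (g z) 1 f df ->
  is_derive z 1 g dg -> is_derive z 1 (fun w => f (g w)) (df * dg).
Proof.
move=> [/derivable1_diffP fd <-] [/derivable1_diffP gd <-].
have fg : differentiable (f \o g) z := differentiable_comp gd fd.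
apply: DeriveDef; first exact/derivable1_diffP.
have E := diff1E fd; rewrite derive1E in E.
apply: (etrans (deriveE (1 : C) fg)).
apply: (etrans (congr1 (fun F => F (1 : C)) (diff_comp gd fd))).
apply: (etrans (congr1 (fun F => F ('d g z 1)) E)).
apply: (etrans (congr1 (fun x => x *: 'D_1 f (g z)) (esym (deriveE (1 : C) gd)))).
exact: mulrC.
Qed.

End Derivation.

Section GoursatTheorem.
Context {R : realType}.
Notation C := R[i].
Implicit Types (a b c z w d : C) (f F G : C -> C) (S O : set C).

Definition holo S f := forall z, S z -> derivable f z 1.

Lemma derivable_continuousC f z : derivable f z 1 -> {for z, continuous f}.
Proof. by move=> /derivable1_diffP; exact: differentiable_continuous. Qed.

Lemma holo_continuous S f : holo S f -> continuous_on S f.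
Proof. by move=> fh z /fh; exact: derivable_continuousC. Qed.

Lemma affine_primitive (p q c : C) z :
  is_derive z 1 (fun w => p * w + q * ((w - c) ^+ 2 / 2)) (p + q * (z - c)).
Proof.
have dc := deriv_sub (deriv_id z) (deriv_cst c z).
have := deriv_add (deriv_scale p (deriv_id z)) (deriv_scale (q / 2) (deriv_mul dc dc)).
have key (u v : C) : q / 2 * (u * v) = q * (u * v / 2) by field.
under [X in is_derive _ _ X _ -> _]eq_fun do rewrite key -expr2.
by set D := _ + _; rewrite (_ : D = p + q * (z - c))// /D; field.
Qed.

(** Goursat: halving the triangle T repeatedly while keeping at least a quarter
of the integral leads to a point where f is nearly affine, and affine functions
integrate to 0. *)
Theorem goursat O f T : exhausted O -> holo O f -> tri_in O T -> tri_int f T = 0.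
Proof.
move=> exO fh OT; have [H [HO hc cH HT]] : exists S, [/\ S `<=` O, convexC S, closed S &
    tri_in S T] by case: T OT => [[a b] c] [Oa Ob Oc]; exact: exO.
have fc : continuous_on H f by move=> z /HO; exact: holo_continuous fh z.
have next U : exists V, tri_in H U -> V \in sub_triangles U /\
    normc (tri_int f U) <= 4 * normc (tri_int f V).
  have [HU|] := pselect (tri_in H U); last by exists U.
  by have [V VU le] := tri_int_large hc fc HU; exists V.
have [step stepP] := choice next.
pose s k := iter k step T.
have Hs k : tri_in H (s k).
  elim: k => [|k IH]; first exact: HT.
  by have [sub _] := stepP _ IH; exact: sub_triangles_in hc IH sub.
pose D k := perimeter (s k).
have DS k : D k.+1 = D k / 2.
  by have [sub _] := stepP _ (Hs k); exact: sub_triangles_perimeter sub.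
have Dk k : D k = D 0 / 2 ^+ k.
  by elim: k => [|k IH]; rewrite ?expr0 ?divr1// DS IH exprS invfM mulrA mulrAC.
have perim0 (U : C * C * C) : 0 <= perimeter U.
  by case: U => [[a b] c]; rewrite !addr_ge0 ?normc_ge0.
have Ik k : normc (tri_int f T) <= 4 ^+ k * normc (tri_int f (s k)).
  elim: k => [|k IH]; first by rewrite expr0 mul1r.
  have [_ le] := stepP _ (Hs k); apply: le_trans IH _.
  by rewrite exprSr -mulrA ler_wpM2l ?exprn_ge0.
pose v k := (s k).1.1.
have vnear k m : normc (v (k + m)%N - v k) <= 2 * D k - 2 * D (k + m)%N.
  elim: m => [|m IH]; first by rewrite addn0 !subrr normc0.
  rewrite addnS; apply: le_trans (normc_trans (v (k + m)%N) _ _) _.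
  have [sub _] := stepP _ (Hs (k + m)%N).
  have H1 : normc (v (k + m).+1 - v (k + m)%N) <= D (k + m)%N.
    exact: sub_triangles_vertex sub.
  by rewrite (DS (k + m)%N); move: IH H1; lra.
have [U [UU Uoo]] := ultraFilterLemma (@eventually_filter).
have Hv k : H (v k) by have := Hs k; rewrite /v; case: (s k) => [[a b] c] [].
have [l vl] : exists l : C, v k @[k --> U] --> l.
  apply: (@ultra_bounded_cvg R _ _ _ _ (2 * D 0 + normc (v 0%N))).
  apply: nearW => k; have := normc_add (v k - v 0%N) (v 0%N).
  have := vnear 0%N k; rewrite add0n subrK; have := perim0 (s k); rewrite -/(D k); lra.
have Hl : H l.
  apply: (@closed_cvg nat C U _ v H cH _ l vl).
  by near=> k; exact: Hv.
have lv k : normc (l - v k) <= 2 * D k.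
  apply: (cvg_normc_le (cvgB vl (cvg_cst (v k)))).
  apply: Uoo; exists k => // j /= kj.
  have := vnear k (j - k)%N; rewrite subnKC//.
  by have := perim0 (s j); rewrite -/(D j); lra.
have /is_deriveCP df : is_derive l 1 f ('D_1 f l) by apply/derivableP/fh/HO.
have D00 := perim0 T; rewrite -[perimeter T]/(D 0%N) in D00.
apply: normc_small => e0 e00.
pose e := e0 / (3 * (D 0%N + 1) ^+ 2).
have e_gt0 : 0 < e by rewrite divr_gt0// mulr_gt0// exprn_gt0//; lra.
have [r r0 rP] := df e e_gt0.
pose k := Num.Def.archi_bound (3 * D 0%N / r).
have kr : 3 * D k < r.
  have : 3 * D 0%N / r < 2 ^+ k by exact: upper_nthrootP.
  by rewrite (Dk k) mulrA ltr_pdivrMr// ltr_pdivrMr ?exprn_gt0// (mulrC r).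
pose A w := f l * w + 'D_1 f l * ((w - l) ^+ 2 / 2).
have side x y : seg x y `<=` H -> (forall w, seg x y w -> normc (w - v k) <= D k) ->
    normc (seg_int f x y - (A y - A x)) <= e * (3 * D k) * normc (y - x).
  move=> xyH xyD.
  apply: (@seg_int_near _ x y A f (fun w => f l + 'D_1 f l * (w - l))).
  - by move=> z /xyH; exact: fc.
  - by apply: is_derive_antider => z _; exact: affine_primitive.
  move=> w xyw; have wl : normc (w - l) <= 3 * D k.
    have := normc_trans (v k) w l; rewrite (normc_sub_sym (v k) l).
    by have := lv k; have := xyD w xyw; lra.
  have -> : f w - (f l + 'D_1 f l * (w - l)) = f w - f l - 'D_1 f l * (w - l) by ring.
  apply: le_trans (rP w _) _; first exact: le_lt_trans wl kr.
  by rewrite ler_pM2l.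
have : normc (tri_int f (s k)) <= e * (3 * D k) * D k.
  have := Hs k; have vkE : v k = (s k).1.1 by [].
  have DkE : D k = perimeter (s k) by [].
  case: (s k) vkE DkE => [[a b] c] /= vkE DkE [Ha Hb Hc].
  have n1 := normc_ge0 (a - b); have n2 := normc_ge0 (b - c).
  have n3 := normc_ge0 (c - a).
  have s1 := side a b (hc _ _ Ha Hb); have s2 := side b c (hc _ _ Hb Hc).
  have s3 := side c a (hc _ _ Hc Ha).
  have {s1}/s1 s1 : forall w, seg a b w -> normc (w - v k) <= D k.
    by move=> w /seg_dist; rewrite vkE DkE (normc_sub_sym b); lra.
  have {s2}/s2 s2 : forall w, seg b c w -> normc (w - v k) <= D k.
    move=> w /seg_dist; rewrite vkE DkE (normc_sub_sym c).
    by have := normc_trans b w a; rewrite (normc_sub_sym b a); lra.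
  have {s3}/s3 s3 : forall w, seg c a w -> normc (w - v k) <= D k.
    by move=> w; rewrite seg_sym => /seg_dist; rewrite vkE DkE; lra.
  have -> : seg_int f a b + seg_int f b c + seg_int f c a =
     (seg_int f a b - (A b - A a)) + (seg_int f b c - (A c - A b)) +
     (seg_int f c a - (A a - A c)) by ring.
  have := normc_add (seg_int f a b - (A b - A a) + (seg_int f b c - (A c - A b)))
    (seg_int f c a - (A a - A c)).
  have := normc_add (seg_int f a b - (A b - A a)) (seg_int f b c - (A c - A b)).
  move: s1 s2 s3; set m := e * (3 * D k); rewrite DkE !mulrDr (normc_sub_sym b) (normc_sub_sym c b).
  by rewrite (normc_sub_sym a c); lra.
move=> Hk; apply: le_trans (Ik k) _.
apply: (@le_trans _ _ (4 ^+ k * (e * (3 * D k) * D k))); first by rewrite ler_wpM2l ?exprn_ge0.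
have -> : 4 ^+ k * (e * (3 * D k) * D k) = e * (3 * D 0%N ^+ 2).
  rewrite (Dk k) (_ : 4 = 2 * 2 :> R); last by ring.
  have : (2 : R) ^+ k != 0 by rewrite expf_neq0.
  by rewrite exprMn; move: (2 ^+ k) => q q0; field.
rewrite /e mulrAC -mulrA ler_piMr// ?(ltW e00)//.
rewrite ler_pdivrMr ?mul1r; last by rewrite mulr_gt0// exprn_gt0//; lra.
by nra.
Unshelve. all: by end_near. Qed.

(** By Goursat the integral of f from a fixed base point is a primitive. *)
Theorem primitive_exists O f : open O -> convexC O -> exhausted O -> O !=set0 -> holo O f ->
  exists G, forall z, O z -> is_derive z 1 G (f z).
Proof.
move=> oO cO exO [p Op] fh; exists (seg_int f p) => z Oz.
have fc x y : O x -> O y -> continuous_on (seg x y) f.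
  by move=> Ox Oy w /(cO _ _ Ox Oy); exact: holo_continuous fh w.
apply/is_deriveCP => e e0.
have /continuousCP/(_ e e0)[d d0 dP] := holo_continuous fh Oz.
have [r r0 rO] := openCP oO Oz.
exists (Num.min d r); first by rewrite lt_min d0.
move=> w; rewrite lt_min => /andP[wd wr]; have Ow : O w by exact: rO.
have /= := @goursat O f (p, z, w) exO fh (And3 Op Oz Ow).
rewrite (@seg_int_sym _ p w); last exact: fc.
move=> E; have -> : seg_int f p w - seg_int f p z = seg_int f z w.
  by apply/eqP; rewrite -subr_eq0 -[0]oppr0 -E; apply/eqP; ring.
have -> : f z * (w - z) = f z * w - f z * z by ring.
apply: (@seg_int_near _ z w (fun x => f z * x) f (fun _ => f z)).
- exact: fc.
- by apply: is_derive_antider => x _; have := deriv_scale (f z) (deriv_id x); rewrite mulr1.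
- move=> x /seg_dist xz; apply/ltW/dP; exact: le_lt_trans xz wd.
Qed.

End GoursatTheorem.

(** * The exponential and the bound at the centre of a circle *)

Local Arguments normc : simpl never.

Section CircleBound.
Context {R : realType}.
Notation C := R[i].
Implicit Types (a b c z w d : C) (f F G : C -> C) (S O : set C).

Lemma zero_derivative_const O F : convexC O ->
  (forall z, O z -> is_derive z 1 F 0) -> forall z w, O z -> O w -> F z = F w.
Proof.
move=> cO dF z w Oz Ow.
have dF0 : antider_on (seg w z) F (fun => 0).
  by apply: is_derive_antider => x /(cO _ _ Ow Oz); exact: dF.
have H := mean_value_seg (M := 0) dF0; rewrite mul0r in H.
apply/eqP; rewrite -subr_eq0; apply/eqP/normc_le0; apply: H => x _.
by rewrite normc0.
Qed.

Definition cexp z : C := (expR (Re z))%:C * (cos (Im z) +i* sin (Im z)).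

Lemma normc_cexp z : normc (cexp z) = expR (Re z).
Proof.
rewrite normcM normc_real ger0_norm ?expR_ge0//.
by rewrite /normc /= cos2Dsin2 sqrtr1 mulr1.
Qed.

Lemma cexp_neq0 z : cexp z != 0.
Proof. by rewrite -normc_gt0 normc_cexp expR_gt0. Qed.

Lemma cexpD z w : cexp (z + w) = cexp z * cexp w.
Proof.
case: z w => [x y] [x' y']; rewrite /cexp /= expRD cosD sinD.
by apply/eqP; rewrite eq_complex /=; apply/andP; split; apply/eqP; ring.
Qed.

Lemma cexp0 : cexp 0 = 1.
Proof. by rewrite /cexp /= expR0 cos0 sin0 mul1r. Qed.

Lemma cexpN z : cexp (- z) = (cexp z)^-1.
Proof.
apply: (mulfI (cexp_neq0 z)); rewrite -cexpD subrr cexp0 mulfV//.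
exact: cexp_neq0.
Qed.

Lemma cexp_periodic z : cexp (z + 0 +i* (pi *+ 2)) = cexp z.
Proof.
case: z => x y; rewrite /cexp /= addr0.
by rewrite -[y + _]/(y + pi *+ 2) cosD2pi sinD2pi.
Qed.

Lemma is_derive_cexp z : is_derive z 1 cexp (cexp z).
Proof.
suff d0 : forall e : R, 0 < e -> exists2 r, 0 < r &
    forall h : C, normc h < r -> normc (cexp h - 1 - h) <= e * normc h.
  apply/is_deriveCP => e e0.
  have N0 : 0 < normc (cexp z) by rewrite normc_gt0 cexp_neq0.
  have [r r0 rP] := d0 (e / normc (cexp z)) (divr_gt0 e0 N0).
  exists r => // w /rP H.
  have -> : cexp w - cexp z - cexp z * (w - z) = cexp z * (cexp (w - z) - 1 - (w - z)).
    by rewrite !mulrBr -cexpD [z + (w - z)]addrC subrK mulr1.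
  by rewrite normcM mulrC -ler_pdivlMr// mulrAC.
move=> e e0; pose e' := Num.min 1 (e / 8).
have e'0 : 0 < e' by rewrite lt_min ltr01 divr_gt0.
have /is_deriveP/(_ _ e'0)/nbhs_normP[r1 /= r10 r1P] := @is_derive_expR R 0.
have /is_deriveP/(_ _ e'0)/nbhs_normP[r2 /= r20 r2P] := @is_derive_cos R 0.
have /is_deriveP/(_ _ e'0)/nbhs_normP[r3 /= r30 r3P] := @is_derive_sin R 0.
exists (Num.min (Num.min r1 r2) (Num.min r3 (e' / 2))).
  by rewrite !lt_min r10 r20 r30 divr_gt0.
move=> [x y]; rewrite !lt_min => /andP[/andP[h1 h2] /andP[h3 h4]].
have xh := normcRe (x +i* y); have yh := normcIm (x +i* y); rewrite /= in xh yh.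
set m := normc (x +i* y) in h1 h2 h3 h4 xh yh *.
have := r1P x; rewrite /= sub0r normrN subr0 expR0 mul1r => /(_ (le_lt_trans xh h1)) H1.
have := r2P y; rewrite /= sub0r normrN subr0 cos0 sin0 oppr0 mul0r subr0 => /(_ (le_lt_trans yh h2)) H2.
have := r3P y; rewrite /= sub0r normrN subr0 cos0 sin0 mul1r subr0 => /(_ (le_lt_trans yh h3)) H3.
have e'1 : e' <= 1 by rewrite ge_min lexx.
have e'8 : e' <= e / 8 by rewrite ge_min lexx orbT.
have m0 : 0 <= m by exact: normc_ge0.
have x1 := ler_norm x; have x2 := ler_norm (- x); rewrite normrN in x2.
have y1 := ler_norm y; have y2 := ler_norm (- y); rewrite normrN in y2.
have B1 : `|expR x - 1 - x| <= e' * m by apply: le_trans H1 _; rewrite ler_wpM2l// ltW.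
have B2 : `|cos y - 1| <= e' * m by apply: le_trans H2 _; rewrite ler_wpM2l// ltW.
have B3 : `|sin y - y| <= e' * m by apply: le_trans H3 _; rewrite ler_wpM2l// ltW.
have em : e' * m <= m by rewrite ler_piMl.
have em0 : 0 <= e * m by rewrite mulr_ge0// ltW.
have mm : m * m <= e' / 2 * m by rewrite ler_wpM2r// ltW.
have em8 : e' * m <= e / 8 * m by rewrite ler_wpM2r.
have E1 : `|expR x - 1| <= 2 * m.
  have -> : expR x - 1 = (expR x - 1 - x) + x by ring.
  by apply: le_trans (ler_normD _ _) _; lra.
have E2 : `|expR x| <= 2.
  have -> : expR x = (expR x - 1) + 1 by ring.
  by apply: le_trans (ler_normD _ _) _; rewrite normr1; lra.
apply: le_trans (normc_le_ReIm _) _ => /=.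
have -> : expR x * cos y - 0 * sin y - 1 - x = expR x * (cos y - 1) + (expR x - 1 - x).
  by ring.
have -> : expR x * sin y + 0 * cos y - 0 - y = expR x * (sin y - y) + (expR x - 1) * y.
  by ring.
have := ler_normD (expR x * (cos y - 1)) (expR x - 1 - x).
have := ler_normD (expR x * (sin y - y)) ((expR x - 1) * y).
rewrite !normrM.
have := ler_pM (normr_ge0 _) (normr_ge0 _) E2 B2.
have := ler_pM (normr_ge0 _) (normr_ge0 _) E2 B3.
have := ler_pM (normr_ge0 _) (normr_ge0 _) E1 yh.
by lra.
Qed.

Lemma normc_seg c a b z : seg a b z ->
  normc (z - c) <= Num.max (normc (a - c)) (normc (b - c)).
Proof.
move=> [t /andP[t0 t1] ->].
have -> : a + t%:C * (b - a) - c = (1 - t)%:C * (a - c) + t%:C * (b - c).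
  by rewrite rmorphB rmorph1; ring.
apply: le_trans (normc_add _ _) _; rewrite !normcM !normc_real.
rewrite !ger0_norm ?subr_ge0//; set m := Num.max _ _.
have am : normc (a - c) <= m by rewrite le_max lexx.
have bm : normc (b - c) <= m by rewrite le_max lexx orbT.
by nra.
Qed.

Lemma disc_convex c (r : R) : convexC (disc c r).
Proof.
by move=> a b ar br z /(normc_seg c) /le_lt_trans; apply; rewrite gt_max; exact/andP.
Qed.

Lemma disc_exhausted c (r : R) : exhausted (disc c r).
Proof.
move=> x y z xr yr zr; pose m := Num.max (normc (x - c)) (Num.max (normc (y - c)) (normc (z - c))).
exists (cdisc c m); split.
- by move=> w wm; apply: le_lt_trans wm _; rewrite !gt_max; apply/and3P.
- move=> a b am bm w /(normc_seg c) /le_trans; apply.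
  by rewrite ge_max; exact/andP.
- by apply: compact_closed; [exact: norm_hausdorff|exact: compact_cdisc].
by split; rewrite /cdisc /= !le_max lexx ?orbT.
Qed.

(** The modulus at the centre is bounded by the modulus on a circle. In the
logarithmic coordinate, f (c + exp z) has a primitive G on a half-plane and
G (z + 2 pi i) - G z has derivative 0; this constant is 2 pi i f(c), as small
circles show. This bound takes the place of Cauchy's formula. *)
Theorem center_le_circle f c (r s M : R) : 0 < s -> s < r ->
  {for c, continuous f} ->
  (forall z, 0 < normc (z - c) -> normc (z - c) < r -> derivable f z 1) ->
  (forall z, normc (z - c) = s -> normc (f z) <= M) -> normc (f c) <= M.
Proof.
move=> s0 sr fc fh fM; have r0 := lt_trans s0 sr.
pose O : set C := [set z | Re z < ln r].
pose F z := f (c + cexp z).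
have normce z : normc (c + cexp z - c) = expR (Re z).
  by rewrite addrAC subrr add0r normc_cexp.
have FO : holo O F.
  move=> z Oz; have [] : is_derive z 1 F ('D_1 f (c + cexp z) * cexp z).
    apply: is_derive_compC.
      apply/derivableP/fh; rewrite normce ?expR_gt0//.
      by move: Oz; rewrite /O /= -ltr_expR lnK// posrE.
    by have := deriv_add (deriv_cst c z) (is_derive_cexp z); rewrite add0r.
  by [].
have Re_seg (a b z : C) : seg a b z -> Re z <= Num.max (Re a) (Re b).
  move=> [t /andP[t0 t1] ->]; set m := Num.max _ _.
  have am : Re a <= m by rewrite le_max lexx.
  have bm : Re b <= m by rewrite le_max lexx orbT.
  by move: am bm; case: a b @m => [x y] [x' y'] m /=; nra.
have cO : convexC O.
  by move=> a b Oa Ob z /Re_seg /le_lt_trans; apply; rewrite gt_max; exact/andP.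
have exO : exhausted O.
  move=> a b d Oa Ob Od; pose m := Num.max (Re a) (Num.max (Re b) (Re d)).
  exists [set z | Re z <= m]; split.
  - by move=> z /= zm; apply: le_lt_trans zm _; rewrite !gt_max; apply/and3P.
  - by move=> x y xm ym z /Re_seg /le_trans; apply; rewrite ge_max; exact/andP.
  - rewrite -openC openE => z /= /negP; rewrite -ltNge => zm.
    apply/nbhsCP; exists (Re z - m); first by rewrite subr_gt0.
    move=> w; rewrite /disc /= => wz; apply/negP; rewrite -ltNge.
    have := normcRe (w - z); have := ler_norm (- Re (w - z)); rewrite normrN.
    by case: w z zm wz => [? ?] [? ?] /=; lra.
  by split; rewrite /= !le_max lexx ?orbT.
have oO : open O.
  rewrite openE => z Oz; apply/nbhsCP; exists (ln r - Re z); first by rewrite subr_gt0.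
  move=> w; rewrite /disc /O /= => wz.
  have := normcRe (w - z); have := ler_norm (Re (w - z)).
  by case: w z wz {Oz} => [? ?] [? ?] /=; lra.
have Oln t : 0 < t -> t < r -> O ((ln t)%:C) by move=> t0 tr; rewrite /O /= ltr_ln ?posrE.
have [G dG] : exists G, forall z, O z -> is_derive z 1 G (F z).
  by apply: primitive_exists => //; exists ((ln s)%:C); exact: Oln.
pose p : C := 0 +i* (pi *+ 2).
have pE : p = (pi *+ 2)%:C * 'i%C by apply/eqP; rewrite eq_complex /=; apply/andP; split; apply/eqP; ring.
have pi20 : 0 < pi *+ 2 :> R by rewrite mulrn_wgt0// pi_gt0.
have normp : normc p = pi *+ 2.
  by rewrite /normc /= expr0n add0r sqrtr_sqr ger0_norm// ltW.
have Op z : O z -> O (z + p) by rewrite /O; case: z => x y /=; rewrite addr0.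
have dL z : O z -> is_derive z 1 (fun w => G (w + p) - G w) 0.
  move=> Oz; have d1 : is_derive z 1 (fun w => G (w + p)) (F (z + p) * 1).
    apply: is_derive_compC; first exact/dG/Op.
    by have := deriv_add (deriv_id z) (deriv_cst p z); rewrite addr0.
  have := is_deriveB d1 (dG z Oz); rewrite mulr1 /F cexp_periodic subrr.
  by [].
have Lc := zero_derivative_const cO dL.
have segp (t : R) z : 0 < t -> t < r -> seg (ln t)%:C ((ln t)%:C + p) z -> O z /\ expR (Re z) = t.
  move=> t0 tr [u _ ->]; rewrite addrAC subrr add0r pE.
  have E : Re ((ln t)%:C + u%:C * ((pi *+ 2)%:C * 'i%C)) = ln t by rewrite /=; ring.
  have ltE : Re ((ln t)%:C + u%:C * ((pi *+ 2)%:C * 'i%C)) < ln r.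
    by rewrite E ltr_ln ?posrE.
  by split; [exact: ltE|rewrite E lnK ?posrE].
have bound (t N : R) (k : C) : 0 < t -> t < r ->
    (forall z, normc (z - c) = t -> normc (f z - k) <= N) ->
    normc (G ((ln t)%:C + p) - G (ln t)%:C - k * p) <= N * (pi *+ 2).
  move=> t0 tr tN; set a := (ln t)%:C.
  have dGk : antider_on (seg a (a + p)) (fun z => G z - k * z) (fun z => F z - k).
    apply: antider_onB; first by apply: is_derive_antider => z zs; apply: dG; have [] := segp _ _ t0 tr zs.
    by apply: is_derive_antider => x _; have := deriv_scale k (deriv_id x); rewrite mulr1.
  have := mean_value_seg (M := N) dGk.
  rewrite (_ : a + p - a = p) ?normp; last by ring.
  rewrite (_ : G (a + p) - k * (a + p) - (G a - k * a) = G (a + p) - G a - k * p); last by ring.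
  by apply=> z zs; have [_ zt] := segp _ _ t0 tr zs; apply: tN; rewrite normce.
set a := (ln s)%:C; set L := G (a + p) - G a.
have LE : L = f c * p.
  apply/eqP; rewrite -subr_eq0; apply/eqP/normc_small => e e0.
  have /continuousCP/(_ _ (divr_gt0 e0 pi20))[d d0 dP] := fc.
  pose t := Num.min (d / 2) s.
  have t0 : 0 < t by rewrite lt_min s0 divr_gt0.
  have tr : t < r by rewrite gt_min sr orbT.
  have := bound t (e / (pi *+ 2)) (f c) t0 tr.
  rewrite divfK ?lt0r_neq0// (_ : G ((ln t)%:C + p) - G (ln t)%:C = L); last first.
    by apply: Lc; exact: Oln.
  apply=> z zt; apply/ltW/dP; rewrite zt gt_min; apply/orP; left; lra.
have := bound s M 0 s0 sr; rewrite -/a -/L mul0r subr0 LE normcM normp ler_pM2r//; apply.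
by move=> z /fM; rewrite subr0.
Qed.

End CircleBound.

(** * Cauchy estimates and limits of bounded families *)

Section CauchyEstimates.
Context {R : realType}.
Notation C := R[i].
Implicit Types (a b c z w d : C) (f g F G : C -> C) (S O : set C) (r s M : R).

Definition cder f z : C := 'D_1 f z.

Lemma cderP f z : derivable f z 1 -> is_derive z 1 f (cder f z).
Proof. exact: derivableP. Qed.

Lemma cderE f z d : is_derive z 1 f d -> cder f z = d.
Proof. by move=> H; rewrite /cder derive_val. Qed.

Lemma holoD O f g : holo O f -> holo O g -> holo O (fun w => f w + g w).
Proof. by move=> hf hg z Oz; case: (deriv_add (cderP (hf z Oz)) (cderP (hg z Oz))). Qed.

Lemma holoB O f g : holo O f -> holo O g -> holo O (fun w => f w - g w).
Proof. by move=> hf hg z Oz; case: (deriv_sub (cderP (hf z Oz)) (cderP (hg z Oz))). Qed.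

Lemma holoM O f g : holo O f -> holo O g -> holo O (fun w => f w * g w).
Proof. by move=> hf hg z Oz; case: (deriv_mul (cderP (hf z Oz)) (cderP (hg z Oz))). Qed.

Lemma holoV O f : holo O f -> (forall z, O z -> f z != 0) ->
  holo O (fun w => (f w)^-1).
Proof. by move=> hf f0 z Oz; case: (deriv_inv (cderP (hf z Oz)) (f0 z Oz)). Qed.

Lemma holo_cst O k : holo O (fun => k).
Proof. by move=> z _; case: (deriv_cst k z). Qed.

Lemma holoX O f n : holo O f -> holo O (fun w => f w ^+ n).
Proof.
move=> fh; elim: n => [|n IH]; first exact: holo_cst.
by have := holoM fh IH; under eq_fun do rewrite -exprS.
Qed.

Lemma holo_sum O (I : Type) (s : seq I) (h : I -> C -> C) :
  (forall i, holo O (h i)) -> holo O (fun w => \sum_(i <- s) h i w).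
Proof.
move=> hh; elim: s => [|i s IH].
  by have := @holo_cst O 0; under [X in _ -> holo _ X]eq_fun do rewrite big_nil.
by have := holoD (hh i) IH; under [X in _ -> holo _ X]eq_fun do rewrite big_cons.
Qed.

Lemma is_derive_holo O f g : (forall z, O z -> is_derive z 1 f (g z)) -> holo O f.
Proof. by move=> H z /H[]. Qed.

Lemma is_derive_near f g z d : (\forall w \near z, f w = g w) ->
  is_derive z 1 f d -> is_derive z 1 g d.
Proof.
move=> fg /is_deriveP H; apply/is_deriveP => e /H H1; near=> w.
have <- : f w = g w by near: w.
by rewrite -(nbhs_singleton fg); near: w.
Unshelve. all: by end_near. Qed.

Lemma holo_sub S O f : S `<=` O -> holo O f -> holo S f.
Proof. by move=> SO H z /SO; exact: H. Qed.

Definition dquot f c w : C := if w == c then cder f c else (f w - f c) / (w - c).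

Lemma dquotE f c w : f w = f c + (w - c) * dquot f c w.
Proof.
rewrite /dquot; case: eqVneq => [->|wc]; first by rewrite subrr mul0r addr0.
by rewrite mulrC divfK ?subr_eq0// addrC subrK.
Qed.

Lemma dquot_continuous f c : derivable f c 1 -> {for c, continuous (dquot f c)}.
Proof.
move=> /cderP/is_deriveCP df; apply/continuousCP => e e0.
have e20 : 0 < e / 2 by rewrite divr_gt0.
have [r r0 rP] := df _ e20; exists r => // w wr.
rewrite /dquot eqxx; case: eqVneq => [_|wc]; first by rewrite subrr normc0.
have wc0 : w - c != 0 by rewrite subr_eq0.
have := rP w wr; rewrite -ler_pdivrMr ?normc_gt0// -normcV -normcM.
by rewrite mulrBl mulfK//; lra.
Qed.

Lemma dquot_derivable f c z : derivable f z 1 -> z != c ->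
  derivable (dquot f c) z 1.
Proof.
move=> df zc; have zc0 : z - c != 0 by rewrite subr_eq0.
have d1 : derivable (fun w => (f w - f c) / (w - c)) z 1.
  have := deriv_mul (deriv_sub (cderP df) (deriv_cst (f c) z))
    (deriv_inv (deriv_sub (deriv_id z) (deriv_cst c z)) zc0).
  by case.
suff [] : is_derive z 1 (dquot f c) (cder (fun w => (f w - f c) / (w - c)) z) by [].
apply: is_derive_near (cderP d1); apply/nbhsCP.
exists (normc (z - c)); first by rewrite normc_gt0.
move=> w wz; rewrite /dquot; case: eqVneq => // wc.
by move: wz; rewrite /disc /= wc normc_sub_sym ltxx.
Qed.

(** The bound at the centre of a circle, applied to the difference quotient. *)
Lemma cauchy_bound f c r M : 0 < r -> holo (disc c r) f ->
  (forall z, disc c r z -> normc (f z) <= M) -> normc (cder f c) <= 4 * M / r.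
Proof.
move=> r0 fh fM.
have cc : disc c r c by exact: disc_center.
have -> : cder f c = dquot f c c by rewrite /dquot eqxx.
apply: (@center_le_circle _ (dquot f c) c r (r / 2)).
- by rewrite divr_gt0.
- by lra.
- exact/dquot_continuous/fh.
- by move=> z zc zr; apply: dquot_derivable; [exact: fh|rewrite -subr_eq0 -normc_gt0].
move=> z zs; have zc : z != c.
  by rewrite -subr_eq0 -normc_gt0 zs divr_gt0.
rewrite /dquot (negPf zc) normcM normcV zs ler_pdivrMr ?divr_gt0//.
have -> : 4 * M / r * (r / 2) = M + M by field; rewrite lt0r_neq0.
apply: le_trans (normc_sub _ _) _; apply: lerD; apply: fM => //.
by rewrite /disc /= zs; lra.
Qed.

Lemma lipschitz_bound f c r M : 0 < r -> holo (disc c r) f ->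
  (forall z, disc c r z -> normc (f z) <= M) ->
  forall z w, disc c (r / 2) z -> disc c (r / 2) w ->
    normc (f z - f w) <= 8 * M / r * normc (z - w).
Proof.
move=> r0 fh fM z w zr wr.
have sub x : disc c (r / 2) x -> disc x (r / 2) `<=` disc c r.
  move=> xr; apply: subset_trans (@disc_in _ x c r); apply: disc_le.
  by move: xr; rewrite /disc /=; lra.
apply: (@mean_value_seg _ w z f (cder f)).
  apply: is_derive_antider => x /(disc_convex wr zr) xr; apply/cderP/fh.
  by apply: sub xr _ _; apply: disc_center; rewrite divr_gt0.
move=> x /(disc_convex wr zr) xr.
have -> : 8 * M / r = 4 * M / (r / 2) by field; rewrite lt0r_neq0.
apply: cauchy_bound; first by rewrite divr_gt0.
- by apply: holo_sub fh; exact: sub.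
- by move=> y /(sub _ xr); exact: fM.
Qed.

Definition diffq f (h z : C) : C := (f (z + h) - f z) / h.

Lemma diffq_holo f c r h : 0 < r -> holo (disc c r) f -> normc h < r / 4 ->
  holo (disc c (r / 4)) (diffq f h).
Proof.
move=> r0 fh hr z zr.
have dfz : derivable f z 1 by apply: fh; apply: disc_le zr; lra.
have dz : derivable f (z + h) 1.
  apply: fh; rewrite /disc /= in zr *; have := normc_add (z - c) h.
  by rewrite (_ : z - c + h = z + h - c); [lra | ring].
have dh := is_derive_compC (g := fun w => w + h) (cderP dz) (deriv_add (deriv_id z) (deriv_cst h z)).
by case: (deriv_mul (deriv_sub dh (cderP dfz)) (deriv_cst h^-1 z)).
Qed.

Lemma diffq_bound f c r M h : 0 < r -> holo (disc c r) f ->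
  (forall z, disc c r z -> normc (f z) <= M) -> h != 0 -> normc h < r / 4 ->
  forall z, disc c (r / 4) z -> normc (diffq f h z) <= 8 * M / r.
Proof.
move=> r0 fh fM h0 hr z zr.
rewrite /diffq normcM normcV ler_pdivrMr ?normc_gt0//.
rewrite -[X in _ <= _ * normc X](addrK z h) [h + z]addrC.
apply: (lipschitz_bound r0 fh fM); last by apply: disc_le zr; lra.
rewrite /disc /= in zr *; have := normc_add (z - c) h.
by rewrite (_ : z - c + h = z + h - c); [lra|ring].
Qed.

Lemma diffq_cvg f z : derivable f z 1 ->
  diffq f h z @[h --> (0 : C)^'] --> cder f z.
Proof.
move=> /cderP/is_deriveCP df; apply/cvgCP => e e0.
have e20 : 0 < e / 2 by rewrite divr_gt0.
have [r r0 rP] := df _ e20; apply/nbhsCP; exists r => // h.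
rewrite /disc /= subr0 => hr h0.
have := rP (z + h); rewrite addrAC subrr add0r => /(_ hr).
rewrite -ler_pdivrMr ?normc_gt0// -normcV -normcM mulrBl mulfK//.
by rewrite /diffq; lra.
Qed.

(** The difference quotients of f are holomorphic and bounded, uniformly in the
step h, so that they have a common Lipschitz constant. *)
Lemma derivative_lipschitz f c r M : 0 < r -> holo (disc c r) f ->
  (forall z, disc c r z -> normc (f z) <= M) ->
  forall z w, disc c (r / 8) z -> disc c (r / 8) w ->
    normc (cder f z - cder f w) <= 256 * M / r ^+ 2 * normc (z - w).
Proof.
move=> r0 fh fM z w zr wr.
have dz x : disc c (r / 8) x -> derivable f x 1.
  by move=> xr; apply: fh; apply: disc_le xr; lra.
apply: (cvg_normc_le (cvgB (diffq_cvg (dz z zr)) (diffq_cvg (dz w wr)))).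
have r40 : 0 < r / 4 by rewrite divr_gt0.
apply/nbhsCP; exists (r / 4) => // h; rewrite /disc /= subr0 => hr h0.
have := lipschitz_bound r40 (diffq_holo r0 fh hr) (diffq_bound r0 fh fM h0 hr).
move=> /(_ z w); have -> : r / 4 / 2 = r / 8 by field.
move=> /(_ zr wr) /le_trans; apply.
rewrite ler_wpM2r ?normc_ge0// le_eqVlt; apply/orP; left; apply/eqP; field.
by rewrite lt0r_neq0.
Qed.

Lemma taylor1_bound f c r M : 0 < r -> holo (disc c r) f ->
  (forall z, disc c r z -> normc (f z) <= M) ->
  forall w, disc c (r / 8) w ->
    normc (f w - f c - cder f c * (w - c)) <=
      256 * M / r ^+ 2 * normc (w - c) ^+ 2.
Proof.
move=> r0 fh fM w wr; have cr : disc c (r / 8) c by apply: disc_center; lra.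
have sub : seg c w `<=` disc c (r / 8) := disc_convex cr wr.
have -> : f w - f c - cder f c * (w - c) =
  (f w - cder f c * w) - (f c - cder f c * c) by ring.
rewrite expr2 mulrA; apply: (@mean_value_seg _ c w (fun z => f z - cder f c * z)
  (fun z => cder f z - cder f c)).
  apply: antider_onB; apply: is_derive_antider => x /sub xr.
    by apply/cderP/fh; apply: disc_le xr; lra.
  by have := deriv_scale (cder f c) (deriv_id x); rewrite mulr1.
move=> x cwx; apply: le_trans (derivative_lipschitz r0 fh fM (sub _ cwx) cr) _.
have M0 : 0 <= M by apply: le_trans (normc_ge0 _) (fM c (disc_center _ _)).
by rewrite ler_wpM2l ?seg_dist// !mulr_ge0// invr_ge0 sqr_ge0.
Qed.

Lemma locally_bounded f z : {for z, continuous f} ->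
  exists2 r, 0 < r & forall w, disc z r w -> normc (f w) <= normc (f z) + 1.
Proof.
move=> /continuousCP/(_ 1 ltr01)[r r0 rP]; exists r => // w /rP.
by have := normc_dist (f w) (f z); lra.
Qed.

Section Weierstrass.
Context {T : Type} {U : set_system T} {UU : UltraFilter U}.
Implicit Types (phi : T -> C -> C).

(** The situation produced by Montel's theorem. *)
Definition bounded_limit phi g c r M := [/\ 0 < r,
  \forall t \near U, holo (disc c r) (phi t),
  \forall t \near U, forall z, disc c r z -> normc (phi t z) <= M &
  forall z, disc c r z -> phi t z @[t --> U] --> g z].

Lemma bounded_limit_sub phi g c r M z : bounded_limit phi g c r M -> disc c r z ->
  bounded_limit phi g z (r - normc (z - c)) M.
Proof.
move=> [r0 ph pM pg] zr; have sub := @disc_in _ z c r; split.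
- by rewrite subr_gt0.
- by apply: filterS ph => t; exact: holo_sub.
- by apply: filterS pM => t h w /sub; exact: h.
- by move=> w /sub; exact: pg.
Qed.

(** The quadratic remainder estimate is uniform in the family, so it passes to
the limit. *)
Lemma weierstrass_center phi g c r M : bounded_limit phi g c r M ->
  derivable g c 1 /\ cder (phi t) c @[t --> U] --> cder g c.
Proof.
move=> [r0 ph pM pg]; have cr : disc c r c by exact: disc_center.
have [l dl] : exists l : C, cder (phi t) c @[t --> U] --> l.
  apply: (@ultra_bounded_cvg _ _ _ _ _ (4 * M / r)).
  by move: ph pM; apply: filterS2 => t; exact: cauchy_bound.
suff gl : is_derive c 1 g l by rewrite (cderE gl); split; [case: gl|].
pose K := 256 * M / r ^+ 2.
have bound w : disc c (r / 8) w -> normc (g w - g c - l * (w - c)) <= K * normc (w - c) ^+ 2.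
  move=> wr; have wr' : disc c r w by apply: disc_le wr; lra.
  apply: (cvg_normc_le (cvgB (cvgB (pg w wr') (pg c cr)) (cvgM dl (cvg_cst (w - c))))).
  by move: ph pM; apply: filterS2 => t h1 h2; exact: taylor1_bound.
apply/is_deriveCP => e e0.
have K1 : 0 < `|K| + 1 by have := normr_ge0 K; lra.
exists (Num.min (r / 8) (e / (`|K| + 1))); first by rewrite lt_min !divr_gt0.
move=> w; rewrite lt_min (ltr_pdivlMr _ _ K1) => /andP[w1 w2].
apply: le_trans (bound w w1) _; rewrite expr2 mulrA ler_wpM2r ?normc_ge0//.
by have := ler_norm K; have := normc_ge0 (w - c); nra.
Qed.

Lemma weierstrass phi g c r M : bounded_limit phi g c r M -> holo (disc c r) g.
Proof. by move=> pg z /(bounded_limit_sub pg)/weierstrass_center[]. Qed.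

Lemma locally_uniform_cvg phi g c r M : bounded_limit phi g c r M ->
  forall e, 0 < e -> exists2 d : R, 0 < d & \forall t \near U,
    forall w, normc (w - c) < d -> normc (phi t w - g w) < e.
Proof.
move=> lim e e0; have [r0 ph pM pg] := lim; have cr : disc c r c by exact: disc_center.
have e30 : 0 < e / 3 by rewrite divr_gt0.
have /continuousCP/(_ _ e30)[d1 d10 d1P] := holo_continuous (weierstrass lim) cr.
pose K := 8 * M / r; have K1 : 0 < `|K| + 1 by have := normr_ge0 K; lra.
exists (Num.min (r / 2) (Num.min d1 (e / 3 / (`|K| + 1)))).
  by rewrite !lt_min d10 !divr_gt0.
move/cvgCP: (pg c cr) => /(_ _ e30).
move: ph pM; apply: filterS3 => t ph pM pc w.
rewrite !lt_min (ltr_pdivlMr _ _ K1) => /andP[w1 /andP[w2 w3]].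
have cr2 : disc c (r / 2) c by apply: disc_center; rewrite divr_gt0.
have lip := lipschitz_bound r0 ph pM w1 cr2; rewrite -/K in lip.
have lip' : normc (phi t w - phi t c) < e / 3.
  apply: le_lt_trans lip _; apply: le_lt_trans w3; rewrite mulrC ler_wpM2l ?normc_ge0//.
  by have := ler_norm K; lra.
have := normc_trans (phi t c) (phi t w) (g w); have := normc_trans (g c) (phi t c) (g w).
by rewrite (normc_sub_sym (g c) (g w)); have := d1P w w2; lra.
Qed.

End Weierstrass.

(** The difference quotients of f are holomorphic, uniformly bounded, and
converge to its derivative. *)
Theorem holo_cder O f : open O -> holo O f -> holo O (cder f).
Proof.
move=> oO fh c Oc; have [r1 r10 r1O] := openCP oO Oc.
have [r2 r20 r2P] := locally_bounded (holo_continuous fh Oc).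
pose r := Num.min r1 r2; have r0 : 0 < r by rewrite lt_min r10.
have fr : holo (disc c r) f.
  by move=> z zr; apply/fh/r1O; apply: disc_le zr; rewrite ge_min lexx.
have fM z : disc c r z -> normc (f z) <= normc (f c) + 1.
  by move=> zr; apply: r2P; apply: disc_le zr; rewrite ge_min lexx orbT.
have [U [UU U0]] := ultraFilterLemma (Proper_dnbhs_numFieldType (0 : C)).
have small : \forall h \near U, normc h < r / 4 /\ h != 0.
  apply: U0; apply/nbhsCP; exists (r / 4); first by rewrite divr_gt0.
  by move=> h; rewrite /disc /= subr0.
have r40 : 0 < r / 4 by rewrite divr_gt0.
have lim : bounded_limit (U := U) (diffq f) (cder f) c (r / 4) (8 * (normc (f c) + 1) / r).
  split=> //; [by apply: filterS small => h [hr _]; exact: diffq_holo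
    |by apply: filterS small => h [hr h0]; exact: diffq_bound|].
  move=> z zr; apply: cvg_trans (diffq_cvg (fr z _)); first exact: cvg_app U0.
  by apply: disc_le zr; lra.
by case: (weierstrass_center lim).
Qed.

(** Removable singularity: the derivative of the difference quotient at its
centre is half the second derivative of f. *)
Theorem holo_dquot O f c : open O -> O c -> holo O f -> holo O (dquot f c).
Proof.
move=> oO Oc fh z Oz; have [->|zc] := eqVneq z c; last first.
  by apply: dquot_derivable => //; exact: fh.
have f'h := holo_cder oO fh; pose k := cder (cder f) c.
suff [] : is_derive c 1 (dquot f c) (k / 2) by [].
apply/is_deriveCP => e e0.
have /cderP/is_deriveCP/(_ e e0)[r1 r10 r1P] := f'h c Oc.
have [r2 r20 r2O] := openCP oO Oc.
exists (Num.min r1 r2); first by rewrite lt_min r10.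
move=> w; rewrite lt_min => /andP[w1 w2].
have [->|wc] := eqVneq w c; first by rewrite !subrr mulr0 subrr normc0 mulr0.
have wc0 : w - c != 0 by rewrite subr_eq0.
have nwc0 : 0 < normc (w - c) by rewrite normc_gt0.
have -> : dquot f c w - dquot f c c - k / 2 * (w - c) =
    ((f w - (cder f c * w + k * ((w - c) ^+ 2 / 2))) -
     (f c - (cder f c * c + k * ((c - c) ^+ 2 / 2)))) / (w - c).
  by rewrite /dquot eqxx (negPf wc); field.
rewrite normcM normcV ler_pdivrMr//.
have sub : seg c w `<=` disc c r2 by exact: disc_convex (disc_center _ r20) w2.
apply: (@mean_value_seg _ c w (fun z => f z - (cder f c * z + k * ((z - c) ^+ 2 / 2)))
  (fun z => cder f z - (cder f c + k * (z - c)))).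
  apply: antider_onB; apply: is_derive_antider => x xs; last exact: affine_primitive.
  by apply/cderP/fh/r2O/sub.
move=> x xs; rewrite opprD addrA.
apply: le_trans (r1P x _) _; first exact: le_lt_trans (seg_dist xs) w1.
by rewrite ler_wpM2l ?seg_dist ?ltW.
Qed.

End CauchyEstimates.

(** * Zeros, Liouville's theorem and the maximum principle *)

Section IdentityTheorem.
Context {R : realType}.
Notation C := R[i].
Implicit Types (a b c z w d : C) (f g F G : C -> C) (S O : set C) (r s M : R).

Lemma convexC_connected S : convexC S -> connected S.
Proof.
move=> cS; have [[p Sp]|S0] := pselect (S !=set0); last first.
  have -> : S = set0 by apply/seteqP; split=> // z Sz; case: S0; exists z.
  exact: connected0.
have -> : S = \bigcup_(z in S) seg p z.
  apply/seteqP; split=> [z Sz|z [w Sw]]; first by exists z => //; exact: seg_r.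
  exact: cS.
apply: bigcup_connected; first by exists p => z _; exact: seg_l.
move=> z _; have -> : seg p z = (fun t : R => p + t%:C * (z - p)) @` `[0, 1].
  apply/seteqP; split=> w [t].
    by move=> t01 ->; exists t => //; rewrite /= in_itv.
  by rewrite /= in_itv /= => t01 <-; exists t.
apply: connected_continuous_connected; first exact: segment_connected.
apply: continuous_subspaceT => t; apply/(@cvgCP _ _ (nbhs t)) => e e0.
have N0 : 0 < normc (z - p) + 1 by have := normc_ge0 (z - p); lra.
apply/nbhs_normP; exists (e / (normc (z - p) + 1)); first by rewrite /= divr_gt0.
move=> s /=; rewrite ltr_pdivlMr// => ts.
have -> : p + s%:C * (z - p) - (p + t%:C * (z - p)) = (s - t)%:C * (z - p).
  by rewrite rmorphB; ring.
rewrite normcM normc_real distrC; apply: le_lt_trans ts.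
by rewrite ler_wpM2l// lerDl.
Qed.

Definition germ0 f z := \forall w \near z, f w = 0.

(** Dividing repeatedly by w - c either ends with a nonvanishing factor, or
gives bounds C^k |w - c|^k on f near c for every k. *)
Lemma order_or_germ0 f c r : 0 < r -> holo (disc c r) f -> germ0 f c \/
  exists k g, [/\ holo (disc c r) g, g c != 0 &
    forall w, f w = (w - c) ^+ k * g w].
Proof.
move=> r0 fh; have [H|noorder] := pselect (exists k g, [/\ holo (disc c r) g,
    g c != 0 & forall w, f w = (w - c) ^+ k * g w]); first by right.
left; have cr : disc c r c by exact: disc_center.
have factor k : exists2 g, holo (disc c r) g & forall w, f w = (w - c) ^+ k * g w.
  elim: k => [|k [g gh fg]]; first by exists f => // w; rewrite expr0 mul1r.
  have gc : g c = 0.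
    by apply/eqP; apply: contrapT => /negP gc; apply: noorder; exists k, g.
  exists (dquot g c); first by apply: holo_dquot => //; exact: open_disc.
  by move=> w; rewrite fg (dquotE g c w) gc add0r mulrA -exprSr.
have [r2 r20 fM] := locally_bounded (holo_continuous fh cr).
pose M := normc (f c) + 1; have M0 : 0 < M by have := normc_ge0 (f c); rewrite /M; lra.
pose r1 := Num.min r r2; have r10 : 0 < r1 by rewrite lt_min r0.
have r1r : r1 <= r by rewrite ge_min lexx.
have r1r2 : r1 <= r2 by rewrite ge_min lexx orbT.
pose s := r1 / 2; have s0 : 0 < s by rewrite divr_gt0.
apply/nbhsCP; exists (s / 4); first by rewrite divr_gt0.
move=> z; rewrite /disc /= => zs.
have zc0 := normc_ge0 (z - c).
have bound k : normc (f z) <= M * (3^-1) ^+ k.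
  have [g gh fg] := factor k.
  have gz : normc (g z) <= M / (3 / 4 * s) ^+ k.
    apply: (@center_le_circle _ g z (s + s / 2) s).
    - by [].
    - by lra.
    - apply: (holo_continuous gh); rewrite /disc /=; move: zs; rewrite /s; lra.
    - move=> w _ wz; apply: gh; rewrite /disc /=; have := normc_trans z w c.
      by move: zs wz; rewrite /s; lra.
    move=> w wz; have wc : 3 / 4 * s <= normc (w - c).
      have := normc_dist (w - z) (c - z); rewrite (normc_sub_sym c z).
      by rewrite (_ : w - z - (c - z) = w - c); [lra|ring].
    have wc0 : 0 < normc (w - c) by apply: lt_le_trans wc; lra.
    have wr2 : disc c r2 w.
      by rewrite /disc /=; have := normc_trans z w c; move: zs; rewrite /s in wz *; lra.
    have := fM w wr2; rewrite fg normcM normcX mulrC -ler_pdivlMr ?exprn_gt0// => H.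
    apply: le_trans H _; rewrite ler_pM2l// lef_pV2 ?posrE ?exprn_gt0//; last by lra.
    by rewrite lerXn2r ?nnegrE ?normc_ge0//; lra.
  rewrite fg normcM normcX.
  apply: (@le_trans _ _ ((s / 4) ^+ k * (M / (3 / 4 * s) ^+ k))).
    by rewrite ler_pM ?exprn_ge0 ?normc_ge0// lerXn2r ?nnegrE// ?ltW//; lra.
  rewrite mulrCA -exprVn -exprMn (_ : s / 4 / (3 / 4 * s) = 3^-1)//.
  by field; rewrite lt0r_neq0.
apply: normc_small => e e0.
pose k := Num.Def.archi_bound (M / e).
have k2 : M / e < 2 ^+ k by exact: upper_nthrootP.
apply: le_trans (bound k) _; rewrite exprVn ler_pdivrMr ?exprn_gt0//.
move: k2; rewrite ltr_pdivrMr// => /ltW /le_trans; apply.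
by rewrite mulrC ler_pM2l// lerXn2r ?nnegrE//; lra.
Qed.

Lemma germ0_near f z : germ0 f z -> exists2 e, 0 < e &
  forall w, normc (w - z) < e -> germ0 f w.
Proof.
move=> /(@nbhsCP R z [set w | f w = 0])[e e0 eP]; exists e => // w wz.
apply/(@nbhsCP R w [set x | f x = 0]); exists (e - normc (w - z)).
  by rewrite subr_gt0.
exact: subset_trans (@disc_in _ w z e) eP.
Qed.

Lemma germ0_zero f z : germ0 f z -> f z = 0.
Proof. exact: nbhs_singleton. Qed.

Lemma isolated_zeros O f z : open O -> O z -> holo O f -> ~ germ0 f z ->
  exists2 e, 0 < e & forall w, 0 < normc (w - z) -> normc (w - z) < e -> f w != 0.
Proof.
move=> oO Oz fh nf; have [r r0 rO] := openCP oO Oz.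
have [//|[k [g [gh gz fg]]]] := order_or_germ0 r0 (holo_sub rO fh).
have /continuousCP := holo_continuous gh (disc_center z r0).
rewrite -normc_gt0 in gz; move=> /(_ _ gz)[e e0 eP]; exists e => // w w0 /eP gw.
rewrite fg mulf_neq0// ?expf_neq0//; first by rewrite -normc_gt0.
by rewrite -normc_gt0; have := normc_dist (g z) (g w); rewrite normc_sub_sym; lra.
Qed.

Theorem identity_theorem O f z : open O -> connected O -> holo O f -> O z ->
  germ0 f z -> forall w, O w -> f w = 0.
Proof.
move=> oO cO fh Oz fz w Ow; apply: germ0_zero.
apply: (connected_locally_constant cO _ Oz fz Ow) => x Ox.
have [fx|nfx] := pselect (germ0 f x).
  have [e e0 eP] := germ0_near fx; exists e; first exact: e0.
  move=> y _ yx.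
  by split=> _; [exact: eP|exact: fx].
have [e e0 eP] := isolated_zeros oO Ox fh nfx; exists e; first exact: e0.
move=> y _ yx; split=> [fx|fy]; first by case: (nfx fx).
have [<-|yx0] := eqVneq y x; first exact: fy.
exfalso; have y0 : 0 < normc (y - x) by rewrite normc_gt0 subr_eq0.
by move: (eP y y0 yx); rewrite (germ0_zero fy) eqxx.
Qed.

Theorem liouville f M : holo setT f -> (forall z, normc (f z) <= M) ->
  forall z w, f z = f w.
Proof.
move=> fh fM z w; apply: (@zero_derivative_const _ setT) => // x _.
have -> : (0 : C) = cder f x; last exact/cderP/fh.
have M0 : 0 <= M := le_trans (normc_ge0 _) (fM x).
apply/esym/normc_small => e e0.
have r0 : 0 < (4 * M + 1) / e by rewrite divr_gt0//; lra.
have := @cauchy_bound _ f x _ M r0 (holo_sub (@subsetT _ _) fh) (fun z _ => fM z).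
move/le_trans; apply; rewrite invf_div mulrA ler_pdivrMr; last by lra.
by rewrite mulrC ler_pM2l//; lra.
Qed.

(** If f - f(c) vanishes to the exact order k at c, then the k-th Taylor
coefficient of f^N grows linearly in N while f^N stays bounded. *)
Lemma max_modulus_germ f c r : 0 < r -> holo (disc c r) f ->
  (forall w, disc c r w -> normc (f w) <= 1) -> normc (f c) = 1 ->
  germ0 (fun w => f w - f c) c.
Proof.
move=> r0 fh f1 fc; have fch : holo (disc c r) (fun w => f w - f c).
  by apply: holoB; [exact: fh|exact: holo_cst].
have [g0|[k [g [gh gc fg]]]] := order_or_germ0 r0 fch; first exact: g0.
have k0 : (0 < k)%N.
  by rewrite lt0n; apply/eqP => k0; move: (fg c) gc; rewrite k0 subrr expr0 mul1r => <-; rewrite eqxx.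
pose s := r / 2; have s0 : 0 < s by rewrite divr_gt0.
have gc0 : 0 < normc (g c) by rewrite normc_gt0.
have bound (N : nat) : N%:R * normc (g c) <= 2 / s ^+ k.
  pose h w := g w * \sum_(i <- index_enum 'I_N) f w ^+ (N.-1 - i) * f c ^+ i.
  have hh : holo (disc c r) h.
    apply: holoM; first exact: gh.
    apply: holo_sum => i.
    by apply: holoM; [exact: holoX|exact: holo_cst].
  have hE w : f w ^+ N - f c ^+ N = (w - c) ^+ k * h w.
    by rewrite subrXX fg mulrA.
  have hc : normc (h c) = N%:R * normc (g c).
    rewrite /h normcM mulrC; congr (_ * _).
    rewrite (eq_bigr (fun=> f c ^+ N.-1)); last first.
      by move=> i _; rewrite -exprD subnK// -ltnS prednK// (leq_ltn_trans _ (ltn_ord i)).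
    by rewrite sumr_const card_ord normcMn normcX fc expr1n.
  rewrite -hc; apply: (@center_le_circle _ h c r s); [exact: s0|by rewrite /s; lra| | |].
  - exact/(holo_continuous hh)/disc_center.
  - by move=> z _ zr; exact: hh.
  move=> z zs; rewrite ler_pdivlMr ?exprn_gt0// mulrC -zs -normcX -normcM -hE.
  have zr : disc c r z by rewrite /disc /= zs /s; lra.
  apply: le_trans (normc_sub _ _) _; rewrite !normcX fc expr1n.
  by have := exprn_ile1 N (normc_ge0 (f z)) (f1 z zr); lra.
pose N := Num.Def.archi_bound (2 / s ^+ k / normc (g c)).
have : 2 / s ^+ k / normc (g c) < N%:R.
  by apply: archi_boundP; rewrite !divr_ge0 ?exprn_ge0 ?normc_ge0// ltW.
by rewrite ltr_pdivrMr// ltNge bound.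
Qed.

End IdentityTheorem.

(** * Hurwitz's theorem and logarithms *)

Section Hurwitz.
Context {R : realType}.
Notation C := R[i].
Implicit Types (a b c z w d : C) (f g F G : C -> C) (S O : set C) (r s M : R).

Definition circle c s : set C := [set w | normc (w - c) = s].

Lemma compact_circle c s : compact (circle c s).
Proof.
rewrite compact_ultra => U UU Us.
have Ur : U (cdisc c s) by apply: filterS Us => w; rewrite /circle /cdisc /= => ->.
have := compact_cdisc (c := c) (r := s); rewrite compact_ultra => /(_ U UU Ur).
move=> [l [lr Ul]]; exists l; split=> //.
have Ul' : id t @[t --> U] --> l by exact: Ul.
rewrite /circle /=; apply/eqP; rewrite eq_le; apply/andP; split; first exact: lr.
apply: (cvg_normc_ge (cvgB Ul' (cvg_cst c))).
by apply: filterS Us => w /= ->.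
Qed.

Lemma circle_point c s : 0 <= s -> circle c s (c + s%:C).
Proof. by move=> s0; rewrite /circle /= addrAC subrr add0r normc_real ger0_norm. Qed.

Lemma compact_modulus_ge f (K : set C) : compact K -> K !=set0 ->
  continuous_on K f -> (forall z, K z -> f z != 0) ->
  exists2 m : R, 0 < m & forall z, K z -> m <= normc (f z).
Proof.
move=> cK K0 fc f0.
have [|c Kc cmax] := @EVT_compactC R K (fun z => - normc (f z)) K0 cK.
  by move=> z Kz; exact: cvgN (cvg_normc (fc z Kz)).
exists (normc (f c)); first by rewrite normc_gt0 f0.
by move=> z /cmax; rewrite lerN2.
Qed.

Context {T : Type} {U : set_system T} {UU : UltraFilter U}.
Implicit Types (phi : T -> C -> C).

(** Near an isolated zero c of the limit, 1/phi would be bounded on a circle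
around c, hence at c. *)
Lemma hurwitz_center phi g c r M : bounded_limit (U := U) phi g c r M ->
  (\forall t \near U, forall z, disc c r z -> phi t z != 0) ->
  g c = 0 -> germ0 g c.
Proof.
move=> lim p0 gc0; apply: contrapT => ng; have [r0 ph _ pg] := lim.
have gh : holo (disc c r) g by exact: weierstrass lim.
have [e e0 eP] := isolated_zeros (@open_disc R c r) (disc_center c r0) gh ng.
pose q := Num.min e r; have q0 : 0 < q by rewrite lt_min e0.
have qe : q <= e by rewrite ge_min lexx.
have qr : q <= r by rewrite ge_min lexx orbT.
pose s := q / 2; have s0 : 0 < s by rewrite divr_gt0.
have sr z : circle c s z -> disc c r z by rewrite /circle /disc /= => ->; rewrite /s; lra.
have [|||m m0 mP] := @compact_modulus_ge g (circle c s) (@compact_circle c s).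
- by exists (c + s%:C); apply: circle_point; exact: ltW.
- by move=> z /sr; exact: holo_continuous gh z.
- by move=> z; rewrite /circle /= => zs; apply: eP; rewrite zs // /s; lra.
have close : \forall t \near U, forall z, circle c s z -> normc (phi t z - g z) < m / 2.
  apply: compact_near_all; first exact: compact_circle.
  move=> z /sr zr; apply: (locally_uniform_cvg (bounded_limit_sub lim zr)).
  by rewrite divr_gt0.
have ge_c : \forall t \near U, m / 2 <= normc (phi t c).
  near=> t; have pt : holo (disc c r) (phi t) by near: t.
  have p0t : forall z, disc c r z -> phi t z != 0 by near: t.
  have ct : forall z, circle c s z -> normc (phi t z - g z) < m / 2 by near: t.
  have ih := holoV pt p0t; have cr := disc_center c r0.
  have : normc (phi t c)^-1 <= (m / 2)^-1.
    apply: (@center_le_circle _ (fun w => (phi t w)^-1) c r s) => //.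
    - by rewrite /s; lra.
    - exact: holo_continuous ih c cr.
    - by move=> z _ zr; exact: ih.
    move=> z zs; have := ct z zs; have := mP z zs; have := normc_dist (g z) (phi t z).
    rewrite normc_sub_sym normcV => h1 h2 h3; rewrite lef_pV2 ?posrE ?normc_gt0 ?p0t//; last 2 first.
    - exact: sr.
    - by rewrite divr_gt0.
    by lra.
  by rewrite normcV lef_pV2 ?posrE ?normc_gt0 ?p0t ?divr_gt0.
have ge_g : m / 2 <= normc (g c).
  by apply: (cvg_normc_ge (pg c (disc_center c r0))); exact: ge_c.
by move: ge_g; rewrite gc0 normc0; lra.
Unshelve. all: by end_near. Qed.

Theorem hurwitz phi g c r M : bounded_limit (U := U) phi g c r M ->
  (\forall t \near U, forall z, disc c r z -> phi t z != 0) ->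
  forall z, disc c r z -> g z = 0 -> forall w, disc c r w -> g w = 0.
Proof.
move=> lim p0 z zr gz w wr.
apply: (identity_theorem (@open_disc R c r) (convexC_connected (@disc_convex _ c r))
  (weierstrass lim) zr _ wr).
apply: hurwitz_center (bounded_limit_sub lim zr) _ gz.
by apply: filterS p0 => t h x /disc_in; exact: h.
Qed.

End Hurwitz.

Section Logarithm.
Context {R : realType}.
Notation C := R[i].
Implicit Types (c z w : C) (f g h : C -> C) (r : R).

Lemma holo_cexp O f : holo O f -> holo O (fun z : C => cexp (f z)).
Proof.
by move=> fh z Oz; case: (is_derive_compC (is_derive_cexp (f z)) (cderP (fh z Oz))).
Qed.

(** A primitive h of f'/f makes f exp(- h) constant. *)
Theorem log_modulus f c r : 0 < r -> holo (disc c r) f ->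
  (forall z, disc c r z -> f z != 0) ->
  exists2 h, holo (disc c r) h &
    forall z, disc c r z -> normc (f z) = expR (Re (h z)).
Proof.
move=> r0 fh f0; have cr := disc_center c r0.
have qh : holo (disc c r) (fun z => cder f z / f z).
  by apply: holoM (holo_cder (@open_disc R c r) fh) (holoV fh f0).
have [P dP] := primitive_exists (@open_disc R c r) (@disc_convex _ c r)
  (@disc_exhausted _ c r) (ex_intro _ c cr) qh.
have dQ z : disc c r z -> is_derive z 1 (fun w => f w * cexp (- P w)) 0.
  move=> zr; have dNP : is_derive z 1 (fun w => - P w) (- (cder f z / f z)).
    by have := deriv_sub (deriv_cst 0 z) (dP z zr); rewrite sub0r; under eq_fun do rewrite sub0r.
  have := deriv_mul (cderP (fh z zr)) (is_derive_compC (g := fun w => - P w) (is_derive_cexp (- P z)) dNP).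
  set d := _ + _; rewrite (_ : d = 0)// /d; have := f0 z zr.
  by move: (f z) (cder f z) (cexp _) => x y e x0; field.
pose k := normc (f c * cexp (- P c)).
have k0 : 0 < k by rewrite normc_gt0 mulf_neq0 ?cexp_neq0 ?f0.
exists (fun z => P z + (ln k)%:C).
  by apply: holoD; [exact: is_derive_holo dP|exact: holo_cst].
move=> z zr; have := zero_derivative_const (@disc_convex _ c r) dQ zr cr.
move=> /(congr1 (@normc R)); rewrite -/k normcM normc_cexp.
have -> : Re (- P z) = - Re (P z) by case: (P z).
have -> : Re (P z + (ln k)%:C) = Re (P z) + ln k by case: (P z).
rewrite expRD lnK ?posrE// => <-.
by rewrite mulrCA -expRD subrr expR0 mulr1.
Qed.

End Logarithm.

(** * Leading coordinates *)

Section LeadingCoordinates.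
Context {R : realType} {T : Type} {U : set_system T} {UU : UltraFilter U}.
Context {I : finType}.
Notation C := R[i].
Implicit Types (z w : C) (phi : T -> I -> C -> C) (r s M : R) (i j k : I).

Definition unit_near phi z := exists2 r, 0 < r & \forall t \near U, forall k,
  holo (disc z r) (phi t k) /\ forall w, disc z r w -> phi t k w != 0.

(** For homogeneous coordinates phi this means that near z the curves stay in a
bounded part of the i-th affine chart. *)
Definition leading phi i z := exists r M, 0 < r /\ \forall t \near U, forall k w,
  disc z r w -> normc (phi t k w) <= M * normc (phi t i w).

Definition tame phi z := exists i, leading phi i z.

Definition ratio phi i k t w : C := phi t k w / phi t i w.

Definition ratio_lim phi i k w : C := lim (ratio phi i k t w @[t --> U]).

(** A disc on which the ratios by a leading coordinate form a bounded family of
nonvanishing holomorphic functions. *)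
Definition ratio_disc phi i z r M := [/\ 0 < r,
  (\forall t \near U, forall k, holo (disc z r) (ratio phi i k t)),
  (\forall t \near U, forall k w, disc z r w -> normc (ratio phi i k t w) <= M) &
  (\forall t \near U, forall k w, disc z r w -> ratio phi i k t w != 0)].

Lemma leading_ratio_disc phi i z : unit_near phi z -> leading phi i z ->
  exists r M, ratio_disc phi i z r M.
Proof.
move=> [r1 r10 H1] [r2 [M [r20 H2]]]; pose r := Num.min r1 r2.
have r0 : 0 < r by rewrite lt_min r10.
have s1 : disc z r `<=` disc z r1 by apply: disc_le; rewrite ge_min lexx.
have s2 : disc z r `<=` disc z r2 by apply: disc_le; rewrite ge_min lexx orbT.
exists r, M; split=> //.
- apply: filterS H1 => t H k; apply: holoM; first exact: holo_sub s1 (H k).1.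
  by apply: holoV; [exact: holo_sub s1 (H i).1|move=> w /s1; exact: (H i).2].
- move: H1 H2; apply: filterS2 => t H1 H2 k w wr.
  rewrite normcM normcV ler_pdivrMr; first exact/H2/s2.
  by rewrite normc_gt0; apply: (H1 i).2; exact: s1.
- apply: filterS H1 => t H k w /s1 wr.
  by rewrite mulf_neq0 ?invr_eq0; [|exact: (H k).2|exact: (H i).2].
Qed.

Lemma ratio_cvg phi i z r M : ratio_disc phi i z r M -> forall k w, disc z r w ->
  ratio phi i k t w @[t --> U] --> ratio_lim phi i k w.
Proof.
move=> [_ _ bd _] k w wr; suff : cvg (ratio phi i k t w @[t --> U]) by [].
apply/cvg_ex; have [|l H] := @ultra_bounded_cvg R T U UU (fun t => ratio phi i k t w) M.
  by apply: filterS bd => t; apply.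
by exists l.
Qed.

Lemma ratio_bounded_limit phi i z r M : ratio_disc phi i z r M -> forall k,
  bounded_limit (U := U) (ratio phi i k) (ratio_lim phi i k) z r M.
Proof.
move=> H k; have [r0 h1 h2 _] := H; split; first exact: r0.
- by apply: filterS h1 => t; exact.
- by apply: filterS h2 => t h w; exact: h.
- by move=> w wr; exact: ratio_cvg H k w wr.
Qed.

Lemma ratio_lim_holo phi i z r M : ratio_disc phi i z r M ->
  forall k, holo (disc z r) (ratio_lim phi i k).
Proof. by move=> H k; exact: weierstrass (ratio_bounded_limit H k). Qed.

Lemma ratio_lim_unit phi i z r M : ratio_disc phi i z r M -> forall k w w',
  disc z r w -> disc z r w' -> ratio_lim phi i k w != 0 ->
  ratio_lim phi i k w' != 0.
Proof.
move=> H k w w' wr wr'; apply: contra => /eqP E; apply/eqP.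
apply: (hurwitz (ratio_bounded_limit H k) _ wr' E wr).
by case: H => _ _ _; apply: filterS => t h x; exact: h.
Qed.

Lemma leading_near phi i z : leading phi i z ->
  exists2 e, 0 < e & forall w, normc (w - z) < e -> leading phi i w.
Proof.
move=> [r [M [r0 H]]]; exists r => // w wz.
exists (r - normc (w - z)), M; split; first by rewrite subr_gt0.
by apply: filterS H => t h k x /disc_in; exact: h.
Qed.

(** If i leads at one point of a disc on which j leads, then the limit of the
ratio of i by j is nonzero there, hence nowhere zero on the disc by Hurwitz. *)
Lemma leading_transfer phi i j z r M w : ratio_disc phi j z r M ->
  disc z r w -> unit_near phi w -> leading phi i w -> leading phi i z.
Proof.
move=> H wr [s s0 uw] [r' [M' [r'0 lw]]]; have [r0 h1 h2 h3] := H.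
have ww' : disc w r' w by exact: disc_center.
have ww : disc w s w by exact: disc_center.
have zz : disc z r z by exact: disc_center.
have M'1 : 0 < M'.
  have [t [lt ut]] := @filter_ex _ U _ _ (filterI lw uw).
  have p0 : 0 < normc (phi t i w) by rewrite normc_gt0 (ut i).2.
  by have := lt i w ww'; rewrite ler_pMl//; lra.
have wi : ratio_lim phi j i w != 0.
  rewrite -normc_gt0; apply: (@lt_le_trans _ _ M'^-1); first by rewrite invr_gt0.
  apply: (@cvg_normc_ge R T U _ (fun t => ratio phi j i t w)).
    exact: ratio_cvg H i w wr.
  move: lw uw; apply: filterS2 => t lt ut.
  rewrite normcM normcV ler_pdivlMr ?normc_gt0 ?(ut j).2// ler_pdivrMl//.
  exact: lt.
have := ratio_lim_unit H wr zz wi; rewrite -normc_gt0 => gz.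
pose g := normc (ratio_lim phi j i z).
have e0 : 0 < g / 3 by rewrite divr_gt0.
have [d d0 dP] := locally_uniform_cvg (ratio_bounded_limit H i) e0.
have /continuousCP/(_ _ e0)[d' d'0 d'P] := holo_continuous (ratio_lim_holo H (k := i)) zz.
exists (Num.min (Num.min d d') r), (M * (3 / g)).
split; first by rewrite !lt_min d0 d'0.
move: dP h2 h3; apply: filterS3 => t dP h2 h3 k x.
rewrite /disc /= !lt_min => /andP[/andP[xd xd'] xr].
have q1 : g / 3 <= normc (ratio phi j i t x).
  have := dP x xd; have := d'P x xd'.
  have := normc_trans (ratio_lim phi j i x) (ratio_lim phi j i z) (ratio phi j i t x).
  rewrite (normc_sub_sym (ratio_lim phi j i z) (ratio_lim phi j i x)).
  rewrite (normc_sub_sym (ratio_lim phi j i x) (ratio phi j i t x)).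
  by have := normc_dist (ratio_lim phi j i z) (ratio phi j i t x); rewrite /g; lra.
have q2 := h2 k x xr; have q3 := h3 j x xr.
have p0 : phi t j x != 0 by apply: contra q3 => /eqP E; rewrite /ratio E mul0r.
have n0 : 0 < normc (phi t j x) by rewrite normc_gt0.
move: q1 q2; rewrite !normcM !normcV ler_pdivlMr// ler_pdivrMr// => q1 q2.
have g0 : 0 < g := gz.
have M0 : 0 <= M by apply: le_trans (normc_ge0 _) (h2 k x xr).
apply: le_trans q2 _; rewrite -mulrA ler_wpM2l//.
by rewrite mulrAC ler_pdivlMr// mulrC; lra.
Qed.

(** To lead is a locally constant property of the point, by the transfer. *)
Lemma leading_connected phi (S : set C) i z : connected S ->
  (forall w, S w -> unit_near phi w /\ tame phi w) -> S z -> leading phi i z ->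
  forall w, S w -> leading phi i w.
Proof.
move=> cS SP Sz lz w Sw.
apply: (connected_locally_constant cS _ Sz lz Sw) => x Sx.
have [ux [j lj]] := SP x Sx; have [r [M H]] := leading_ratio_disc ux lj.
have [lx|nlx] := pselect (leading phi i x).
  have [e e0 eP] := leading_near lx; exists e; first exact: e0.
  by move=> y _ yx; split=> _; [exact: eP|exact: lx].
exists r; first by case: H.
move=> y Sy yx; split=> [lx|ly]; first by case: (nlx lx).
by case: nlx; apply: (leading_transfer H yx _ ly); case: (SP y Sy).
Qed.

End LeadingCoordinates.

(** * The gauge and Marty's criterion *)

Section Gauge.
Context {R : realType} {n : nat}.
Notation C := R[i].
Notation I := 'I_n.+1.
Implicit Types (z w d c : C) (h : I -> C -> C) (r s : R) (a b i k l : I).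

Definition hsum h z : R := \sum_(l < n.+1) expR (Re (h l z)).

Definition weight h a z : R := expR (Re (h a z)) / hsum h z.

(** Up to factors that depend on n only, the Fubini-Study norm of the derivative
of the curve [exp h_0 : ... : exp h_n]. *)
Definition gauge h z : R := \sum_(a < n.+1) \sum_(b < n.+1)
  normc (cder (h a) z - cder (h b) z) * (weight h a z * weight h b z).

Lemma hsum_gt0 h z : 0 < hsum h z.
Proof.
rewrite /hsum (bigD1 ord0)//= ltr_pwDl ?expR_gt0//.
by apply: sumr_ge0 => l _; exact: expR_ge0.
Qed.

Lemma hsum_ge h k z : expR (Re (h k z)) <= hsum h z.
Proof.
rewrite /hsum [leRHS](bigD1 k)//= lerDl.
by apply: sumr_ge0 => l _; exact: expR_ge0.
Qed.

Lemma hsum_le h i z : (forall k, Re (h k z) <= Re (h i z)) ->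
  hsum h z <= n.+1%:R * expR (Re (h i z)).
Proof.
move=> hi; rewrite /hsum mulr_natl -[X in _ *+ X](card_ord n.+1) -sumr_const.
by apply: ler_sum => k _; rewrite ler_expR.
Qed.

Lemma weight_gt0 h a z : 0 < weight h a z.
Proof. by rewrite divr_gt0 ?expR_gt0 ?hsum_gt0. Qed.

Lemma weight_le1 h a z : weight h a z <= 1.
Proof.
by rewrite ler_pdivrMr ?hsum_gt0// mul1r hsum_ge.
Qed.

Lemma weight_ratio h a b z : 
  expR (Re (h a z)) = weight h a z / weight h b z * expR (Re (h b z)).
Proof.
rewrite /weight; have := lt0r_neq0 (expR_gt0 (Re (h b z))).
by have := lt0r_neq0 (hsum_gt0 h z) => S0 b0; field; rewrite S0 b0.
Qed.

Lemma is_derive_path (f : C -> C) z d (s : R) : derivable f (z + s%:C * d) 1 ->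
  is_derive s 1 (fun x : R => Re (f (z + x%:C * d)))
    (Re (cder f (z + s%:C * d) * d)).
Proof.
move=> /cderP/is_deriveCP df; apply/is_deriveP => e e0.
have d1 : 0 < normc d + 1 by have := normc_ge0 d; lra.
have [r r0 rP] := df (e / (normc d + 1)) (divr_gt0 e0 d1).
apply/nbhs_normP; exists (r / (normc d + 1)); first by rewrite /= divr_gt0.
move=> x /=; rewrite ltr_pdivlMr// distrC => xs.
have pE : z + x%:C * d - (z + s%:C * d) = (x - s)%:C * d by rewrite rmorphB; ring.
have xd : normc (z + x%:C * d - (z + s%:C * d)) <= `|x - s| * (normc d + 1).
  by rewrite pE normcM normc_real ler_wpM2l// lerDl.
have := rP _ (le_lt_trans xd xs).
rewrite Re_comb => H; apply: le_trans (normcRe _) _.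
have -> : cder f (z + s%:C * d) * d * (x - s)%:C =
  cder f (z + s%:C * d) * (z + x%:C * d - (z + s%:C * d)) by rewrite pE; ring.
apply: le_trans H _; apply: le_trans (ler_wpM2l _ xd) _.
  by rewrite divr_ge0 ?ltW.
by rewrite mulrCA divfK ?lt0r_neq0// mulrC.
Qed.

Lemma gauge_row h z i :
  \sum_(b < n.+1) normc (cder (h i) z - cder (h b) z) * (weight h i z * weight h b z)
    <= gauge h z.
Proof.
rewrite /gauge [X in _ <= X](bigD1 i); last exact: isT.
rewrite lerDl; apply: sumr_ge0 => a _; apply: sumr_ge0 => b _.
by rewrite mulr_ge0 ?normc_ge0// mulr_ge0// ltW// weight_gt0.
Qed.

Lemma ReB z w : Re (z - w) = Re z - Re w.
Proof. by case: z w => [? ?] [? ?]. Qed.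

Lemma weighted_difference (e d : I -> R) i (S : R) : S != 0 ->
  S = \sum_(l < n.+1) e l ->
  \sum_(l < n.+1) (d i - d l) * (e i / S * (e l / S)) =
    e i / S ^+ 2 * (d i * S - \sum_(l < n.+1) e l * d l).
Proof.
move=> S0 SE; rewrite {4}SE mulr_sumr -sumrB mulr_sumr; apply: eq_bigr => l _.
by field.
Qed.

Lemma quotient_rule (e S A d : R) : S != 0 ->
  e / S ^+ 2 * (d * S - A) = e * (- S ^- 2 * A) + S^-1 * (e * d).
Proof. by move=> S0; field. Qed.

(** The weights are Lipschitz for the metric defined by the gauge. *)
Lemma weight_lipschitz h z w i (B : R) :
  (forall x l, seg z w x -> derivable (h l) x 1) ->
  (forall x, seg z w x -> gauge h x <= B) ->
  `|weight h i w - weight h i z| <= B * normc (w - z).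
Proof.
move=> dh gB; pose p (x : R) := z + x%:C * (w - z).
have pseg (x : R) : 0 <= x <= 1 -> seg z w (p x) by move=> x01; exists x.
pose u l x := Re (h l (p x)); pose du l x := Re (cder (h l) (p x) * (w - z)).
pose f x := weight h i (p x).
pose df x := \sum_(l < n.+1) (du i x - du l x) * (weight h i (p x) * weight h l (p x)).
have f_der (x : R) : 0 <= x <= 1 -> is_derive x 1 f (df x).
  move=> x01; have du_der l : is_derive x 1 (u l) (du l x).
    by apply: is_derive_path; apply: dh; exact: pseg.
  have e_der l : is_derive x 1 (fun x => expR (u l x)) (expR (u l x) * du l x).
    by have := @is_derive1_comp R expR (u l) x _ _ (is_derive_expR _) (du_der l).
  have S_der : is_derive x 1 (fun x => hsum h (p x)) (\sum_(l < n.+1) expR (u l x) * du l x).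
    have := is_derive_sum (h := fun l x => expR (u l x)) e_der.
    by rewrite (_ : \sum_(l < n.+1) _ = fun x => hsum h (p x))// fct_sumE.
  have S0 := lt0r_neq0 (hsum_gt0 h (p x)).
  have [dS ES] := S_der.
  have Vd : is_derive x 1 (fun x => (hsum h (p x))^-1)
      (- (hsum h (p x)) ^- 2 * (\sum_(l < n.+1) expR (u l x) * du l x)).
    have := @derivableP _ _ _ _ _ _ (@derivableV R R (fun x => hsum h (p x)) x 1 S0 dS).
    by rewrite (@deriveV R R (fun x => hsum h (p x)) x 1 S0 dS) ES.
  have := @is_deriveM R R _ _ x 1 _ _ (e_der i) Vd.
  set D := _ + _; suff -> : df x = D by [].
  rewrite /df (@weighted_difference (fun l => expR (u l x)) _ i (hsum h (p x)))//.
  by rewrite quotient_rule.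
have [t t01 E] : exists2 t : R, t \in `[0, 1] & f 1 - f 0 = df t * (1 - 0).
  apply: (@MVT_segment R f df 0 1 ler01).
    by move=> x; rewrite in_itv /= => /andP[x0 x1]; apply: f_der; rewrite !ltW.
  apply/subspace_continuousP => x; rewrite /= in_itv /= => x01.
  apply: cvg_within_filter; apply: differentiable_continuous.
  by apply/derivable1_diffP; case: (f_der x x01).
have {}t01 : 0 <= t <= 1 by move: t01; rewrite in_itv.
have <- : f 1 = weight h i w by rewrite /f /p rmorph1 mul1r addrC subrK.
have <- : f 0 = weight h i z by rewrite /f /p rmorph0 mul0r addr0.
rewrite E subr0 mulr1; apply: (@le_trans _ _ (gauge h (p t) * normc (w - z))); last first.
  by rewrite ler_wpM2r ?normc_ge0//; exact/gB/pseg.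
rewrite /df; apply: le_trans (ler_norm_sum _ _ _) _.
apply: le_trans (_ : (\sum_(b < n.+1) normc (cder (h i) (p t) - cder (h b) (p t)) *
    (weight h i (p t) * weight h b (p t))) * normc (w - z) <= _); last first.
  by rewrite ler_wpM2r ?normc_ge0// gauge_row.
rewrite mulr_suml; apply: ler_sum => l _; rewrite normrM.
have w0 : 0 <= weight h i (p t) * weight h l (p t) by rewrite mulr_ge0// ltW// weight_gt0.
rewrite (ger0_norm w0) [X in _ <= X]mulrAC ler_wpM2r// -normcM mulrBl.
by rewrite -ReB; exact: normcRe.
Qed.

Lemma weight_ge_inv_card h z : exists i, n.+1%:R^-1 <= weight h i z.
Proof.
have [i iP] := exists_argmax ord0 (fun k => Re (h k z)); exists i.
rewrite /weight ler_pdivlMr ?hsum_gt0// mulrC ler_pdivrMr ?ltr0n// mulrC.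
exact: hsum_le.
Qed.

(** Marty: on discs of a fixed radius, a bound on the gauge makes one coordinate
comparable to all. *)
Lemma marty h c r (B : R) : 0 < B -> 0 < r -> r <= (2 * B * n.+1%:R)^-1 ->
  (forall l, holo (disc c r) (h l)) ->
  (forall z, disc c r z -> gauge h z <= B) ->
  exists i, forall k z, disc c r z ->
    expR (Re (h k z)) <= (2 * n.+1%:R) * expR (Re (h i z)).
Proof.
move=> B0 r0 rn hh gB; have [i iP] := weight_ge_inv_card h c; exists i => k z zr.
have cr := disc_center c r0; have sub := disc_convex cr zr.
have := @weight_lipschitz h c z i B (fun x l xs => hh l x (sub x xs))
  (fun x xs => gB x (sub x xs)).
have N0 : 0 < n.+1%:R :> R by rewrite ltr0n.
rewrite ler_norml => /andP[lo _].
have zr' : normc (z - c) <= (2 * B * n.+1%:R)^-1 by apply: le_trans rn; exact: ltW.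
have w2 : (2 * n.+1%:R)^-1 <= weight h i z.
  have E : (n.+1%:R)^-1 - B * (2 * B * n.+1%:R)^-1 = (2 * n.+1%:R)^-1 :> R.
    by field; rewrite !lt0r_neq0.
  rewrite -E; apply: le_trans (_ : weight h i c - B * normc (z - c) <= _).
    by rewrite lerB// ler_wpM2l// ltW.
  by move: lo; move: (weight h i c) (weight h i z) => x y; lra.
rewrite (weight_ratio h k i z) ler_pM2r ?expR_gt0// ler_pdivrMr ?weight_gt0//.
apply: le_trans (weight_le1 _ _ _) _.
by rewrite mulrC -ler_pdivrMr ?mulr_gt0// div1r.
Qed.

End Gauge.

(** * Zalcman's rescaling of roots *)

Section Zalcman.
Context {R : realType} {n : nat}.
Notation C := R[i].
Notation I := 'I_n.+1.
Implicit Types (z w d c : C) (h : I -> C -> C) (r s : R) (a b i k l : I).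

Lemma sum_continuous (J : Type) (s : seq J) (f : J -> C -> R) z :
  (forall j, {for z, continuous (f j)}) ->
  {for z, continuous (fun w => \sum_(j <- s) f j w)}.
Proof. by move=> fc; apply: (@cvg_bigsum R R C J (nbhs z) _ s f (fun j => f j z)). Qed.

Lemma gauge_continuous h (O : set C) z : open O -> O z ->
  (forall l, holo O (h l)) -> {for z, continuous (gauge h)}.
Proof.
move=> oO Oz hh.
have ec l : {for z, continuous (fun w => expR (Re (h l w)))}.
  apply: (@continuous_comp C R R (fun w => Re (h l w)) expR); last exact: continuous_expR.
  apply/(@cvgrPdistC_lt _ _ _ (nbhs z)) => e e0.
  have /(@cvgCP _ _ (nbhs z))/(_ e e0) := holo_continuous (hh l) Oz.
  by apply: filterS => w; apply: le_lt_trans; rewrite -ReB; exact: normcRe.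
have Sc : {for z, continuous (hsum h)} by exact: sum_continuous.
have wc l : {for z, continuous (weight h l)}.
  by apply: cvgM (ec l) _; apply: cvgV Sc; rewrite lt0r_neq0// hsum_gt0.
apply: sum_continuous => a; apply: sum_continuous => b.
apply: cvgM (cvgM (wc a) (wc b)); apply: cvg_normc.
exact: cvgB (holo_continuous (holo_cder oO (hh a)) Oz)
  (holo_continuous (holo_cder oO (hh b)) Oz).
Qed.

(** As h consists of logarithms, the curve of exponentials is replaced by its K-th
root. *)
Definition root h (K : R) : I -> C -> C := fun l z => K^-1%:C * h l z.

Definition affine h z (rho : R) : I -> C -> C := fun l w => h l (z + rho%:C * w).

Lemma Re_scale (x : R) z : Re (x%:C * z) = x * Re z.
Proof. by case: z => u v /=; rewrite mul0r subr0. Qed.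

Lemma holo_root (O : set C) h K : (forall l, holo O (h l)) ->
  forall l, holo O (root h K l).
Proof. by move=> hh l z Oz; case: (deriv_scale K^-1%:C (cderP (hh l z Oz))). Qed.

(** Roots bring the coordinates closer to the largest one, whose modulus is a
fraction 1/(n+1) at least of the sum. *)
Lemma root_weight h (K : R) a z : 1 <= K ->
  weight h a z / n.+1%:R <= weight (root h K) a z.
Proof.
move=> K1; have K0 : 0 < K by lra.
have [i iP] := exists_argmax ord0 (fun k => Re (h k z)).
have wa : weight h a z <= expR (Re (h a z) - Re (h i z)).
  rewrite /weight ler_pdivrMr ?hsum_gt0// expRD expRN -mulrA ler_peMr ?expR_ge0//.
  by rewrite mulrC ler_pdivlMr ?expR_gt0// mul1r hsum_ge.
have S1 : hsum (root h K) z <= n.+1%:R * expR (Re (h i z) / K).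
  rewrite mulrC -[_ / K]mulrC -Re_scale mulrC; apply: hsum_le => k.
  by rewrite /root !Re_scale ler_pM2l ?invr_gt0.
rewrite {2}/weight ler_pdivlMr ?hsum_gt0//.
apply: le_trans (ler_wpM2l _ S1) _.
  by rewrite divr_ge0 ?ltW ?weight_gt0.
rewrite mulrA divfK ?pnatr_eq0//; apply: le_trans (ler_wpM2r (expR_ge0 _) wa) _.
rewrite -expRD ler_expR /root Re_scale.
have k0 : 0 < K^-1 by rewrite invr_gt0.
have k1 : K^-1 <= 1 by rewrite invf_le1.
have := iP a; move: (Re (h a z)) (Re (h i z)) K^-1 k0 k1 => A B k k0 k1 AB.
by nra.
Qed.

Lemma gauge_root_ge h (K : R) z : 1 <= K -> (forall l, derivable (h l) z 1) ->
  gauge h z / (K * n.+1%:R ^+ 2) <= gauge (root h K) z.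
Proof.
move=> K1 hh; have K0 : 0 < K by lra.
have k0 : 0 < K^-1 by rewrite invr_gt0.
have N0 : 0 < n.+1%:R :> R by rewrite ltr0n.
rewrite /gauge mulr_suml; apply: ler_sum => a _.
rewrite mulr_suml; apply: ler_sum => b _.
have cE l : cder (root h K l) z = K^-1%:C * cder (h l) z.
  exact: cderE (deriv_scale K^-1%:C (cderP (hh l))).
rewrite !cE -mulrBr normcM normc_real (ger0_norm (ltW k0)).
have wa := root_weight h a z K1; have wb := root_weight h b z K1.
have w0 l : 0 <= weight h l z / n.+1%:R by rewrite divr_ge0 ?ltW ?weight_gt0.
have := ler_pM (w0 a) (w0 b) wa wb.
move=> /(ler_wpM2l (mulr_ge0 (ltW k0) (normc_ge0 (cder (h a) z - cder (h b) z)))).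
apply: le_trans; rewrite le_eqVlt; apply/orP; left; apply/eqP; field.
by rewrite !lt0r_neq0.
Qed.

Lemma affine_weight h z rho l w :
  weight (affine h z rho) l w = weight h l (z + rho%:C * w).
Proof. by []. Qed.

Lemma derivable_affine (f : C -> C) z (rho : R) w :
  derivable f (z + rho%:C * w) 1 ->
  is_derive w 1 (fun x => f (z + rho%:C * x)) (cder f (z + rho%:C * w) * rho%:C).
Proof.
move=> df; apply: (is_derive_compC (g := fun x => z + rho%:C * x)).
  exact: cderP df.
have := deriv_add (deriv_cst z w) (deriv_scale rho%:C (deriv_id w)).
by rewrite add0r mulr1.
Qed.

Lemma gauge_affine h z (rho : R) w : 0 <= rho ->
  (forall l, derivable (h l) (z + rho%:C * w) 1) ->
  gauge (affine h z rho) w = rho * gauge h (z + rho%:C * w).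
Proof.
move=> rho0 hh; rewrite /gauge mulr_sumr; apply: eq_bigr => a _.
rewrite mulr_sumr; apply: eq_bigr => b _.
have cE l : cder (affine h z rho l) w = cder (h l) (z + rho%:C * w) * rho%:C.
  exact: cderE (derivable_affine (hh l)).
by rewrite !cE !affine_weight -mulrBl normcM normc_real ger0_norm//; ring.
Qed.

(** Zalcman: a point that maximizes the gauge times the distance to the boundary
has the gauge controlled by a constant on a large disc in its own scale. *)
Lemma zalcman_select (G : C -> R) c s z1 (N : R) : 0 < s -> 0 < N ->
  (forall z, cdisc c s z -> {for z, continuous G}) ->
  cdisc c (s / 2) z1 -> N <= G z1 ->
  exists z, [/\ normc (z - c) < s, 0 < G z, N * s / 2 <= (s - normc (z - c)) * G z &
    forall w, normc (w - z) <= (s - normc (z - c)) / 2 -> G w <= 2 * G z].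
Proof.
move=> s0 N0 Gc z1s NG; pose F z := (s - normc (z - c)) * G z.
have z1s' : cdisc c s z1 by move: z1s; rewrite /cdisc /=; lra.
have [|z zs zmax] := @EVT_compactC R (cdisc c s) F (ex_intro _ z1 z1s') (@compact_cdisc _ c s).
  move=> z zs; have nc : {for z, continuous (fun w : C => s - normc (w - c))}.
    have idc : (fun w : C => w) w @[w --> z] --> z by exact: cvg_id.
    exact: cvgB (cvg_cst s) (cvg_normc (cvgB idc (cvg_cst c))).
  exact: cvgM nc (Gc z zs).
have Fz : N * s / 2 <= F z.
  apply: le_trans (zmax z1 z1s'); rewrite /F; move: z1s; rewrite /cdisc /= => z1s.
  have : 0 <= (s / 2 - normc (z1 - c)) * N by rewrite mulr_ge0 ?subr_ge0// ltW.
  have : 0 <= (s - normc (z1 - c)) * (G z1 - N) by rewrite mulr_ge0 ?subr_ge0//; lra.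
  by lra.
have Fz0 : 0 < F z by apply: lt_le_trans Fz; rewrite !divr_gt0// mulr_gt0.
have zs1 : normc (z - c) < s.
  rewrite lt_neqAle; apply/andP; split; last exact: zs.
  by apply/eqP => E; move: Fz0; rewrite /F E subrr mul0r ltxx.
have d0 : 0 < s - normc (z - c) by rewrite subr_gt0.
have Gz0 : 0 < G z by move: Fz0; rewrite /F pmulr_rgt0.
exists z; split=> // w wz.
have wc : normc (w - c) <= normc (z - c) + (s - normc (z - c)) / 2.
  by have := normc_trans z w c; lra.
have ws : cdisc c s w by rewrite /cdisc /=; lra.
have := zmax w ws; rewrite /F => H.
have [Gw|Gw] := leP (G w) 0; first by apply: le_trans Gw _; rewrite mulr_ge0// ltW.
have h1 : (s - normc (z - c)) / 2 * G w <= (s - normc (w - c)) * G w.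
  by rewrite ler_pM2r//; lra.
have : (s - normc (z - c)) * G w <= (s - normc (z - c)) * (2 * G z) by lra.
by rewrite ler_pM2l.
Qed.

(** Taking K-th roots divides the gauge by at most a multiple of K. For K the square
root of the maximum of the gauge, the gauge of the roots is therefore of order K
and still allows a rescaling, while K tends to infinity with the gauge. *)
Lemma zalcman_point h c r : 0 < r -> (forall l, holo (disc c r) (h l)) ->
  (exists2 z, cdisc c (r / 4) z & 1 <= gauge h z) ->
  exists z rho K, [/\ 0 < rho, 1 <= K,
    forall w, cdisc c (r / 4) w -> gauge h w <= K ^+ 2,
    gauge (affine (root h K) z rho) 0 = 1 &
    forall w, normc w <= K * (r / (8 * n.+1%:R ^+ 2)) ->
      disc c r (z + rho%:C * w) /\ gauge (affine (root h K) z rho) w <= 2].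
Proof.
move=> r0 hh [y yr gy].
have gc z : disc c r z -> {for z, continuous (gauge h)}.
  by move=> zr; exact: gauge_continuous (@open_disc R c r) zr hh.
have sub : cdisc c (r / 4) `<=` disc c r by move=> z; rewrite /cdisc /disc /=; lra.
have [|z1 z1r z1max] := @EVT_compactC R (cdisc c (r / 4)) (gauge h)
    (ex_intro _ y yr) (@compact_cdisc _ c (r / 4)).
  by move=> z /sub; exact: gc.
pose K := Num.sqrt (gauge h z1).
have g1 : 1 <= gauge h z1 by apply: le_trans gy _; exact: z1max.
have K1 : 1 <= K by rewrite -sqrtr1 ler_sqrt//; lra.
have K0 : 0 < K by lra.
have K2 : K ^+ 2 = gauge h z1 by rewrite sqr_sqrtr//; lra.
have N0 : 0 < n.+1%:R :> R by rewrite ltr0n.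
have N20 : 0 < n.+1%:R ^+ 2 :> R by rewrite exprn_gt0.
have rh l : holo (disc c r) (root h K l) by exact: holo_root.
have s0 : 0 < r / 2 by rewrite divr_gt0.
have KN0 : 0 < K / n.+1%:R ^+ 2 by rewrite divr_gt0.
have [|||z [zs Gz0 Gz zw]] := @zalcman_select (gauge (root h K)) c (r / 2) z1 _ s0 KN0.
- move=> z zs; apply: (gauge_continuous (@open_disc R c r) _ rh).
  by move: zs; rewrite /cdisc /disc /=; lra.
- by move: z1r; rewrite /cdisc /=; lra.
- have := gauge_root_ge K1 (fun l => hh l z1 (sub z1 z1r)).
  apply: le_trans; rewrite -K2 le_eqVlt; apply/orP; left; apply/eqP; field.
  by rewrite !lt0r_neq0.
pose rho := (gauge (root h K) z)^-1.
have rho0 : 0 < rho by rewrite invr_gt0.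
have zr : disc c r z by rewrite /disc /=; lra.
exists z, rho, K; split=> //.
- by move=> w wr; rewrite K2; exact: z1max.
- rewrite gauge_affine ?(ltW rho0)// mulr0 addr0; last by move=> l; exact: rh.
  by rewrite /rho mulVf// lt0r_neq0.
move=> w wK; have wd : normc (z + rho%:C * w - z) <= (r / 2 - normc (z - c)) / 2.
  rewrite addrAC subrr add0r normcM normc_real (ger0_norm (ltW rho0)).
  rewrite mulrC ler_pdivrMr//; apply: le_trans wK _.
  have E : K / n.+1%:R ^+ 2 * (r / 2) / 2 = 2 * (K * (r / (8 * n.+1%:R ^+ 2))).
    by field; rewrite lt0r_neq0.
  move: Gz; rewrite E; move: (K * (r / _)) => X.
  by rewrite mulrAC; lra.
have wr : disc c r (z + rho%:C * w).
  rewrite /disc /=; have := normc_trans z (z + rho%:C * w) c; lra.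
split=> //; rewrite gauge_affine ?(ltW rho0)//; last by move=> l; exact: rh.
by rewrite mulrC /rho ler_pdivrMr//; exact: zw.
Qed.

End Zalcman.

(** * Dominant coordinates of entire curves *)

Section Dominance.
Context {R : realType}.
Notation C := R[i].
Implicit Types (z w : C) (f g : C -> C) (r s : R).

Lemma setT_convex : convexC [set: C]. Proof. by []. Qed.

Lemma holo_continuousT f z : holo setT f -> {for z, continuous f}.
Proof. by move=> fh; exact: holo_continuous fh z I. Qed.

(** The strong maximum principle for f/g, with the identity theorem. *)
Lemma modulus_rigid f g z s : 0 < s -> holo setT f -> holo setT g ->
  (forall w, g w != 0) -> (forall w, disc z s w -> normc (f w) <= normc (g w)) ->
  normc (f z) = normc (g z) ->
  forall w, normc (f w) = normc (g w).
Proof.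
move=> s0 fh gh g0 fg fgz w; pose q x := f x / g x.
have qh : holo setT q by apply: holoM; [exact: fh|apply: holoV; [exact: gh|by move=> x _; exact: g0]].
have gp x : 0 < normc (g x) by rewrite normc_gt0.
have qz : normc (q z) = 1 by rewrite normcM normcV fgz mulfV// lt0r_neq0.
have q1 x : disc z s x -> normc (q x) <= 1.
  by move=> /fg; rewrite normcM normcV ler_pdivrMr// mul1r.
have germ := max_modulus_germ s0 (holo_sub (@subsetT _ _) qh) q1 qz.
have ch : holo setT (fun x => q x - q z) by apply: holoB; [exact: qh|exact: holo_cst].
have := identity_theorem openT (convexC_connected setT_convex) ch I germ (w := w) I.
move=> /eqP; rewrite subr_eq0 => /eqP E.
move: (congr1 (@normc R) E); rewrite qz normcM normcV => /divr1_eq//.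
Qed.

Context {I : finType}.
Context (F : I -> C -> C) (Fh : forall i, holo setT (F i)).
Context (Funit : forall i z w, F i z != 0 -> F i w != 0).

Definition dominant z : {set I} := [set i | [forall k, normc (F k z) <= normc (F i z)]].

Lemma dominantP z i : reflect (forall k, normc (F k z) <= normc (F i z)) (i \in dominant z).
Proof. by rewrite inE; exact: forallP. Qed.

Lemma dominant_eq z i k : i \in dominant z -> k \in dominant z ->
  normc (F i z) = normc (F k z).
Proof. by move=> /dominantP hi /dominantP hk; apply/eqP; rewrite eq_le hi hk. Qed.

Lemma dominant_semicontinuous z : exists2 s, 0 < s &
  forall w, disc z s w -> dominant w \subset dominant z.
Proof.
have near_lt i : i \notin dominant z -> exists2 s, 0 < s &
    forall w, disc z s w -> i \notin dominant w.
  move=> /dominantP /existsNP[k /negP]; rewrite -ltNge => ik.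
  have e0 : 0 < (normc (F k z) - normc (F i z)) / 2 by rewrite divr_gt0// subr_gt0.
  have /continuousCP/(_ _ e0)[d d0 dP] := holo_continuousT (z := z) (@Fh i).
  have /continuousCP/(_ _ e0)[d' d'0 d'P] := holo_continuousT (z := z) (@Fh k).
  exists (Num.min d d'); first by rewrite lt_min d0.
  move=> w; rewrite /disc /= lt_min => /andP[/dP h1 /d'P h2].
  apply/negP => /dominantP/(_ k); have := normc_dist (F i w) (F i z).
  by have := normc_dist (F k z) (F k w); rewrite (normc_sub_sym (F k z)); lra.
have /choice[s sP] : forall i, exists s, 0 < s /\
    (i \notin dominant z -> forall w, disc z s w -> i \notin dominant w).
  move=> i; have [/near_lt[s s0 sP]|iz] := boolP (i \notin dominant z); first by exists s.
  by exists 1; split.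
pose m := \big[Num.min/1]_(i : I) s i.
have m0 : 0 < m by rewrite /m; elim/big_ind: _ => // [x y x0 y0|i _]; [by rewrite lt_min x0|by case: (sP i)].
exists m => // w wm; apply/fintype.subsetP => i; apply: contraTT => iz; apply: (sP i).2 iz _ _.
by apply: disc_le wm; rewrite /m (bigD1 i)//= ge_min lexx.
Qed.

(** Dominance is semicontinuous, so the set of dominant coordinates is constant
near a point where it has the least cardinality. *)
Lemma dominant_stable (O : set C) : open O -> O !=set0 -> exists z s,
  [/\ O z, 0 < s & forall w, disc z s w -> O w /\ dominant w = dominant z].
Proof.
move=> oO [z Oz]; pose P m := `[< exists2 z, O z & #|dominant z| = m >].
have exP : exists m, P m by exists #|dominant z|; apply/asboolP; exists z.
case: (ex_minnP exP) => m /asboolP[x Ox xm] mmin.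
have [s1 s10 s1O] := openCP oO Ox; have [s2 s20 s2P] := dominant_semicontinuous x.
exists x, (Num.min s1 s2); split=> //; first by rewrite lt_min s10.
move=> w; rewrite /disc /= lt_min => /andP[/s1O Ow /s2P sub]; split=> //.
apply/eqP; rewrite eqEcard sub /= xm; apply: mmin; apply/asboolP.
by exists w.
Qed.

Lemma dominant_same_modulus z s i k : 0 < s ->
  (forall w, disc z s w -> dominant w = dominant z) -> F k z != 0 ->
  i \in dominant z -> k \in dominant z -> forall w, normc (F i w) = normc (F k w).
Proof.
move=> s0 sP k0 iz kz; apply: (modulus_rigid (z := z) s0).
- exact: Fh.
- exact: Fh.
- by move=> w; exact: Funit k0.
- by move=> w /sP E; rewrite (@dominant_eq w i k) ?E.
- exact: dominant_eq.
Qed.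

(** If one coordinate dominated everywhere, Liouville would make all ratios
constant. So two different classes of coordinates dominate on two open sets. *)
Theorem two_dominant_classes i0 : (forall z, F i0 z = 1) ->
  (exists k z w, F k z != F k w) ->
  exists za zb s, [/\ 0 < s,
    (forall w, disc za s w -> dominant w = dominant za),
    (forall w, disc zb s w -> dominant w = dominant zb) &
    forall a b, a \in dominant za -> b \in dominant zb ->
      exists w, normc (F a w) != normc (F b w)].
Proof.
move=> F1 [k1 [y1 [y2 nc]]].
have dom0 z a : a \in dominant z -> F a z != 0.
  move=> /dominantP/(_ i0); rewrite F1 normc1 -normc_gt0; lra.
have ex_dom z : exists a, a \in dominant z.
  by have [a aP] := exists_argmax i0 (fun k => normc (F k z)); exists a; apply/dominantP.
have [za [s [_ s0 sa]]] := dominant_stable openT (ex_intro _ (0 : C) Logic.I).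
have {}sa w : disc za s w -> dominant w = dominant za by move=> /sa[].
have [a aza] := ex_dom za.
have Fa0 w : F a w != 0 by exact: Funit (dom0 _ _ aza).
pose O : set C := [set z | a \notin dominant z].
have O0 : O !=set0.
  apply: contrapT => O0; have adom z k : normc (F k z) <= normc (F a z).
    apply/dominantP; apply: contrapT => h; apply: O0; exists z; exact/negP.
  have const k z w : F k z / F a z = F k w / F a w.
    apply: (@liouville _ (fun z => F k z / F a z) 1).
      by apply: holoM; [exact: Fh|apply: holoV; [exact: Fh|by move=> x _]].
    by move=> x; rewrite normcM normcV ler_pdivrMr ?normc_gt0// mul1r.
  have aconst : F a y1 = F a y2.
    by have := const i0 y1 y2; rewrite !F1 !div1r => /invr_inj.
  by move: nc; have := const k1 y1 y2; rewrite aconst => /(divIf (Fa0 y2)) ->; rewrite eqxx.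
have oO : open O.
  rewrite openE => z Oz; have [d d0 dP] := dominant_semicontinuous z.
  apply/nbhsCP; exists d => // w /dP/fintype.subsetP sub; apply/negP => /sub.
  by rewrite (negPf Oz).
have [zb [s' [Ozb s'0 sb]]] := dominant_stable oO O0.
exists za, zb, (Num.min s s'); split; first by rewrite lt_min s0.
- by move=> w wd; apply: sa; apply: disc_le wd; rewrite ge_min lexx.
- by move=> w wd; apply: (proj2 (sb w _)); apply: disc_le wd; rewrite ge_min lexx orbT.
move=> a' b a'za bzb; apply: contrapT => same.
have {}same w : normc (F a' w) = normc (F b w).
  by apply/eqP; apply: contrapT => /negP h; apply: same; exists w.
have aa' := dominant_same_modulus s0 sa (dom0 _ _ a'za) aza a'za.
move: Ozb => /negP; apply; apply/dominantP => k; rewrite aa' same.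
exact/dominantP.
Qed.

End Dominance.

(** * Limits of rescaled logarithms *)

Section UltrafilterChoice.
Context {T : Type} {U : set_system T} {UU : UltraFilter U}.

Lemma near_not (P : T -> Prop) : ~ (\forall t \near U, P t) ->
  \forall t \near U, ~ P t.
Proof. by have [h|h] := in_ultra_setVsetC [set t | P t] UU. Qed.

Lemma ultra_finite_choice (J : finType) (P : J -> T -> Prop) :
  (\forall t \near U, exists j, P j t) -> exists j, \forall t \near U, P j t.
Proof.
move=> H; apply: contrapT => none.
have nP j : \forall t \near U, ~ P j t.
  by apply: near_not => h; apply: none; exists j.
have [t [[j Pj] nPt]] := @filter_ex _ U _ _ (filterI H (filter_forall _ nP)).
exact: nPt j Pj.
Qed.

End UltrafilterChoice.

Section RescaledLimit.
Context {R : realType} {T : Type} {U : set_system T} {UU : UltraFilter U}.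
Context {n : nat}.
Notation C := R[i].
Notation I := 'I_n.+1.
Implicit Types (z w : C) (r s : R) (i k l : I).
Context (H : T -> I -> C -> C).
Context (Hholo : forall r, \forall t \near U, forall l, holo (disc 0 r) (H t l)).
Context (Hgauge : forall r, \forall t \near U, forall w, disc 0 r w -> gauge (H t) w <= 2).
Context (Hgauge0 : \forall t \near U, gauge (H t) 0 = 1).

Definition expfam t l w : C := cexp (H t l w).

Lemma expfam_modulus t l w : normc (expfam t l w) = expR (Re (H t l w)).
Proof. exact: normc_cexp. Qed.

Lemma disc0_sub z r : disc z r `<=` disc 0 (normc z + r).
Proof.
by move=> w; rewrite /disc /= subr0 => wz; have := normc_add (w - z) z; rewrite subrK; lra.
Qed.

Lemma expfam_unit_near z : unit_near (U := U) expfam z.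
Proof.
exists 1 => //; apply: filterS (Hholo (normc z + 1)) => t hh k; split; last first.
  by move=> w _; exact: cexp_neq0.
by apply: holo_cexp; exact: holo_sub (@disc0_sub z 1) (hh k).
Qed.

Lemma expfam_tame z : tame (U := U) expfam z.
Proof.
pose r : R := (2 * 2 * n.+1%:R)^-1.
have r0 : 0 < r by rewrite invr_gt0 !mulr_gt0// ltr0n.
suff : exists i, \forall t \near U, forall k w, disc z r w ->
    normc (expfam t k w) <= 2 * n.+1%:R * normc (expfam t i w).
  by move=> [i iP]; exists i, r, (2 * n.+1%:R).
apply: ultra_finite_choice.
move: (Hholo (normc z + r)) (Hgauge (normc z + r)); apply: filterS2 => t hh hg.
have two0 : (0 : R) < 2 by [].
have [||i iP] := @marty R n (H t) z r 2 two0 r0 (lexx _).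
- by move=> l; exact: holo_sub (@disc0_sub z r) (hh l).
- by move=> w /disc0_sub; exact: hg.
by exists i => k w wr; rewrite !expfam_modulus; exact: iP.
Qed.

Lemma expfam_leading : exists i, forall z, leading (U := U) expfam i z.
Proof.
have [i i0] := expfam_tame 0; exists i => z.
apply: (leading_connected (convexC_connected setT_convex) _ _ i0) => // w _.
by split; [exact: expfam_unit_near|exact: expfam_tame].
Qed.

Context (i0 : I) (lead : forall z, leading (U := U) expfam i0 z).

Let F k z : C := ratio_lim (U := U) expfam i0 k z.

Lemma limit_disc z : exists r M, ratio_disc (U := U) expfam i0 z r M.
Proof. by apply: leading_ratio_disc (lead z); exact: expfam_unit_near. Qed.

Lemma limit_cvg k z : ratio expfam i0 k t z @[t --> U] --> F k z.
Proof.
have [r [M D]] := limit_disc z; apply: (ratio_cvg D).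
by apply: disc_center; case: D.
Qed.

Lemma limit_holo k : holo setT (F k).
Proof.
move=> z _; have [r [M D]] := limit_disc z; apply: (ratio_lim_holo D).
by apply: disc_center; case: D.
Qed.

Lemma limit_unit k z w : F k z != 0 -> F k w != 0.
Proof.
move=> kz; apply: (@connected_locally_constant R setT (fun x => F k x != 0)
  (convexC_connected setT_convex) _ z Logic.I kz w Logic.I) => x _.
have [r [M D]] := limit_disc x; have r0 : 0 < r by case: D.
have xr := disc_center x r0; exists r => // y _ yr.
by split; [exact: (ratio_lim_unit D xr yr)|exact: (ratio_lim_unit D yr xr)].
Qed.

Lemma limit_one z : F i0 z = 1.
Proof.
have h := @limit_cvg i0 z.
have c1 : ratio expfam i0 i0 t z @[t --> U] --> (1 : C).
  rewrite (_ : (fun t => ratio expfam i0 i0 t z) = fun=> 1); first exact: cvg_cst.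
  by apply/funext => t; rewrite /ratio mulfV// cexp_neq0.
exact: cvgC_unique h c1.
Qed.

(** The weights are at most the moduli of the ratios by any coordinate. *)
Lemma gauge_le_wronskian t : (forall l, derivable (H t l) 0 1) ->
  gauge (H t) 0 <= \sum_(a < n.+1) \sum_(b < n.+1)
    normc (cder (ratio expfam i0 a t) 0 * ratio expfam i0 b t 0 -
           ratio expfam i0 a t 0 * cder (ratio expfam i0 b t) 0).
Proof.
move=> dH; apply: ler_sum => a _; apply: ler_sum => b _.
have rE k w : ratio expfam i0 k t w = cexp (H t k w - H t i0 w).
  by rewrite /ratio /expfam cexpD cexpN.
have dE k : cder (ratio expfam i0 k t) 0 =
    ratio expfam i0 k t 0 * (cder (H t k) 0 - cder (H t i0) 0).
  have -> : ratio expfam i0 k t = fun w => cexp (H t k w - H t i0 w).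
    by apply/funext => w; exact: rE.
  apply: cderE; apply: (is_derive_compC (g := fun w => H t k w - H t i0 w)).
    exact: is_derive_cexp.
  exact: deriv_sub (cderP (dH k)) (cderP (dH i0)).
have key (x y p q d : C) : x * (p - d) * y - x * (y * (q - d)) = (p - q) * (x * y).
  by ring.
rewrite !dE key 2!normcM ler_wpM2l ?normc_ge0//.
have wle k : weight (H t) k 0 <= normc (ratio expfam i0 k t 0).
  rewrite /ratio normcM normcV !expfam_modulus /weight ler_wpM2l ?expR_ge0//.
  by rewrite lef_pV2 ?posrE ?hsum_gt0 ?expR_gt0// hsum_ge.
by apply: ler_pM; [exact: ltW (weight_gt0 _ _ _)|exact: ltW (weight_gt0 _ _ _)|exact: wle|exact: wle].
Qed.

(** Constant limits would make the gauge at 0 tend to 0. *)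
Lemma limit_nonconstant : exists k z w, F k z != F k w.
Proof.
apply: contrapT => const.
have {}const k z w : F k z = F k w.
  by apply/eqP; apply: contrapT => /negP h; apply: const; exists k, z, w.
have dF k : cder (F k) 0 = 0.
  have -> : F k = fun=> F k 0 by apply/funext => w; exact: const.
  exact: cderE (deriv_cst _ _).
have [r [M D]] := limit_disc 0.
have dcv k : cder (ratio expfam i0 k t) 0 @[t --> U] --> (0 : C).
  have h : cder (ratio expfam i0 k t) 0 @[t --> U] --> cder (F k) 0.
    exact: (weierstrass_center (ratio_bounded_limit D k)).2.
  by move: h; rewrite (dF k).
pose W t := \sum_(a < n.+1) \sum_(b < n.+1)
    normc (cder (ratio expfam i0 a t) 0 * ratio expfam i0 b t 0 -
           ratio expfam i0 a t 0 * cder (ratio expfam i0 b t) 0).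
have W0 : W t @[t --> U] --> (0 : R).
  have -> : 0 = \sum_(a < n.+1) \sum_(b < n.+1) (0 : R).
    by rewrite big1// => a _; rewrite big1.
  apply: cvg_bigsum => a; apply: cvg_bigsum => b.
  have h := cvg_normc (cvgB (cvgM (dcv a) (@limit_cvg b 0)) (cvgM (@limit_cvg a 0) (dcv b))).
  by rewrite mul0r mulr0 subrr normc0 in h; exact: h.
have : (1 : R) <= 0; last by rewrite ler10.
apply: (cvgr_to_ge W0); move: Hgauge0 (Hholo 1); apply: filterS2 => t g1 hh.
rewrite -g1; apply: gauge_le_wronskian => l; apply: hh.
exact: disc_center.
Qed.

End RescaledLimit.

(** * Hyperplanes and cancellation *)

Lemma near_all4 (T : Type) (F : set_system T) {FF : Filter F}
    (P1 P2 P3 P4 Q : T -> Prop) : (forall t, P1 t -> P2 t -> P3 t -> P4 t -> Q t) ->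
  (\forall t \near F, P1 t) -> (\forall t \near F, P2 t) ->
  (\forall t \near F, P3 t) -> (\forall t \near F, P4 t) -> \forall t \near F, Q t.
Proof. by move=> H h1 h2 h3 h4; near do apply: H. Unshelve. all: by end_near. Qed.

Lemma cvgR_le (R : realType) (T : Type) (F : set_system T) {FF : ProperFilter F}
    (f g : T -> R) (x y : R) : f t @[t --> F] --> x -> g t @[t --> F] --> y ->
  (\forall t \near F, f t <= g t) -> x <= y.
Proof.
move=> fx gy fg; rewrite -subr_ge0; apply: (cvgr_to_ge (cvgB gy fx)).
by apply: filterS fg => t; rewrite -subr_ge0.
Qed.

Section Rescaling.
Context {R : realType} {T : Type} {U : set_system T} {UU : UltraFilter U}.
Context {n : nat}.
Notation C := R[i].
Notation I := 'I_n.+1.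
Implicit Types (w : C) (r s : R) (i k l : I).

(** Rescalings of the logarithms h / K around the points z, at the scale rho. *)
Definition rescaled (h : T -> I -> C -> C) (z : T -> C) (rho K : T -> R) t :=
  affine (root (h t) (K t)) (z t) (rho t).

(** The gauge is at most K^2 on the smaller disc, hence K tends to infinity along
U; so do the radii of the discs on which the rescaled gauge is at most 2. *)
Lemma rescaling_exists (h : T -> I -> C -> C) z0 r : 0 < r ->
  (\forall t \near U, forall i, holo (disc z0 r) (h t i)) ->
  (forall B, \forall t \near U, exists2 w, cdisc z0 (r / 4) w & B < gauge (h t) w) ->
  exists (z : T -> C) (rho K : T -> R), [/\ (forall B, \forall t \near U, B <= K t),
    (forall s, \forall t \near U, forall w, disc 0 s w -> disc z0 r (z t + (rho t)%:C * w)),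
    (forall s, \forall t \near U, forall l, holo (disc 0 s) (rescaled h z rho K t l)),
    (forall s, \forall t \near U, forall w, disc 0 s w ->
      gauge (rescaled h z rho K t) w <= 2) &
    \forall t \near U, gauge (rescaled h z rho K t) 0 = 1].
Proof.
move=> r0 hh unb.
pose good (t : T) (x : C * R * R) := let: (z, rho, K) := x in
  [/\ 0 < rho, 1 <= K, forall w, cdisc z0 (r / 4) w -> gauge (h t) w <= K ^+ 2,
    gauge (affine (root (h t) K) z rho) 0 = 1 &
    forall w, normc w <= K * (r / (8 * n.+1%:R ^+ 2)) ->
      disc z0 r (z + rho%:C * w) /\ gauge (affine (root (h t) K) z rho) w <= 2].
have /choice[x xP] : forall t, exists x, (forall i, holo (disc z0 r) (h t i)) ->
    (exists2 w, cdisc z0 (r / 4) w & 1 < gauge (h t) w) -> good t x.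
  move=> t; have [[ht [w w1 w2]]|no] := pselect ((forall i, holo (disc z0 r) (h t i)) /\
      exists2 w, cdisc z0 (r / 4) w & 1 < gauge (h t) w).
    have [|z [rho [K H]]] := @zalcman_point R n (h t) z0 r r0 ht.
      by exists w => //; exact: ltW.
    by exists (z, rho, K).
  by exists (0, 0, 0) => ht hw; case: no.
have {xP}xP : \forall t \near U, good t (x t).
  by move: hh (unb 1); apply: filterS2 => t; exact: xP.
exists (fun t => (x t).1.1), (fun t => (x t).1.2), (fun t => (x t).2).
have Kbig B : \forall t \near U, B <= (x t).2.
  move: xP (unb (`|B| ^+ 2)); apply: filterS2 => t.
  case: (x t) => [[z rho] K] [_ K1 Kg _ _] [w /Kg wK Bw] /=.
  have : `|B| ^+ 2 < K ^+ 2 by apply: lt_le_trans wK.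
  rewrite ltr_pXn2r ?nnegrE ?normr_ge0//; last by lra.
  by move=> /ltW; apply: le_trans; exact: ler_norm.
pose k0 : R := r / (8 * n.+1%:R ^+ 2).
have k00 : 0 < k0 by rewrite divr_gt0// mulr_gt0// exprn_gt0// ltr0n.
have large s : \forall t \near U, forall w, disc 0 s w -> normc w <= (x t).2 * k0.
  apply: filterS (Kbig (s / k0)) => t; rewrite ler_pdivrMr// => sK w.
  by rewrite /disc /= subr0 => ws; apply: le_trans sK; exact: ltW.
split.
- exact: Kbig.
- move=> s; move: xP (large s); apply: filterS2 => t.
  by case: (x t) => [[z rho] K] [_ _ _ _ H] /= ls w /ls /H[].
- move=> s; move: xP (large s) hh; apply: filterS3 => t.
  rewrite /rescaled; case: (x t) => [[z rho] K] [_ _ _ _ H] /= ls ht l w /ls /H[wr _].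
  by case: (derivable_affine (@holo_root R n (disc z0 r) (h t) K ht l _ wr)).
- move=> s; move: xP (large s); apply: filterS2 => t.
  by rewrite /rescaled; case: (x t) => [[z rho] K] [_ _ _ _ H] /= ls w /ls /H[].
- by apply: filterS xP => t; rewrite /rescaled; case: (x t) => [[z rho] K] [].
Qed.

(** Constant factors disappear under K-th roots. *)
Lemma expR_div_cvg1 (K : T -> R) (L : R) : (forall B, \forall t \near U, B <= K t) ->
  expR (L / K t) @[t --> U] --> (1 : R).
Proof.
move=> Kbig; have LK0 : L / K t @[t --> U] --> (0 : R).
  apply/cvgrPdistC_le => e e0; have L1 : 0 < `|L| + 1 by have := normr_ge0 L; lra.
  apply: filterS (Kbig ((`|L| + 1) / e)) => t; rewrite ler_pdivrMr// => H.
  have K0 : 0 < K t by have : 0 < K t * e by [lra]; rewrite pmulr_lgt0.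
  rewrite subr0 normrM normfV (gtr0_norm K0) ler_pdivrMr// mulrC; lra.
have hc : expR (L / K t) @[t --> U] --> expR 0.
  exact: (@continuous_cvg _ _ _ U _ (fun t => L / K t) expR 0 (@continuous_expR R 0) LK0).
by rewrite expR0 in hc; exact: hc.
Qed.

End Rescaling.

Section Position.
Context {R : realType} {n : nat} {J : finType}.
Notation C := R[i].
Notation I := 'I_n.+1.
Implicit Types (i : I) (j : J).

(** Hyperplanes in general position: n+1 coordinate hyperplanes and those of
coefficients c, of which no nonzero point lies on more than n. *)
Definition position_general (c : J -> I -> C) := forall p : I -> C,
  (exists i, p i != 0) -> (#|[pred i | (p i == 0)%R]| +
    #|[pred j | (\sum_(i < n.+1) c j i * p i == 0)%R]| <= n)%N.

End Position.

Section Cancellation.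
Context {R : realType} {T : Type} {U : set_system T} {UU : UltraFilter U}.
Context {n : nat} {J : finType}.
Notation C := R[i].
Notation I := 'I_n.+1.
Implicit Types (w zeta : C) (s : R) (i k l a b : I) (j : J).

Context (phi h : T -> I -> C -> C) (c : J -> I -> C) (z0 : C) (r : R) (r0 : 0 < r).
Definition form t j w : C := \sum_(i < n.+1) c j i * phi t i w.
Context (phiholo : \forall t \near U, forall i, holo (disc z0 r) (phi t i)).
Context (phimod : \forall t \near U, forall i w, disc z0 r w ->
  normc (phi t i w) = expR (Re (h t i w))).
Context (formP : \forall t \near U, forall j,
  (forall w, disc z0 r w -> form t j w != 0) \/
  (forall w, disc z0 r w -> form t j w = 0)).
Context (z : T -> C) (rho K : T -> R).
Context (Kbig : forall B, \forall t \near U, B <= K t).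
Context (zdisc : forall s, \forall t \near U, forall w, disc 0 s w ->
  disc z0 r (z t + (rho t)%:C * w)).
Let H := rescaled h z rho K.
Context (Hholo : forall s, \forall t \near U, forall l, holo (disc 0 s) (H t l)).
Context (i0 : I) (lead : forall z, leading (U := U) (expfam H) i0 z).

Let F k w : C := ratio_lim (U := U) (expfam H) i0 k w.
Let pt t w : C := z t + (rho t)%:C * w.

Lemma pt_disc w : \forall t \near U, disc z0 r (pt t w).
Proof.
apply: filterS (zdisc (normc w + 1)) => t; apply.
by rewrite /disc /= subr0; lra.
Qed.

Lemma ReH t l w : Re (H t l w) = Re (h t l (pt t w)) / K t.
Proof. by rewrite /H /rescaled /affine /root Re_scale mulrC. Qed.

Lemma ratio_modulus t k l w : 
  normc (ratio (expfam H) l k t w) = expR (Re (H t k w) - Re (H t l w)).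
Proof. by rewrite normcM normcV !expfam_modulus expRD expRN. Qed.

(** The sum of the coordinates dominates the value of the j-th form, but in the
limit it may be negligible: then the coordinates cancel in that form. *)
Definition cancels j w := forall e, 0 < e -> \forall t \near U,
  normc (form t j (pt t w)) <= e * hsum (h t) (pt t w).

Lemma not_cancels j w : ~ cancels j w -> exists2 e, 0 < e & \forall t \near U,
  e * hsum (h t) (pt t w) < normc (form t j (pt t w)).
Proof.
move=> /existsNP[e /not_implyP[e0 ne]]; exists e => //.
by apply: filterS (near_not ne) => t /negP; rewrite -ltNge.
Qed.

Lemma form_bound j : exists2 B, 1 <= B & \forall t \near U, forall w,
  disc z0 r w -> exists m, normc (form t j w) <= B * expR (Re (h t m w)).
Proof.
exists (1 + \sum_(i < n.+1) normc (c j i)).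
  by rewrite lerDl; apply: sumr_ge0 => i _; exact: normc_ge0.
apply: filterS phimod => t pm w wr.
have [m mP] := exists_argmax ord0 (fun k => Re (h t k w)); exists m.
have sum_le (s : seq I) : normc (\sum_(i <- s) c j i * phi t i w) <=
    (\sum_(i <- s) normc (c j i)) * expR (Re (h t m w)).
  elim: s => [|i s IH]; first by rewrite !big_nil normc0 mul0r.
  rewrite !big_cons mulrDl; apply: le_trans (normc_add _ _) _.
  by rewrite lerD// normcM ler_wpM2l ?normc_ge0// pm// ler_expR.
apply: le_trans (sum_le _) _; rewrite ler_wpM2r ?expR_ge0//.
by rewrite lerDr.
Qed.

(** The K-th root of a form that does not cancel somewhere has an entire limit,
of modulus at most that of the dominant coordinates, with equality wherever
there is no cancellation. *)
Lemma form_root_limit j zeta : ~ cancels j zeta -> exists G : C -> C,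
  [/\ holo setT G,
    (forall w, exists m, normc (G w) <= normc (F m w)) &
    (forall w a, ~ cancels j w -> normc (F a w) <= normc (G w))].
Proof.
move=> nc; have nz : \forall t \near U, forall w, disc z0 r w -> form t j w != 0.
  have [e e0 big] := not_cancels nc.
  move: big formP (pt_disc zeta); apply: filterS3 => t big /(_ j)[//|z0t] pr.
  move: big; rewrite (z0t _ pr) normc0 => neg.
  have := lt_trans (mulr_gt0 e0 (hsum_gt0 (h t) (pt t zeta))) neg.
  by rewrite ltxx.
have fh : \forall t \near U, holo (disc z0 r) (form t j).
  apply: filterS phiholo => t ph; apply: holo_sum => i.
  by apply: holoM; [exact: holo_cst|exact: ph].
have /choice[eta etaP] : forall t, exists eta, holo (disc z0 r) (form t j) ->
    (forall w, disc z0 r w -> form t j w != 0) -> holo (disc z0 r) eta /\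
    forall w, disc z0 r w -> normc (form t j w) = expR (Re (eta w)).
  move=> t; have [[h1 h2]|no] := pselect (holo (disc z0 r) (form t j) /\
      forall w, disc z0 r w -> form t j w != 0).
    by have [eta e1 e2] := log_modulus r0 h1 h2; exists eta.
  by exists (fun=> 0) => h1 h2; case: no.
have {etaP} : \forall t \near U, holo (disc z0 r) (eta t) /\
    forall w, disc z0 r w -> normc (form t j w) = expR (Re (eta t w)).
  by move: fh nz; apply: filterS2 => t; exact: etaP.
move=> etaP; pose G t w : C := cexp ((K t)^-1%:C * eta t (pt t w) - H t i0 w).
have GE t w : normc (G t w) = expR (Re (eta t (pt t w)) / K t - Re (H t i0 w)).
  by rewrite /G normc_cexp ReB Re_scale [_^-1 * _]mulrC.
have Gh s : \forall t \near U, holo (disc 0 s) (G t).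
  move: etaP (zdisc s) (Hholo s); apply: filterS3 => t [eh _] zd Hh.
  apply: holo_cexp; apply: holoB; last exact: Hh.
  move=> w ws; have d := derivable_affine (eh _ (zd w ws)).
  by case: (deriv_scale (K t)^-1%:C d).
have [B B1 HB] := form_bound j.
have upper s : \forall t \near U, forall w, disc 0 s w -> exists m,
    normc (G t w) <= expR (ln B / K t) * normc (ratio (expfam H) i0 m t w).
  near=> t => w ws; have zd : disc z0 r (pt t w).
    by have h1 : (forall w, disc 0 s w -> disc z0 r (z t + (rho t)%:C * w)) by [near: t]; exact: h1.
  have [m fm] : exists m, normc (form t j (pt t w)) <= B * expR (Re (h t m (pt t w))).
    have h2 : (forall w, disc z0 r w -> exists m, normc (form t j w) <= B * expR (Re (h t m w))).
      by near: t.
    exact: h2.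
  have h3 : holo (disc z0 r) (eta t) /\
    forall w, disc z0 r w -> normc (form t j w) = expR (Re (eta t w)) by near: t.
  exists m; rewrite GE ratio_modulus -expRD ler_expR addrA lerD2r ReH -mulrDl.
  have K0 : 1 <= K t by near: t; exact: Kbig.
  rewrite ler_pM2r ?invr_gt0; last by lra.
  rewrite -ler_expR expRD lnK ?posrE; last by lra.
  by rewrite -h3.2.
have cv1 L : expR (L / K t) @[t --> U] --> (1 : R) by exact: expR_div_cvg1.
have Fcv L k w : expR (L / K t) * normc (ratio (expfam H) i0 k t w) @[t --> U]
    --> normc (F k w).
  rewrite -[normc (F k w)]mul1r; apply: cvgM; first exact: cv1.
  by apply: cvg_normc; exact: limit_cvg.
have Gbound zeta' : exists s M, 0 < s /\ \forall t \near U,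
    holo (disc zeta' s) (G t) /\ forall w, disc zeta' s w -> normc (G t w) <= M.
  have [s [M D]] := limit_disc Hholo lead zeta'; have [s0 _ bd _] := D.
  exists s, (expR (ln B) * M); split=> //.
  move: bd (Gh (normc zeta' + s)) (upper (normc zeta' + s)) (Kbig 1).
  apply: near_all4 => t bd gh up K1.
  split; first exact: holo_sub (@disc0_sub R zeta' s) gh.
  move=> w ws; have [m gm] := up w (disc0_sub ws).
  apply: le_trans gm _; apply: ler_pM; rewrite ?expR_ge0 ?normc_ge0//; last exact: bd.
  rewrite ler_expR ler_pdivrMr; last by lra.
  by rewrite ler_peMr// ln_ge0.
pose Gl w : C := lim (G t w @[t --> U]).
have Gcv w : G t w @[t --> U] --> Gl w.
  have [s [M [s0 HG]]] := Gbound w; suff : cvg (G t w @[t --> U]) by [].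
  apply/cvg_ex; have [|l HH] := @ultra_bounded_cvg R T U UU (fun t => G t w) M.
    by apply: filterS HG => t [_]; apply; exact: disc_center.
  by exists l.
exists Gl; split.
- move=> w _; have [s [M [s0 HG]]] := Gbound w.
  have lim : bounded_limit (U := U) G Gl w s M.
    split; [exact: s0|by apply: filterS HG => t []|by apply: filterS HG => t []|].
    by move=> x _; exact: Gcv.
  exact: (weierstrass_center lim).1.
- move=> w; have : \forall t \near U, exists m,
      normc (G t w) <= expR (ln B / K t) * normc (ratio (expfam H) i0 m t w).
    by apply: filterS (upper (normc w + 1)) => t; apply; rewrite /disc /= subr0; lra.
  move=> /ultra_finite_choice[m mP]; exists m.
  by apply: cvgR_le (cvg_normc (Gcv w)) (Fcv (ln B) m w) mP.
move=> w a /not_cancels[e e0 big].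
apply: cvgR_le (Fcv (ln e) a w) (cvg_normc (Gcv w)) _.
move: big etaP (pt_disc w) (Kbig 1); apply: near_all4 => t big [_ et] pr K1.
rewrite GE ratio_modulus -expRD ler_expR addrA lerD2r ReH -mulrDl.
rewrite ler_pM2r ?invr_gt0; last by lra.
rewrite -ler_expR expRD lnK ?posrE// -et//; apply: le_trans (ltW big).
by rewrite ler_pM2l// hsum_ge.
Unshelve. all: by end_near. Qed.

Context (gp : position_general c).

(** In projective space the curves converge along the filter at the point w. The
limit lies on every coordinate hyperplane that is not dominant and on every
hyperplane whose form cancels, and general position bounds their number. *)
Lemma cancel_count w : (#|[pred j | `[< cancels j w >]]| < #|dominant F w|)%N.
Proof.
have [m mP] : exists m, \forall t \near U, forall k,
    Re (h t k (pt t w)) <= Re (h t m (pt t w)).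
  apply: ultra_finite_choice; apply: nearW => t.
  exact: exists_argmax ord0 (fun k => Re (h t k (pt t w))).
pose x t i : C := phi t i (pt t w) / phi t m (pt t w).
have xmod : \forall t \near U, forall i,
    normc (x t i) = expR (Re (h t i (pt t w)) - Re (h t m (pt t w))).
  move: phimod (pt_disc w); apply: filterS2 => t pm pr i.
  by rewrite normcM normcV !pm// expRD expRN.
have x1 : \forall t \near U, forall i, normc (x t i) <= 1.
  move: xmod mP; apply: filterS2 => t xm mt i.
  by rewrite xm -expR0 ler_expR subr_le0.
have /choice[p pP] : forall i, exists l : C, x t i @[t --> U] --> l.
  move=> i; apply: (@ultra_bounded_cvg R T U UU (fun t => x t i) 1).
  by apply: filterS x1 => t; apply.
have pm1 : p m = 1.
  have c1 : x t m @[t --> U] --> (1 : C).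
    apply/cvgCP => e e0; move: phimod (pt_disc w); apply: filterS2 => t pm pr.
    by rewrite /x mulfV ?subrr ?normc0// -normc_gt0 pm// expR_gt0.
  exact: cvgC_unique (pP m) c1.
have nondom i : i \notin dominant F w -> p i = 0.
  move=> /dominantP/existsNP[k /negP]; rewrite -ltNge => ik.
  apply: normc_small => e e0; apply: (cvg_normc_le (pP i)).
  have Fk0 : 0 < normc (F k w) by apply: le_lt_trans ik; exact: normc_ge0.
  pose th := (normc (F i w) / normc (F k w) + 1) / 2.
  have q1 : normc (F i w) / normc (F k w) < 1 by rewrite ltr_pdivrMr// mul1r.
  have q0 : 0 <= normc (F i w) / normc (F k w) by rewrite divr_ge0 ?normc_ge0.
  have th0 : 0 < th by rewrite /th; lra.
  have th1 : th < 1 by rewrite /th; lra.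
  have Fth : normc (F i w) < th * normc (F k w).
    by rewrite -ltr_pdivrMr// /th; lra.
  have cvd : th * normc (ratio (expfam H) i0 k t w) - normc (ratio (expfam H) i0 i t w)
      @[t --> U] --> th * normc (F k w) - normc (F i w).
    apply: cvgB; last by apply: cvg_normc; exact: limit_cvg.
    apply: cvgM; first exact: cvg_cst.
    by apply: cvg_normc; exact: limit_cvg.
  have lnth : ln th < 0 by rewrite -ln1 ltr_ln ?posrE.
  have d0 : 0 < th * normc (F k w) - normc (F i w) by rewrite subr_gt0.
  move/cvgrPdistC_lt: cvd => /(_ _ d0) near_d.
  move: near_d (Kbig (Num.max 1 (ln e / ln th))) xmod mP.
  apply: near_all4 => t dt; rewrite ge_max => /andP[K1 Ke] xm mt.
  have : normc (ratio (expfam H) i0 i t w) < th * normc (ratio (expfam H) i0 k t w).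
    by move: dt; rewrite ltr_norml => /andP[]; lra.
  rewrite !ratio_modulus -[th]lnK ?posrE// -expRD ltr_expR addrA ltrD2r !ReH.
  have K0 : 0 < K t by lra.
  rewrite ltr_pdivrMr// mulrDl divfK ?lt0r_neq0// => ui.
  rewrite xm -[e]lnK ?posrE// ler_expR.
  have Ke' : K t * ln th <= ln e by rewrite -ler_ndivrMr.
  by have := mt k; lra.
have can j : cancels j w -> \sum_(i < n.+1) c j i * p i = 0.
  move=> cj; apply: normc_small => e e0.
  have cv : \sum_(i < n.+1) c j i * x t i @[t --> U] --> \sum_(i < n.+1) c j i * p i.
    apply: cvg_bigsum => i; apply: cvgM; [exact: cvg_cst|exact: pP].
  apply: (cvg_normc_le cv).
  have N0 : 0 < n.+1%:R :> R by rewrite ltr0n.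
  have e1 : 0 < e / n.+1%:R by rewrite divr_gt0.
  move: (cj _ e1) mP phimod (pt_disc w); apply: near_all4 => t ct mt pm pr.
  have -> : \sum_(i < n.+1) c j i * x t i = form t j (pt t w) / phi t m (pt t w).
    by rewrite /form mulr_suml; apply: eq_bigr => i _; rewrite mulrA.
  rewrite normcM normcV ler_pdivrMr pm ?expR_gt0//; apply: le_trans ct _.
  apply: le_trans (ler_wpM2l (ltW e1) (hsum_le mt)) _.
  by rewrite mulrA divfK// lt0r_neq0.
have := @gp p (ex_intro _ m _); rewrite pm1 oner_neq0 => /(_ isT) H1.
have sub1 : ~: dominant F w \subset [pred i | p i == 0].
  by apply/fintype.subsetP => i; rewrite !inE => hi; apply/eqP/nondom; rewrite inE.
have sub2 : [pred j | `[< cancels j w >]] \subset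
    [pred j | \sum_(i < n.+1) c j i * p i == 0].
  by apply/fintype.subsetP => j; rewrite !inE => cj; apply/eqP/can; do 2 move/asboolP: cj => cj.
rewrite -(ltn_add2r #|~: dominant F w|) cardsC card_ord addnC ltnS.
exact: leq_trans (leq_add (subset_leq_card sub1) (subset_leq_card sub2)) H1.
Qed.

End Cancellation.

(** * A normality criterion of Bloch and Cartan *)

Section BlochCartan.
Context {R : realType} {T : Type} {U : set_system T} {UU : UltraFilter U}.
Context {n : nat} {J : finType}.
Notation C := R[i].
Notation I := 'I_n.+1.
Implicit Types (w : C) (i k : I) (j : J).

(** Otherwise the gauge of the logarithms is unbounded, and the K-th roots of the
rescaled coordinates, divided by a leading one, have entire limits F, each
without zeros or identically 0, and not all constant. Two disjoint sets A and B of coordinates dominate near two points. A form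
that does not cancel at either point would have a root limit whose modulus is
that of F a and of F b, for a in A and b in B, which are different. So each of
the n forms cancels at one of the points, at most |A| - 1 of them at the first
and |B| - 1 at the second, but |A| + |B| <= n + 1. *)
Theorem bloch_cartan (phi : T -> I -> C -> C) (c : J -> I -> C) z0 (r : R) :
  0 < r -> (n <= #|J|)%N -> position_general c ->
  (\forall t \near U, forall i, holo (disc z0 r) (phi t i) /\
    forall w, disc z0 r w -> phi t i w != 0) ->
  (\forall t \near U, forall j,
    (forall w, disc z0 r w -> form phi c t j w != 0) \/
    (forall w, disc z0 r w -> form phi c t j w = 0)) ->
  tame (U := U) phi z0.
Proof.
move=> r0 Jn gp phiu formP; apply: contrapT => nt.
have /choice[h hP] : forall t, exists h : I -> C -> C,
    (forall i, holo (disc z0 r) (phi t i) /\ forall w, disc z0 r w -> phi t i w != 0) ->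
    forall i, holo (disc z0 r) (h i) /\
      forall w, disc z0 r w -> normc (phi t i w) = expR (Re (h i w)).
  move=> t; have [pt|no] := pselect (forall i, holo (disc z0 r) (phi t i) /\
      forall w, disc z0 r w -> phi t i w != 0); last by exists (fun _ _ => 0).
  suff /choice[h hP] : forall i, exists h, holo (disc z0 r) h /\
      forall w, disc z0 r w -> normc (phi t i w) = expR (Re (h w)) by exists h.
  move=> i; have [h h1 h2] := log_modulus r0 (pt i).1 (pt i).2.
  by exists h.
have hh : \forall t \near U, forall i, holo (disc z0 r) (h t i).
  by apply: filterS phiu => t pt i; case: (hP t pt i).
have phimod : \forall t \near U, forall i w, disc z0 r w ->
    normc (phi t i w) = expR (Re (h t i w)).
  by apply: filterS phiu => t pt i; case: (hP t pt i).
have phih : \forall t \near U, forall i, holo (disc z0 r) (phi t i).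
  by apply: filterS phiu => t pt i; case: (pt i).
have unb B : \forall t \near U, exists2 w, cdisc z0 (r / 4) w & B < gauge (h t) w.
  suff : ~ \forall t \near U, forall w, cdisc z0 (r / 4) w -> gauge (h t) w <= B.
    move=> /near_not; apply: filterS => t /existsNP[w /not_implyP[wr /negP]].
    by rewrite -ltNge; exists w.
  move=> bd; apply: nt.
  pose B' := `|B| + 1; have B'0 : 0 < B' by have := normr_ge0 B; rewrite /B'; lra.
  pose s := Num.min (r / 4) (2 * B' * n.+1%:R)^-1.
  have s0 : 0 < s by rewrite lt_min divr_gt0//= invr_gt0 !mulr_gt0// ltr0n.
  have s1 : s <= r / 4 by rewrite ge_min lexx.
  have s2 : s <= (2 * B' * n.+1%:R)^-1 by rewrite ge_min lexx orbT.
  have sub : disc z0 s `<=` disc z0 r by apply: disc_le; lra.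
  suff : exists i, \forall t \near U, forall k w, disc z0 s w ->
      normc (phi t k w) <= 2 * n.+1%:R * normc (phi t i w).
    by move=> [i iP]; exists i, s, (2 * n.+1%:R).
  apply: ultra_finite_choice; move: bd hh phimod; apply: filterS3 => t bd ht pm.
  have [||i iP] := @marty R n (h t) z0 s B' B'0 s0 s2.
  - by move=> l; exact: holo_sub sub (ht l).
  - move=> w ws; apply: le_trans (bd w _) _; last by have := ler_norm B; rewrite /B'; lra.
    by move: ws; rewrite /disc /cdisc /=; lra.
  by exists i => k w ws; rewrite !pm; [exact: iP|exact: sub|exact: sub].
have [z [rho [K [Kbig zdisc Hholo Hgauge Hgauge0]]]] := rescaling_exists r0 hh unb.
set H := rescaled h z rho K in Hholo Hgauge Hgauge0.
have [i0 lead] := expfam_leading Hholo Hgauge.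
pose F k w := ratio_lim (U := U) (expfam H) i0 k w.
have Fh k : holo setT (F k) by exact: limit_holo.
have Fu k x y : F k x != 0 -> F k y != 0 by exact: limit_unit.
have F1 x : F i0 x = 1 by exact: limit_one.
have Fnc : exists k x y, F k x != F k y by exact: limit_nonconstant.
have [za [zb [s [s0 sa sb ab]]]] := two_dominant_classes Fh Fu F1 Fnc.
pose can x := [pred j | `[< cancels (U := U) phi h c z rho j x >]].
have countA x : (#|can x| < #|dominant F x|)%N.
  exact: (cancel_count phimod Kbig zdisc Hholo lead gp x).
have Fu_dom x a : a \in dominant F x -> forall w, F a w != 0.
  move=> /dominantP/(_ i0); rewrite F1 normc1 => a1 w; apply: (Fu a x w).
  by rewrite -normc_gt0; lra.
have ex_dom x : exists a, a \in dominant F x.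
  by apply/set0Pn; rewrite -card_gt0; exact: leq_ltn_trans (countA x).
have covers j : (j \in can za) || (j \in can zb).
  rewrite !inE -implyNb; apply/implyP => /asboolPn na; apply/asboolP.
  apply: contrapT => nb.
  have [G [Gh Gle Gge]] := form_root_limit r0 phih phimod formP Kbig zdisc Hholo lead na.
  have G_dom x a w : 0 < s -> (forall w, disc x s w -> dominant F w = dominant F x) ->
      ~ cancels (U := U) phi h c z rho j x -> a \in dominant F x ->
      normc (G w) = normc (F a w).
    move=> _ sx nx ax; apply: (modulus_rigid (z := x) s0 Gh (Fh a) (Fu_dom x a ax)).
      move=> y /sx E; have [m mP] := Gle y; apply: le_trans mP _.
      by move: ax; rewrite -E => /dominantP.
    apply/eqP; rewrite eq_le Gge// andbT.
    by have [m mP] := Gle x; apply: le_trans mP _; move/dominantP: ax.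
  have [a aA] := ex_dom za; have [b bB] := ex_dom zb.
  have [w] := ab a b aA bB; rewrite -(G_dom za a w)// -(G_dom zb b w)//.
  by rewrite eqxx.
have disj : dominant F za :&: dominant F zb = finset.set0.
  apply/setP => a; rewrite !inE; apply/negP => /andP[aA aB].
  have [w] : exists w, normc (F a w) != normc (F a w).
    by apply: ab; rewrite inE.
  by rewrite eqxx.
have cardJ : (#|J| <= #|can za| + #|can zb|)%N.
  rewrite -cardUI; apply: leq_trans (leq_addr _ _).
  by apply: subset_leq_card; apply/fintype.subsetP => j _; exact: covers.
have cardI : (#|dominant F za| + #|dominant F zb| <= n.+1)%N.
  rewrite -cardsUI disj cards0 addn0 -[X in (_ <= X)%N]card_ord.
  exact: max_card.
have := countA za; have := countA zb; move: cardJ cardI Jn.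
move: #|J| #|can za| #|can zb| #|dominant F za| #|dominant F zb|.
by move=> *; lia.
Qed.

End BlochCartan.

(** * Isolated exceptional points *)

Section IsolatedPoints.
Context {R : realType}.
Notation C := R[i].

(** A continuous image of the segment [-pi, pi]. *)
Lemma circle_connected (c : C) (s : R) : connected (circle c s).
Proof.
have [s0|s0] := ltP 0 s; last first.
  have [s00|sn0] := eqVneq s 0.
    have -> : circle c s = [set c]; last exact: connected1.
    apply/seteqP; split=> w; rewrite /circle /= s00.
      by move=> /eqP; rewrite normc_eq0 subr_eq0 => /eqP.
    by move=> ->; rewrite subrr normc0.
  have -> : circle c s = set0; last exact: connected0.
  apply/seteqP; split=> // w; rewrite /circle /= => ws.
  by have := normc_ge0 (w - c); rewrite ws => s1; case/eqP: sn0; apply/eqP; rewrite eq_le s0.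
pose p (t : R) : C := c + s%:C * cexp (0 +i* t).
have -> : circle c s = p @` `[(- pi), pi].
  apply/seteqP; split=> w; rewrite /circle /=; last first.
    move=> [t _ <-]; rewrite /p addrAC subrr add0r normcM normc_real gtr0_norm//.
    by rewrite normc_cexp /= expR0 mulr1.
  move=> ws; pose u := (w - c) / s%:C.
  have sC : s%:C != 0 by rewrite eq_complex /= eqxx andbT lt0r_neq0.
  have u1 : normc u = 1.
    by rewrite normcM normcV ws normc_real gtr0_norm// mulfV// lt0r_neq0.
  have wE : w = c + s%:C * u by rewrite /u mulrC divfK// addrC subrK.
  case uE : u => [a b].
  have ab : a ^+ 2 + b ^+ 2 = 1.
    have : normc u ^+ 2 = 1 by rewrite u1 expr1n.
    by rewrite uE /normc sqr_sqrtr// addr_ge0// sqr_ge0.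
  have a1 : -1 <= a <= 1.
    by apply/andP; split; have := sqr_ge0 b; nra.
  have sa : sin (acos a) = `|b|.
    by rewrite sin_acos// -sqrtr_sqr; congr Num.sqrt; lra.
  have pa := acos_ge0 a1; have pb := acos_lepi a1; have pi0 := pi_gt0 R.
  have [b0|b0] := leP 0 b.
    exists (acos a); first by rewrite in_itv /=; apply/andP; split; lra.
    rewrite /p wE uE /cexp /= expR0 acosK// sa ger0_norm//.
    by congr (_ + _ * _); rewrite -[RHS]mul1r.
  exists (- acos a); first by rewrite in_itv /=; apply/andP; split; lra.
  rewrite /p wE uE /cexp /= expR0 cosN sinN acosK// sa ltr0_norm// opprK.
  by congr (_ + _ * _); rewrite -[RHS]mul1r.
apply: connected_continuous_connected; first exact: segment_connected.
apply: continuous_subspaceT => t; apply/(@cvgCP _ _ (nbhs t)) => e e0.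
have cc : {for (0 +i* t : C), continuous cexp}.
  by apply: derivable_continuousC; case: (is_derive_cexp (0 +i* t : C)).
have e1 : 0 < e / s by rewrite divr_gt0.
have /continuousCP/(_ _ e1)[d d0 dP] := cc.
apply/nbhs_normP; exists d => // x /= tx.
have -> : p x - p t = s%:C * (cexp (0 +i* x) - cexp (0 +i* t)) by rewrite /p; ring.
rewrite normcM normc_real gtr0_norm// mulrC -ltr_pdivlMr//; apply: dP.
have -> : (0 +i* x : C) - 0 +i* t = 0 +i* (x - t).
  by apply/eqP; rewrite eq_complex /= subrr !eqxx.
by rewrite /normc expr0n /= add0r sqrtr_sqr distrC.
Qed.

Context {T : Type} {U : set_system T} {UU : UltraFilter U} {I : finType}.
Implicit Types (w : C) (i k : I).

(** Some coordinate leads along a whole circle around z0, with uniform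
constants, and the maximum principle carries the bound inside. *)
Lemma tame_of_punctured (phi : T -> I -> C -> C) z0 (e : R) : 0 < e ->
  (\forall t \near U, forall i, holo (disc z0 e) (phi t i) /\
    forall w, disc z0 e w -> phi t i w != 0) ->
  (forall w, 0 < normc (w - z0) -> normc (w - z0) < e -> tame (U := U) phi w) ->
  tame (U := U) phi z0.
Proof.
move=> e0 phiu tm; pose s := e / 2; have s0 : 0 < s by rewrite divr_gt0.
have cs w : circle z0 s w -> unit_near (U := U) phi w /\ tame (U := U) phi w.
  rewrite /circle /= => ws; split; last by apply: tm; rewrite ws // /s; lra.
  exists (e - s); first by rewrite /s; lra.
  have sub : disc w (e - s) `<=` disc z0 e by rewrite -ws; exact: disc_in.
  apply: filterS phiu => t pt i; split; first exact: holo_sub sub (pt i).1.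
  by move=> x /sub; exact: (pt i).2.
have p0 : circle z0 s (z0 + s%:C) by apply: circle_point; exact: ltW.
have [i i0] := (cs _ p0).2.
have lead : forall w, circle z0 s w -> leading (U := U) phi i w.
  exact: leading_connected (@circle_connected z0 s) cs p0 i0.
pose Q (x : T * (R * R)) w := forall k y, normc (y - w) < x.2.2 ->
  normc (phi x.1 k y) <= x.2.1 * normc (phi x.1 i y).
have FF : Filter (filter_prod U (filter_prod (pinfty_nbhs R) (at_right (0 : R)))) by exact: _.
have unif : \forall x \near filter_prod U (filter_prod (pinfty_nbhs R) (at_right (0 : R))),
    forall w, circle z0 s w -> Q x w.
  apply: compact_near_all; first exact: compact_circle.
  move=> w ws; have [d [M [d0 H]]] := lead w ws.
  exists (d / 2); first by rewrite divr_gt0.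
  exists ([set t | forall k y, disc w d y -> normc (phi t k y) <= M * normc (phi t i y)],
    [set x : R * R | M <= x.1 /\ x.2 < d / 2]).
    split=> //=; exists ([set x | M <= x], [set x | x < d / 2]) => //=.
    by split=> /=; [apply: nbhs_pinfty_ge; exact: num_real|apply: nbhs_right_lt; rewrite divr_gt0].
  move=> [t [M' d']] /= [Ht [MM' dd']] x xw k y yx.
  have yw : disc w d y.
    by rewrite /disc /=; have := normc_trans x y w; move: yx => /=; lra.
  apply: le_trans (Ht k y yw) _; rewrite ler_wpM2r ?normc_ge0//.
move: unif => [[A B] [/= UA [[B1 B2] [/= pB1 pB2] B12]] AB].
have [M MB1] := @filter_ex _ (pinfty_nbhs R) _ _ pB1.
have [d [dB2 [d0 ds]]] : exists d : R, B2 d /\ 0 < d /\ d < s.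
  have : at_right (0 : R) (B2 `&` [set d | 0 < d /\ d < s]).
    apply: filterI => //; apply: filterI; first exact: nbhs_right_gt.
    exact: nbhs_right_lt.
  by move=> /filter_ex[d [? []]]; exists d.
exists i, d, M; split=> //; move: UA phiu; apply: filterS2 => t At pt k z zd.
have QB := AB (t, (M, d)) (conj At (B12 (M, d) (conj MB1 dB2))).
have pi0 w : disc z0 e w -> 0 < normc (phi t i w) by move=> we; rewrite normc_gt0 (pt i).2.
have ze : disc z0 e z by move: zd; rewrite /disc /= /s in ds *; lra.
rewrite -ler_pdivrMr ?pi0// -normcV -normcM.
have qh : holo (disc z0 e) (fun w => phi t k w / phi t i w).
  by apply: holoM; [exact: (pt k).1|apply: holoV; [exact: (pt i).1|exact: (pt i).2]].
apply: (@center_le_circle _ (fun w => phi t k w / phi t i w) z (e - d) s).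
- by [].
- by rewrite /s in ds *; lra.
- exact: holo_continuous qh z ze.
- move=> x _ xz; apply: qh; move: zd; rewrite /disc /= => zd.
  by have := normc_trans z x z0; lra.
move=> x xz; have xe : disc z0 e x.
  by move: zd; rewrite /disc /= => zd; have := normc_trans z x z0; rewrite xz /s in ds *; lra.
rewrite normcM normcV ler_pdivrMr ?pi0//.
apply: (QB (x - z + z0)); first by rewrite /circle /= addrK.
have -> : x - (x - z + z0) = z - z0 by ring.
exact: zd.
Qed.

End IsolatedPoints.

Lemma near_all_seq (T : Type) (F : set_system T) {FF : Filter F} (X : eqType)
    (s : seq X) (P : T -> X -> Prop) :
  (forall x, x \in s -> \forall t \near F, P t x) ->
  \forall t \near F, forall x, x \in s -> P t x.
Proof.
elim: s => [|x s IH] sP; first by apply: filterE.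
have H1 := sP x (mem_head x s).
have H2 : \forall t \near F, forall x, x \in s -> P t x.
  by apply: IH => y ys; apply: sP; rewrite inE ys orbT.
by move: H1 H2; apply: filterS2 => t tx ts y; rewrite inE => /orP[/eqP->|/ts].
Qed.

Section Isolation.
Context {R : realType} {T : Type} {U : set_system T} {UU : UltraFilter U}.
Notation C := R[i].
Implicit Types (w : C) (Z : T -> C -> Prop).

Definition avoided Z w := exists2 d : R, 0 < d &
  \forall t \near U, forall y, disc w d y -> ~ Z t y.

Lemma near_separated (s : seq C) x : \forall d \near 0^'+, forall y : C,
  y \in s -> x != y -> d <= normc (x - y).
Proof.
apply: near_all_seq => y ys; have [->|xy] := eqVneq x y; first by apply: filterE.
have n0 : 0 < normc (x - y) by rewrite normc_gt0 subr_eq0.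
by apply: filterS (nbhs_right_le n0) => d.
Qed.

(** A point is not avoided when almost every t has zeros in each disc around it;
so M + 1 such points would give M + 1 zeros for one t. *)
Lemma avoided_of_bounded Z z0 (r : R) (M : nat) : 0 < r ->
  (\forall t \near U, forall s : seq C, uniq s ->
    (forall x, x \in s -> disc z0 r x /\ Z t x) -> (size s <= M)%N) ->
  exists2 e, 0 < e & forall w, 0 < normc (w - z0) -> normc (w - z0) < e ->
    avoided Z w.
Proof.
move=> r0 bd.
pose bad (s : seq C) := uniq s /\ forall x, x \in s -> disc z0 r x /\ ~ avoided Z x.
have badM s : bad s -> (size s <= M)%N.
  move=> [us sP].
  have [d [d0 sepd ind]] : exists d : R, [/\ 0 < d,
      (forall x, x \in s -> forall y, y \in s -> x != y -> d <= normc (x - y)) &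
      forall x, x \in s -> disc x d `<=` disc z0 r].
    have N1 : \forall d \near (0 : R)^'+, forall x : C, x \in s ->
        forall y, y \in s -> x != y -> d <= normc (x - y).
      by apply: near_all_seq => x _; exact: near_separated.
    have N2 : \forall d \near (0 : R)^'+, forall x : C, x \in s -> disc x d `<=` disc z0 r.
      apply: near_all_seq => x /sP[xr _].
      have x0 : 0 < r - normc (x - z0) by move: xr; rewrite /disc /=; lra.
      by apply: filterS (nbhs_right_le x0) => d /disc_le dx y /dx; exact: disc_in.
    have N3 : \forall d \near (0 : R)^'+, 0 < d by exact: nbhs_right_gt.
    have : \forall d \near (0 : R)^'+, [/\ 0 < d,
      (forall x, x \in s -> forall y, y \in s -> x != y -> d <= normc (x - y)) &
      forall x, x \in s -> disc x d `<=` disc z0 r].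
      by move: N1 N2 N3; apply: filterS3 => d.
    by move=> /filter_ex.
  have hit : \forall t \near U, forall x, x \in s ->
      exists y, [/\ disc x (d / 2) y, disc x d y & Z t y].
    apply: near_all_seq => x /sP[_ nav].
    have : ~ \forall t \near U, forall y, disc x (d / 2) y -> ~ Z t y.
      by move=> H; apply: nav; exists (d / 2) => //; rewrite divr_gt0.
    move=> /near_not; apply: filterS => t /existsNP[y /not_implyP[yx /contrapT Zy]].
    exists y; split=> //; apply: (@disc_le R x (d / 2) d _ y yx).
    by move: d0; lra.
  have [t [bt ht]] := filter_ex (filterI bd hit).
  have /choice[g gP] : forall x, exists y, x \in s ->
      [/\ disc x (d / 2) y, disc x d y & Z t y].
    move=> x; have [xs|xs] := boolP (x \in s); last by exists 0.
    by have [y yP] := ht x xs; exists y.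
  rewrite -(size_map g); apply: bt.
    rewrite map_inj_in_uniq// => x y xs ys gxy; apply/eqP.
    apply: contraT => xy; have := sepd x xs y ys xy; rewrite leNgt.
    have [gx _ _] := gP x xs; have [gy _ _] := gP y ys.
    move: gx gy; rewrite -gxy /disc /= => gx gy.
    by have := normc_trans (g x) x y; have := normc_sub_sym x (g x); lra.
  move=> _ /mapP[x xs ->]; have [_ gx Zx] := gP x xs.
  by split=> //; apply: ind xs _ gx.
have exm : exists m, `[< exists2 s, bad s & size s = m >].
  by exists 0%N; apply/asboolP; exists [::].
have ubm m : `[< exists2 s, bad s & size s = m >] -> (m <= M)%N.
  by move=> /asboolP[s /badM sM <-].
have [m /asboolP[s [us sP] sm] mmax] := ex_maxnP exm ubm.
have : \forall e \near (0 : R)^'+, 0 < e /\ (e <= r /\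
    forall y, y \in s -> z0 != y -> e <= normc (z0 - y)).
  apply: filterI; first exact: nbhs_right_gt.
  by apply: filterI; [exact: nbhs_right_le|exact: near_separated].
move=> /filter_ex[e [e0 [er eP]]]; exists e => // w w0 we.
apply: contrapT => nav.
have ws : w \notin s.
  apply/negP => ws; have := eP w ws; rewrite normc_sub_sym eq_sym -subr_eq0 -normc_gt0.
  by move=> /(_ w0); lra.
have /mmax : `[< exists2 s, bad s & size s = m.+1 >].
  apply/asboolP; exists (w :: s); last by rewrite /= sm.
  split=> /=; first by rewrite ws.
  move=> x; rewrite inE => /orP[/eqP->|/sP//]; split=> //.
  by rewrite /disc /=; lra.
by rewrite ltnn.
Qed.

(** The criterion of Bloch and Cartan applies around the points near z0 other than
z0, and the maximum principle fills in z0. *)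
Theorem tame_everywhere (n : nat) (J : finType) (D : set C)
    (phi : T -> 'I_n.+1 -> C -> C) (c : J -> 'I_n.+1 -> C) :
  open D -> (n <= #|J|)%N -> position_general c ->
  (\forall t \near U, forall i, holo D (phi t i) /\
    forall w, D w -> phi t i w != 0) ->
  (forall z0 j, D z0 -> exists2 e, 0 < e &
    forall w, 0 < normc (w - z0) -> normc (w - z0) < e ->
    exists2 d, 0 < d & \forall t \near U,
      (forall y, disc w d y -> form phi c t j y != 0) \/
      (forall y, disc w d y -> form phi c t j y = 0)) ->
  forall z0, D z0 -> unit_near (U := U) phi z0 /\ tame (U := U) phi z0.
Proof.
move=> oD Jn gp phiu iso z0 Dz0.
have [r r0 rD] := openCP oD Dz0.
have phid w s : disc w s `<=` D -> \forall t \near U, forall i,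
    holo (disc w s) (phi t i) /\ forall y, disc w s y -> phi t i y != 0.
  move=> sub; apply: filterS phiu => t pt i; split; first exact: holo_sub sub (pt i).1.
  by move=> y /sub; exact: (pt i).2.
split; first by exists r => //; exact: phid.
have [e [e0 er eP]] : exists e, [/\ 0 < e, e <= r & forall j w,
    0 < normc (w - z0) -> normc (w - z0) < e -> exists2 d, 0 < d &
    \forall t \near U, (forall y, disc w d y -> form phi c t j y != 0) \/
      (forall y, disc w d y -> form phi c t j y = 0)].
  have N1 : \forall e \near (0 : R)^'+, forall j w,
      0 < normc (w - z0) -> normc (w - z0) < e -> exists2 d, 0 < d &
      \forall t \near U, (forall y, disc w d y -> form phi c t j y != 0) \/
        (forall y, disc w d y -> form phi c t j y = 0).
    apply: filter_forall => j; have [e e0 eP] := iso z0 j Dz0.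
    apply: filterS (nbhs_right_le e0) => e' ee' w w0 we'.
    by apply: eP => //; exact: lt_le_trans ee'.
  have N2 : \forall e \near (0 : R)^'+, 0 < e by exact: nbhs_right_gt.
  have [e [[e0 er] eP]] := filter_ex (filterI (filterI N2 (nbhs_right_le r0)) N1).
  by exists e.
have eD : disc z0 e `<=` D by exact: subset_trans (disc_le er) rD.
apply: (tame_of_punctured e0); first exact: phid.
move=> w w0 we.
have N1 : \forall d \near (0 : R)^'+, forall j,
    \forall t \near U, (forall y, disc w d y -> form phi c t j y != 0) \/
      (forall y, disc w d y -> form phi c t j y = 0).
  apply: filter_forall => j; have [d d0 dP] := eP j w w0 we.
  apply: filterS (nbhs_right_le d0) => d' dd'; apply: filterS dP => t.
  by case=> H; [left|right] => y yd; apply: H; exact: disc_le dd' _ yd.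
have N2 : \forall d \near (0 : R)^'+, 0 < d by exact: nbhs_right_gt.
have ew : 0 < e - normc (w - z0) by rewrite subr_gt0.
have [d [[d0 dw] dP]] := filter_ex (filterI (filterI N2 (nbhs_right_le ew)) N1).
apply: (bloch_cartan d0 Jn gp).
  by apply: phid; apply: subset_trans eD; apply: subset_trans (disc_le dw) (@disc_in _ w z0 e).
exact: filter_forall.
Qed.

End Isolation.

(** * Coordinates of points and curves *)

Section ProjectivePoints.
Local Open Scope quotient_scope.
Context {R : realType} {n : nat}.
Notation C := R[i].
Notation P := (projective R n).
Notation V := 'rV[C]_n.+1.
Implicit Types (p : P) (v w a : V).

Definition coords p : V := \val (repr p : nonzero_vectors).

Lemma coords_neq0 p : coords p != 0.
Proof. exact: set_valP (repr p : nonzero_vectors). Qed.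

Let ones_neq0 : (const_mx 1 : V) \in nonzero_vectors.
Proof.
by apply: mem_set; apply/eqP => /matrixP/(_ 0 0); rewrite !mxE => /eqP; rewrite oner_eq0.
Qed.

(** Total, so that a point can be written down before its coordinates are known
not to vanish simultaneously. *)
Definition lifted v : nonzero_vectors := insubd (SigSub ones_neq0) v.
Definition to_proj v : P := \pi_P (lifted v).

Lemma val_lifted v : v != 0 -> \val (lifted v) = v.
Proof. by move=> v0; rewrite /lifted val_insubd mem_set. Qed.

Lemma pi_collinear (u u' : nonzero_vectors) : \pi_P u = \pi_P u' ->
  exists2 c, c != 0 & \val u' = c *: \val u.
Proof.
move=> /eqquotP; rewrite /collinear_rel /=.
by move=> /asboolP[c [c0 E]]; exists c.
Qed.

Lemma collinear_pi (u u' : nonzero_vectors) c : c != 0 ->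
  \val u' = c *: \val u -> \pi_P u = \pi_P u'.
Proof. by move=> c0 E; apply/eqquotP; apply/asboolP; exists c. Qed.

Lemma coords_to_proj v : v != 0 -> exists2 c, c != 0 & coords (to_proj v) = c *: v.
Proof.
move=> v0; have : \pi_P (lifted v) = \pi_P (repr (to_proj v)) by rewrite reprK.
by move=> /pi_collinear; rewrite val_lifted.
Qed.

Lemma to_proj_scale v p c : c != 0 -> v = c *: coords p -> to_proj v = p.
Proof.
move=> c0 vE; rewrite -[RHS]reprK; apply/esym/(@collinear_pi _ _ c) => //.
rewrite val_lifted// vE scaler_eq0 negb_or c0; exact: coords_neq0.
Qed.

Lemma has_coordinatesP p w :
  has_coordinates p w <-> exists2 c, c != 0 & w = c *: coords p.
Proof.
split=> [[u <- ->]|[c c0 wE]].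
  by apply: pi_collinear; rewrite reprK.
have w0 : w != 0 by rewrite wE scaler_eq0 negb_or c0; exact: coords_neq0.
exists (lifted w); first exact: val_lifted.
by rewrite -(to_proj_scale c0 wE).
Qed.

Lemma linear_formZ a c w : linear_form a (c *: w) = c * linear_form a w.
Proof. by rewrite /linear_form mulr_sumr; apply: eq_bigr => l _; rewrite mxE mulrCA. Qed.

Lemma linear_form_delta l w : linear_form (delta_mx 0 l) w = w 0 l.
Proof.
rewrite /linear_form (bigD1 l)//= mxE !eqxx mul1r big1 ?addr0// => k kl.
by rewrite mxE (negbTE kl) andbF mul0r.
Qed.

Lemma hyperplaneP a p : hyperplane a p <-> linear_form a (coords p) = 0.
Proof.
split=> [[w /has_coordinatesP[c c0 ->]]|H].
  by rewrite linear_formZ => /eqP; rewrite mulf_eq0 (negbTE c0) => /eqP.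
by exists (coords p) => //; apply/has_coordinatesP; exists 1; rewrite ?oner_neq0 ?scale1r.
Qed.

End ProjectivePoints.

Section CurveCoordinates.
Context {R : realType} {n : nat} {D : set R[i]}.
Notation C := R[i].
Notation P := (projective R n).
Notation V := 'rV[C]_n.+1.
Implicit Types (f : D -> P) (a b : V) (z : C).

(** Dividing by a form without zeros on the curve removes the arbitrary choice of
representatives and gives a lift that is holomorphic on all of D. *)
Definition lift_by f b z : V :=
  let w := coords (valL_ (to_proj (const_mx 1)) f z) in (linear_form b w)^-1 *: w.

Lemma valL_val (X : Type) (x : X) (f : D -> X) (d : D) : valL_ x f (\val d) = f d.
Proof. by have := congr1 (@^~ d) (@valLK C X x D f); rewrite /sigL /= => ->. Qed.

Lemma valL_in (X : Type) (x : X) (f : D -> X) z (Dz : D z) :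
  valL_ x f z = f (SigSub (mem_set Dz)).
Proof. exact: valL_val x f (SigSub (mem_set Dz)). Qed.

Lemma linear_form_lift f a b z (Dz : D z) :
  let w := coords (f (SigSub (mem_set Dz))) in
  linear_form a (lift_by f b z) = linear_form a w / linear_form b w.
Proof. by rewrite /= /lift_by valL_in linear_formZ mulrC. Qed.

(** Near z the curve stays in one standard chart, where a quotient of two linear
forms is a quotient of affine functions of the chart coordinates, whatever
representatives have been chosen. *)
Lemma lift_by_holo f a b : open D -> holomorphic_curve f ->
  (forall x, linear_form b (coords (f x)) != 0) ->
  holo D (fun z => linear_form a (lift_by f b z)).
Proof.
move=> oD [_ fh] b0 z Dz.
pose x : D := SigSub (mem_set Dz).
have [i i0] : exists i, coords (f x) 0 i != 0.
  apply: contrapT => no; have /negP := coords_neq0 (f x); apply.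
  apply/eqP/matrixP => r i; rewrite (ord1 r) mxE; apply/eqP.
  by apply: contrapT => /negP ri; apply: no; exists i.
pose ch j := chart i j \o valL_ (f x) f.
have chh j : holomorphic_at (ch j) z by exact: (fh x i i0 j).
have chE j w (Dw : D w) : ch j w =
    coords (f (SigSub (mem_set Dw))) 0 j / coords (f (SigSub (mem_set Dw))) 0 i.
  by rewrite /ch [LHS]/comp (valL_in (f x) f Dw).
pose num (e : V) w := \sum_(l < n.+1) e 0 l * ch l w.
have near_eq : \forall w \near z, linear_form a (lift_by f b w) = num a w / num b w.
  have chi : {for z, continuous (ch i)}.
    by apply: derivable_continuousC; exact: nbhs_singleton (chh i).
  have chiz : ch i z = 1.
    by rewrite (chE _ _ Dz) divff.
  have /continuousCP/(_ 1 ltr01)[d d0 dP] := chi.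
  have [r r0 rD] := openCP oD Dz.
  apply/nbhsCP; exists (Num.min d r); first by rewrite lt_min d0.
  move=> w; rewrite /disc /= lt_min => /andP[wd wr].
  have Dw : D w by exact: rD.
  have wi : coords (f (SigSub (mem_set Dw))) 0 i != 0.
    apply/eqP => E; have := dP w wd; rewrite chiz (chE _ _ Dw).
    by rewrite E invr0 mulr0 sub0r normcN normc1 ltxx.
  have numE e : num e w = linear_form e (coords (f (SigSub (mem_set Dw)))) /
      coords (f (SigSub (mem_set Dw))) 0 i.
    rewrite /num /linear_form mulr_suml; apply: eq_bigr => l _.
    by rewrite (chE _ _ Dw) mulrA.
  by rewrite (linear_form_lift f a b Dw) !numE invfM invrK mulrACA mulVf// mulr1.
have numh e : derivable (num e) z 1.
  have : holo [set z] (num e).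
    apply: holo_sum => l; apply: holoM; first exact: holo_cst.
    by move=> _ ->; exact: nbhs_singleton (chh l).
  by apply.
have nb : num b z != 0.
  have -> : num b z = linear_form b (coords (f x)) / coords (f x) 0 i.
    rewrite /num /linear_form mulr_suml; apply: eq_bigr => l _.
    by rewrite (chE _ _ Dz) mulrA.
  by rewrite mulf_neq0// invr_eq0.
have qd : derivable (fun w => num a w / num b w) z 1.
  have : holo [set z] (fun w => num a w / num b w).
    apply: holoM; first by move=> _ ->; exact: numh.
    by apply: holoV; move=> _ ->; [exact: numh|exact: nb].
  by apply.
have [q qP] : exists q, is_derive z 1 (fun w => num a w / num b w) q.
  by exists ('D_1 (fun w => num a w / num b w) z); split.
have : is_derive z (1 : C) (fun w => linear_form a (lift_by f b w)) q.
  apply: is_derive_near qP; apply: filterS near_eq => w ->. by [].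
by case.
Qed.

Lemma lift_by_reduced f b : open D -> holomorphic_curve f ->
  (forall x, linear_form b (coords (f x)) != 0) ->
  reduced_representation f (lift_by f b).
Proof.
move=> oD fh b0.
have liftE (x : D) : exists2 c, c != 0 & lift_by f b (\val x) = c *: coords (f x).
  exists (linear_form b (coords (f x)))^-1; first by rewrite invr_eq0.
  by rewrite /lift_by valL_val.
split.
- move=> z l Dz; have := lift_by_holo (a := delta_mx 0 l) oD fh b0 Dz.
  congr (derivable _ z 1); apply/funext => w; exact: linear_form_delta.
- move=> z Dz; have [c c0 E] := liftE (SigSub (mem_set Dz)).
  apply: contrapT => no; have /negP := coords_neq0 (f (SigSub (mem_set Dz))); apply.
  apply/eqP/matrixP => r i; rewrite (ord1 r) mxE; apply/eqP.
  apply: contrapT => /negP ri; apply: no; exists i.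
  by rewrite [lift_by _ _ _]E mxE mulf_neq0.
by move=> x; apply/has_coordinatesP; exact: liftE.
Qed.

End CurveCoordinates.

(** * Hyperplanes as coordinates *)

Section CoordinateHyperplanes.
Context {R : realType} {n m q : nat} (e : (n.+1 + m = q)%N).
Notation C := R[i].
Notation V := 'rV[C]_n.+1.
Context (a : 'I_q -> V).
Hypothesis gp : general_position (fun k => hyperplane (a k)).
Implicit Types (v : V) (y : 'I_n.+1 -> C) (i : 'I_n.+1) (j : 'I_m).

Definition lower i : 'I_q := cast_ord e (lshift m i).
Definition upper j : 'I_q := cast_ord e (rshift n.+1 j).

Definition frame : 'M[C]_n.+1 := \matrix_(i < n.+1) a (lower i).

Lemma frame_mul v i : (frame *m v^T) i 0 = linear_form (a (lower i)) v.
Proof. by rewrite mxE; apply: eq_bigr => l _; rewrite !mxE. Qed.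

(** A vector in the kernel would give a point on the first n+1 hyperplanes. *)
Lemma frame_unit : frame \in unitmx.
Proof.
rewrite unitmxE unitfE -det_tr; apply/negP => /det0P[v v0 vA].
have inj : injective lower by move=> i i' /cast_ord_inj/lshift_inj.
have := gp (Q := [set lower i | i : 'I_n.+1]%SET).
rewrite card_imset// card_ord => /(_ erefl) E.
suff : (set0 : set (projective R n)) (to_proj v) by [].
rewrite -E => _ /= /imsetP[i _ ->]; apply/hyperplaneP.
have [c _ ->] := coords_to_proj v0; rewrite linear_formZ -frame_mul.
by rewrite -[frame]trmxK -trmx_mul vA trmx0 mxE mulr0.
Qed.

Definition upper_coef j i : C := (a (upper j) *m invmx frame) 0 i.

Lemma upper_form j v : linear_form (a (upper j)) v =
  \sum_(i < n.+1) upper_coef j i * linear_form (a (lower i)) v.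
Proof.
transitivity ((a (upper j) *m v^T) 0 0).
  by rewrite mxE; apply: eq_bigr => l _; rewrite !mxE.
rewrite -[X in (X *m _) 0 0](mulmxKV frame_unit) -(mulmxA _ frame) mxE.
by apply: eq_bigr => i _; rewrite frame_mul.
Qed.

(** The vector whose values under the first n+1 forms are prescribed. *)
Definition vec y : V := (invmx frame *m (\col_i y i))^T.

Lemma vecE y l : vec y 0 l = \sum_(i < n.+1) invmx frame l i * y i.
Proof. by rewrite !mxE; apply: eq_bigr => i _; rewrite mxE. Qed.

Lemma form_vec y i : linear_form (a (lower i)) (vec y) = y i.
Proof. by rewrite -frame_mul trmxK mulKVmx ?frame_unit// mxE. Qed.

Lemma vec_form v : vec (fun i => linear_form (a (lower i)) v) = v.
Proof.
rewrite /vec -[RHS]trmxK; congr (_^T).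
rewrite -[RHS](mulKmx frame_unit); congr (_ *m _).
by apply/colP => i; rewrite mxE frame_mul.
Qed.

Lemma vec_neq0 y i : y i != 0 -> vec y != 0.
Proof.
apply: contra_neq => E; rewrite -form_vec E /linear_form big1// => l _.
by rewrite mxE mulr0.
Qed.

(** The vanishing p i and the vanishing upper forms at p count the hyperplanes of
the family that contain the point of frame coordinates p. *)
Lemma upper_position : position_general upper_coef.
Proof.
move=> p [i0 pi0]; set v := vec p.
pose S := [set k | linear_form (a k) v == 0]%SET.
have -> : (#|[pred i | (p i == 0)%R]| +
    #|[pred j | (\sum_(i < n.+1) upper_coef j i * p i == 0)%R]| = #|S|)%N.
  rewrite -!sum1_card.
  rewrite [RHS](reindex (cast_ord e)) /=; last first.
    by apply: onW_bij; exists (cast_ord (esym e)); [exact: cast_ordK|exact: cast_ordKV].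
  rewrite big_split_ord /=; congr (_ + _)%N; apply: eq_bigl => k.
    by rewrite !inE form_vec.
  rewrite !inE upper_form; congr (_ == 0).
  by apply: eq_bigr => i _; rewrite form_vec.
rewrite leqNgt; apply/negP => /card_geqP[s [us ss sS]].
have := gp (Q := [set k in s]%SET).
rewrite cardsE (card_uniqP us) ss => /(_ erefl) E.
suff : (set0 : set (projective R n)) (to_proj v) by [].
rewrite -E => k /=; rewrite inE => /sS; rewrite inE => /eqP kv.
apply/hyperplaneP; have [c _ ->] := coords_to_proj (vec_neq0 pi0).
by rewrite linear_formZ kv mulr0.
Qed.

End CoordinateHyperplanes.

(** * Projective space and the compact-open topology *)

Lemma normc_bigsum (R : realType) (J : Type) (s : seq J) (x : J -> R[i]) :
  normc (\sum_(j <- s) x j) <= \sum_(j <- s) normc (x j).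
Proof.
elim/big_ind2: _ => [|u r v t ur vt|j _]; [by rewrite normc0| |exact: lexx].
by apply: le_trans (normc_add _ _) _; exact: lerD.
Qed.

Section ProjectiveTopology.
Local Open Scope quotient_scope.
Context {R : realType} {n m q : nat} (e : (n.+1 + m = q)%N).
Notation C := R[i].
Notation P := (projective R n).
Notation V := 'rV[C]_n.+1.
Context (a : 'I_q -> V).
Hypothesis gp : general_position (fun k => hyperplane (a k)).
Implicit Types (v : V) (y : 'I_n.+1 -> C) (i k : 'I_n.+1) (p : P).

Local Notation L k v := (linear_form (a (lower e k)) v).

(** The condition |L k v / L i v - y k| <= eps, cleared of its denominator so that
it is closed and homogeneous. *)
Definition affine_box y i (eps : R) : set V :=
  [set v | forall k, normc (L k v - y k * L i v) <= eps * normc (L i v)].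

Definition proj_box y i (eps : R) : set P := [set p | affine_box y i eps (coords p)].

Lemma affine_boxZ y i eps c v : c != 0 ->
  affine_box y i eps (c *: v) <-> affine_box y i eps v.
Proof.
move=> c0; have c1 : 0 < normc c by rewrite normc_gt0.
have key k : (normc (L k (c *: v) - y k * L i (c *: v)) <= eps * normc (L i (c *: v)))
    = (normc (L k v - y k * L i v) <= eps * normc (L i v)).
  rewrite !linear_formZ [y k * _]mulrCA -mulrBr !normcM mulrCA.
  by rewrite ler_pM2l.
by split=> H k; [rewrite -key|rewrite key].
Qed.

Lemma proj_box_pi y i eps (u : nonzero_vectors) :
  proj_box y i eps (\pi_P u) <-> affine_box y i eps (\val u).
Proof.
have [c c0 E] : exists2 c, c != 0 & coords (\pi_P u) = c *: \val u.
  by apply: pi_collinear; rewrite reprK.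
by rewrite /proj_box /= E; exact: affine_boxZ.
Qed.

Lemma proj_box_to_proj y i eps v : v != 0 ->
  proj_box y i eps (to_proj v) <-> affine_box y i eps v.
Proof. by move=> v0; rewrite -[in X in _ <-> X](val_lifted v0); exact: proj_box_pi. Qed.

Lemma linear_form_continuous b : continuous (linear_form b : V -> C).
Proof.
move=> v; apply: (@cvg_bigsum C C V 'I_n.+1 (nbhs v) _ _ (fun l v => b 0 l * v 0 l)) => l.
apply: cvgM; first exact: cvg_cst.
exact: coord_continuous.
Qed.

Lemma closed_affine_box y i eps : closed (affine_box y i eps).
Proof.
have -> : affine_box y i eps = \bigcap_k
    ((fun v => normc (L k v - y k * L i v) - eps * normc (L i v)) @^-1` [set r | r <= 0]).
  apply/seteqP; split=> v H k; first by move=> _; rewrite /= subr_le0; exact: H.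
  by have := H k Logic.I; rewrite /= subr_le0.
apply: closed_bigI => k _; apply: closed_comp; last exact: closed_le.
move=> v _; have Lc k' : L k' w @[w --> v] --> L k' v by exact: linear_form_continuous.
apply: (@cvgB R R V (nbhs v)).
  apply: (@cvg_normc R V (nbhs v)); apply: (@cvgB C C V (nbhs v)); first exact: Lc.
  by apply: (@cvgM C V (nbhs v)); [exact: cvg_cst|exact: Lc].
apply: (@cvgM R V (nbhs v)); first exact: cvg_cst.
by apply: (@cvg_normc R V (nbhs v)); exact: Lc.
Qed.

Lemma closed_proj_box y i eps : closed (proj_box y i eps).
Proof.
rewrite -openC; apply: (_ : open (\pi_P @^-1` _)).
exists (~` affine_box y i eps); first by rewrite openC; exact: closed_affine_box.
by apply/seteqP; split=> u /=; rewrite proj_box_pi.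
Qed.

Lemma nbhs_rowP v (A : set V) : nbhs v A -> exists2 d : R, 0 < d &
  forall v', (forall l, normc (v' 0 l - v 0 l) < d) -> A v'.
Proof.
move=> /nbhs_ballP[d d0 dA]; case: d d0 dA => dr di /= /[dup] d0; rewrite ltcE /= => /andP[/eqP di0 dr0] dA.
exists dr => // v' H; apply: dA; split=> [//|r l]; rewrite (ord1 r).
rewrite -ball_normE /ball_ /mkset normc_norm normc_sub_sym ltcE /= di0 eqxx /=.
exact: H.
Qed.

(** In the chart L i = 1 the values of the forms are affine coordinates, from which
the vector is recovered linearly. *)
Lemma proj_box_basis y i (O : set P) : y i = 1 -> open O ->
  O (to_proj (vec e a y)) -> exists2 eps, 0 < eps & proj_box y i eps `<=` O.
Proof.
move=> yi oQ Oy.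
have v0 : vec e a y != 0 by apply: (@vec_neq0 R n m q e a gp y i); rewrite yi oner_neq0.
have [W oW WO] : open (\pi_P @^-1` O) by exact: oQ.
have Wv : W (vec e a y).
  rewrite -(val_lifted v0) -/((W \o set_val) (lifted (vec e a y))).
  by rewrite [W \o _]WO.
have [d d0 dW] := nbhs_rowP (open_nbhs_nbhs (conj oW Wv)).
pose N : R := \sum_(l < n.+1) \sum_(k < n.+1) normc (invmx (frame e a) l k).
have N0 : 0 <= N by apply: sumr_ge0 => l _; apply: sumr_ge0 => k _; exact: normc_ge0.
have N1 : 0 < 1 + N by lra.
exists (d / (1 + N)); first by rewrite divr_gt0.
move=> p pb; pose x := coords p.
have Li0 : L i x != 0.
  apply/negP => /eqP E; have /negP := coords_neq0 p; apply; apply/eqP.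
  rewrite -[coords p](vec_form e gp); apply/rowP => l; rewrite vecE mxE big1// => k _.
  have := pb k; rewrite -/x E mulr0 subr0 normc0 mulr0 => Lk.
  have -> : L k x = 0 by apply/eqP; rewrite -normc_eq0 eq_le Lk normc_ge0.
  by rewrite mulr0.
have ci : (L i x)^-1 != 0 by rewrite invr_eq0.
rewrite -(@to_proj_scale R n ((L i x)^-1 *: x) p _ ci erefl).
have x0 : (L i x)^-1 *: x != 0 by rewrite scaler_eq0 negb_or ci; exact: coords_neq0.
suff Wx : W ((L i x)^-1 *: x).
  change ((\pi_P @^-1` O) (lifted ((L i x)^-1 *: x))); rewrite -WO.
  by change (W (\val (lifted ((L i x)^-1 *: x)))); rewrite val_lifted.
apply: dW => l; rewrite -[_ *: x](vec_form e gp) !vecE -sumrB.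
apply: (@le_lt_trans _ _ (\sum_(k < n.+1) normc (invmx (frame e a) l k) * (d / (1 + N)))).
  apply: le_trans (normc_bigsum _ _) _; apply: ler_sum => k _.
  rewrite -mulrBr normcM ler_wpM2l ?normc_ge0// linear_formZ.
  have := pb k; rewrite -/x -ler_pdivrMr ?normc_gt0// -normcV -normcM mulrBl.
  by rewrite -mulrA divff// mulr1 mulrC.
rewrite -mulr_suml mulrCA gtr_pMr// ltr_pdivrMr// mul1r.
have : \sum_(k < n.+1) normc (invmx (frame e a) l k) <= N.
  rewrite /N [leRHS](bigD1 l)//= lerDl; apply: sumr_ge0 => l' _; apply: sumr_ge0 => k _.
  exact: normc_ge0.
by lra.
Qed.

End ProjectiveTopology.

Section Precompactness.
Context {R : realType} {n : nat} {D : set R[i]}.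
Notation P := (projective R n).
Notation T := (Hol n D).

Lemma closed_eval (x : D) (S : set P) : closed S ->
  closed [set f : T | S (curve f x)].
Proof.
move=> cS; rewrite -openC.
exists [set g : {compact-open, D -> P} | g @` [set x] `<=` ~` S].
  by apply: compact_open_open; [exact: compact_set1|rewrite openC].
apply/seteqP; split=> f /=; rewrite image_set1; first by apply.
by move=> nS _ ->.
Qed.

(** An ultrafilter W that contains the closure of F is compared with an ultrafilter
V that contains F and all open sets of W. Closed sets of V belong to W, so the
limit g of V also attracts W once the convergence of V is expressed by closed
sets. *)
Lemma precompact_of_limits (F : set T) :
  (forall U : set_system T, UltraFilter U -> U F -> exists g : T,
    forall (x : D) (Q : set P), open Q -> Q (curve g x) ->
    exists S B, [/\ closed S, S `<=` Q, nbhs x B &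
      \forall f \near U, forall x', B x' -> S (curve f x')]) ->
  precompact F.
Proof.
move=> limF; rewrite precompactE compact_ultra => W UW WF.
pose G : set_system T := [set A | exists Q, [/\ open Q, W Q & F `&` Q `<=` A]].
have FG : ProperFilter G.
  apply: Build_ProperFilter_ex.
    move=> A [Q [oQ WO sub]]; have [f [fO cf]] := filter_ex (filterI WO WF).
    have [h [Fh Oh]] := cf Q (open_nbhs_nbhs (conj oQ fO)).
    by exists h; exact: sub.
  split.
  - by exists setT; split=> //; [exact: openT|exact: filterT].
  - move=> A B [Q [oQ WO sO]] [Q' [oQ' WO' sO']]; exists (Q `&` Q'); split.
    + exact: openI.
    + exact: filterI.
    + by move=> f [Ff [Of Q'f]]; split; [exact: sO|exact: sO'].
  - move=> A B AB [Q [oQ WO sO]]; exists Q; split=> //.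
    exact: subset_trans AB.
have [V [UV GV]] := ultraFilterLemma FG.
have VF : V F by apply: GV; exists setT; split; [exact: openT|exact: filterT|move=> f []].
have VW S : closed S -> V S -> W S.
  move=> cS VS; have [//|WnS] := in_ultra_setVsetC S UW.
  have VnS : V (F `&` ~` S) by apply: GV; exists (~` S); split=> //; rewrite openC.
  by have [f [Sf [_]]] := filter_ex (filterI VS VnS).
have [g gP] := limF V UV VF.
have Wg : W --> g.
  have cv : (\val : T -> {compact-open, D -> P}) @ W --> \val g.
    apply/compact_open_cvgP => K Q /compact_near_coveringP cK oQ gKQ.
    have near : \forall f \near W, K `<=` (fun x => Q (curve f x)).
      apply: (cK T W (fun f x => Q (curve f x))) => x Kx.
      have [|S [B [cS SQ xB VB]]] := gP x Q oQ; first by apply: gKQ; exists x.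
      have cB : closed [set f : T | forall x', B x' -> S (curve f x')].
        have := @closed_bigI T _ B (fun x' => [set f : T | S (curve f x')]).
        by apply=> x' _; exact: closed_eval.
      exists (B, [set f | forall x', B x' -> S (curve f x')]) => /=.
        by split=> //; exact: VW cB VB.
      by move=> [x' f] /= [Bx' H]; apply: SQ; exact: H.
    by apply: filterS near => f H _ [x Kx <-]; exact: H.
  move=> N [_ [[B oB <-] Bg /filterS]]; apply.
  by apply: cv; exact: open_nbhs_nbhs.
exists g; split=> //; rewrite (iffLR (closure_id _) (@closed_closure _ F)) => N /Wg WN.
by have [f [cf Nf]] := filter_ex (filterI WF WN); exists f.
Qed.

End Precompactness.

(** * The limit curve *)

Section LimitCurve.
Context {R : realType} {n m q : nat} (e : (n.+1 + m = q)%N) {D : set R[i]}.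
Notation C := R[i].
Notation P := (projective R n).
Context (a : 'I_q -> 'rV[C]_n.+1).
Hypothesis gp : general_position (fun k => hyperplane (a k)).
Hypothesis oD : open D.
Implicit Types (i k : 'I_n.+1) (z w : C) (x : D).

Local Notation L k p := (linear_form (a (lower e k)) (coords p)).

Definition frame_lift (f : Hol n D) k z : C :=
  linear_form (a (lower e k)) (lift_by (curve f) (a (lower e ord0)) z).

Context {U : set_system (Hol n D)} {UU : UltraFilter U} {i : 'I_n.+1}.
Hypothesis avoid : \forall f \near U, forall x k, L k (curve f x) != 0.
Hypothesis lead : forall z, D z ->
  unit_near (U := U) frame_lift z /\ leading (U := U) frame_lift i z.

Let y k z : C := ratio_lim (U := U) frame_lift i k z.

Definition limit_curve x : P := to_proj (vec e a (y ^~ (\val x))).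

Let D_val x : D (\val x). Proof. exact: set_valP. Qed.

Let ratio_discD z : D z -> exists r M, ratio_disc (U := U) frame_lift i z r M.
Proof. by move=> /lead[un le]; exact: leading_ratio_disc. Qed.

Let y_lead z : D z -> y i z = 1.
Proof.
move=> /ratio_discD[r [M rd]]; have [r0 _ _ nz] := rd.
have c1 : ratio frame_lift i i f z @[f --> U] --> y i z.
  exact: (ratio_cvg (k := i) rd (disc_center z r0)).
apply: (cvgC_unique c1); apply: cvg_near_cst.
apply: filterS nz => f /(_ i z (disc_center z r0)).
by rewrite /ratio mulf_eq0 invr_eq0 orbb => /divff ->.
Qed.

Let vec_y z : D z -> vec e a (y ^~ z) != 0.
Proof.
move=> Dz; apply: (@vec_neq0 R n m q e a gp (y ^~ z) i).
by rewrite /= y_lead// oner_neq0.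
Qed.

Let y_holo k : holo D (y k).
Proof.
move=> z /ratio_discD[r [M rd]]; have [r0 _ _ _] := rd.
exact: (ratio_lim_holo (k := k) rd) (disc_center _ r0).
Qed.

Let y_near z (eps : R) : D z -> 0 < eps -> exists2 d : R, 0 < d &
  forall k w, normc (w - z) < d -> normc (y k w - y k z) < eps.
Proof.
move=> Dz eps0.
have : \forall w \near z, forall k, normc (y k w - y k z) < eps.
  apply: (@filter_forall C 'I_n.+1 (fun k => [set w | normc (y k w - y k z) < eps])
    (nbhs z)) => k; have ck := derivable_continuousC (y_holo (k := k) Dz).
  have /continuousCP/(_ _ eps0)[d d0 dP] := ck.
  by apply/nbhsCP; exists d.
by move=> /nbhsCP[d d0 dP]; exists d => // k w /dP.
Qed.

Lemma near_disc_val x (d : R) : 0 < d -> nbhs x [set x' : D | disc (\val x) d (\val x')].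
Proof.
move=> d0; apply: (@initial_continuous D C set_val x).
by apply: open_nbhs_nbhs; split; [exact: open_disc|exact: disc_center].
Qed.

Let limit_curve_box x x' (eps : R) :
  (forall k, normc (y k (\val x') - y k (\val x)) <= eps) ->
  proj_box e a (y ^~ (\val x)) i eps (limit_curve x').
Proof.
move=> H; apply/proj_box_to_proj; first exact: vec_y (D_val x').
move=> k; rewrite !(form_vec e gp) /= y_lead; last exact: D_val x'.
by rewrite mulr1 normc1 mulr1; exact: H.
Qed.

Lemma limit_curve_continuous : continuous limit_curve.
Proof.
move=> x N; rewrite nbhsE => -[Q [oQ Qx] QN].
have [eps eps0 box] := proj_box_basis gp (y_lead (D_val x)) oQ Qx.
have [d d0 dP] := y_near (D_val x) eps0.
apply: filterS (near_disc_val x d0) => x' xx'; apply/QN/box/limit_curve_box => k.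
by apply: ltW; exact: dP.
Qed.

Lemma limit_curve_holomorphic : holomorphic_curve limit_curve.
Proof.
split; first exact: limit_curve_continuous.
move=> x l gl j; pose v l' w := vec e a (y ^~ w) 0 l'.
have vh l' : holo D (v l').
  have -> : v l' = fun w => \sum_(k < n.+1) invmx (frame e a) l' k * y k w.
    by apply/funext => w; rewrite /v vecE.
  by apply: holo_sum => k; apply: holoM; [exact: holo_cst|exact: y_holo].
have chE w (Dw : D w) : (chart l j \o valL_ (limit_curve x) limit_curve) w = v j w / v l w.
  rewrite /comp (valL_in _ _ Dw) /limit_curve /chart -/(coords _).
  have [c c0 ->] := coords_to_proj (vec_y Dw).
  rewrite /v; move: (vec _ _ _) => u; rewrite !mxE.
  by rewrite invfM mulrACA divff// mul1r.
have vl : v l (\val x) != 0.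
  apply/eqP => vl; have : coords (limit_curve x) 0 l != 0 by exact: gl.
  have [c c0] := coords_to_proj (vec_y (D_val x)); rewrite -/(limit_curve x) => ->.
  by rewrite mxE -/(v l (\val x)) vl mulr0 eqxx.
have [r r0 rD] := openCP oD (D_val x).
have vl0 : 0 < normc (v l (\val x)) by rewrite normc_gt0.
have cl := derivable_continuousC (vh l _ (D_val x)).
have /continuousCP/(_ _ vl0)[d d0 dP] := cl.
pose s := Num.min d r; have s0 : 0 < s by rewrite lt_min d0.
have sD w : disc (\val x) s w -> D w /\ v l w != 0.
  rewrite /disc /= lt_min => /andP[wd wr]; split; first exact: rD.
  apply/eqP => E; have := dP w wd; rewrite E sub0r normcN ltxx.
  by [].
apply/nbhsCP; exists s; first exact: s0.
move=> w ws.
have qh : holo (disc (\val x) s) (fun w => v j w / v l w).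
  apply: holoM; first by apply: holo_sub (vh j) => w' /sD[].
  apply: holoV; first by apply: holo_sub (vh l) => w' /sD[].
  by move=> w' /sD[].
have [c cP] : exists c, is_derive w 1 (fun w => v j w / v l w) c.
  by exists ('D_1 (fun w => v j w / v l w) w); split; first exact: qh ws.
have : is_derive w (1 : C) (chart l j \o valL_ (limit_curve x) limit_curve) c.
  apply: is_derive_near cP.
  apply: filterS (open_nbhs_nbhs (conj (@open_disc R (\val x) s) ws)) => w' /sD[Dw' _].
  by rewrite chE.
by case.
Qed.

(** The ratios converge locally uniformly, which keeps the values of the curves in
the boxes around those of the limit. *)
Lemma limit_curve_cvg x (Q : set P) : open Q -> Q (limit_curve x) ->
  exists S B, [/\ closed S, S `<=` Q, nbhs x B &
    \forall f \near U, forall x', B x' -> S (curve f x')].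
Proof.
move=> oQ Qx; have [eps eps0 box] := proj_box_basis gp (y_lead (D_val x)) oQ Qx.
have eps2 : 0 < eps / 2 by rewrite divr_gt0.
have [d d0 dP] := y_near (D_val x) eps2.
have [r [M rd]] := ratio_discD (D_val x).
have N1 : \forall s \near (0 : R)^'+, forall k, \forall f \near U, forall w,
    normc (w - \val x) < s -> normc (ratio frame_lift i k f w - y k w) < eps / 2.
  apply: filter_forall => k; have [s s0 sP] := locally_uniform_cvg (ratio_bounded_limit rd k) eps2.
  apply: filterS (nbhs_right_le s0) => s' ss'; apply: filterS sP => f H w ws.
  by apply: H; exact: lt_le_trans ws ss'.
have N2 : \forall s \near (0 : R)^'+, 0 < s by exact: nbhs_right_gt.
have [s [[s0 sd] /filter_forall sP]] := filter_ex (filterI (filterI N2 (nbhs_right_le d0)) N1).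
exists (proj_box e a (y ^~ (\val x)) i eps), [set x' | disc (\val x) s (\val x')].
split=> //; [exact: closed_proj_box|exact: near_disc_val|].
move: avoid sP; apply: filterS2 => f fL H x' xx' k /=.
have Li : 0 < normc (L i (curve f x')) by rewrite normc_gt0.
rewrite -ler_pdivrMr// -normcV -normcM mulrBl -mulrA divff ?mulr1//.
have -> : L k (curve f x') / L i (curve f x') = ratio frame_lift i k f (\val x').
  rewrite /ratio /frame_lift /lift_by valL_val !linear_formZ invfM mulrACA.
  by rewrite invrK mulVf// mul1r.
apply: le_trans (normc_trans (y k (\val x')) _ _) _.
rewrite [eps]splitr; apply: lerD; apply: ltW; first exact: H.
exact: dP k (\val x') (lt_le_trans xx' sd).
Qed.

End LimitCurve.

(** * Counting zeros *)

Section ZeroCounting.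
Context {R : realType}.
Notation C := R[i].

Lemma multiplicity_ge1 (g : C -> C) z : g z = 0 -> (1 <= multiplicity g z)%E.
Proof.
move=> gz; apply/ereal_infP => _ [[|k] [h [_ hz /nbhs_singleton gE]] <-].
  by move: hz; rewrite -[h z]mul1r -[1](expr0 (z - z)) -gE gz eqxx.
by rewrite lee_fin ler1n.
Qed.

Lemma zeros_count_ge (g : C -> C) (K : set C) (s : seq C) : uniq s ->
  (forall x, x \in s -> K x /\ g x = 0) -> ((size s)%:R%:E <= zeros_count g K)%E.
Proof.
move=> us sP; apply: (@le_trans _ _ (\sum_(x \in [set` s]) multiplicity g x)%E).
  rewrite -fsbig_seq//; elim: s us sP => [|x s IH] /=; first by rewrite big_nil.
  move=> /andP[_ us] sP; rewrite big_cons -natr1 EFinD addeC.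
  apply: leeD; first by apply: multiplicity_ge1; case: (sP x (mem_head x s)).
  by apply: IH => // y ys; apply: sP; rewrite inE ys orbT.
apply: ereal_sup_ubound; exists [set` s] => //; split; first exact: finite_seq.
by move=> x /= /sP[].
Qed.

End ZeroCounting.

(** * The theorem *)

(* The index k : 'I_(2 * n + 1) stands for the hyperplane H_{k+1}. *)
Theorem theorem1p5 (R : realType) (n : nat) (D : set R[i])
    (F : set (Hol n D)) (a : 'I_(2 * n + 1) -> 'rV[R[i]]_n.+1) :
  (2 <= n)%N ->
  domain D ->
  (forall k, a k != 0) ->
  general_position (fun k => hyperplane (a k)) ->
  (forall f, F f -> forall k : 'I_(2 * n + 1), (1 <= k.+1 <= n + 1)%N ->
     range (curve f) `&` hyperplane (a k) = set0) ->
  (exists t : nat,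
    [/\ (n + 2 <= t < 2 * n + 1)%N,
        forall f g, F f -> F g ->
          forall k : 'I_(2 * n + 1), (n + 2 <= k.+1 <= t)%N ->
            curve f @^-1` hyperplane (a k) = curve g @^-1` hyperplane (a k),
        forall f, F f ->
          forall k : 'I_(2 * n + 1), (t + 1 <= k.+1 <= 2 * n + 1)%N ->
            ~ range (curve f) `<=` hyperplane (a k) &
        forall K : set R[i], compact K -> K `<=` D ->
          exists M : R, forall f, F f ->
            forall k : 'I_(2 * n + 1), (t + 1 <= k.+1 <= 2 * n + 1)%N ->
              volume_le (curve f) (a k) K M]) ->
  normal_family F.
Proof.
move=> _ [[x0 Dx0] oD cD] _ gp omit [t [_ shared _ volume]].
have [F0|/set0P nF] := eqVneq F set0.
  apply: precompact_of_limits => U UU; rewrite F0 => U0.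
  by case: (filter_ex U0).
have e : (n.+1 + n = 2 * n + 1)%N by lia.
apply: precompact_of_limits => U UU UF.
pose b := a (lower e ord0).
pose c := upper_coef e a.
pose phi := frame_lift e a (D := D).
have avoid f : F f -> forall (x : D) k, linear_form (a (lower e k)) (coords (curve f x)) != 0.
  move=> Ff x k; apply/negP => /eqP/hyperplaneP Hx.
  have kn : (1 <= (lower e k).+1 <= n + 1)%N by rewrite /= addn1 ltn_ord.
  suff : (set0 : set (projective R n)) (curve f x) by [].
  by rewrite -(omit f Ff _ kn); split=> //; exists x.
have holoL f u : F f -> holo D (fun z => linear_form u (lift_by (curve f) b z)).
  move=> Ff; apply: lift_by_holo => //; last by move=> x; exact: avoid.
  exact: set_valP f.
have formE f j z : form phi c f j z = linear_form (a (upper e j)) (lift_by (curve f) b z).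
  by rewrite (upper_form e gp).
have formH f j (x : D) : F f ->
    form phi c f j (\val x) = 0 <-> hyperplane (a (upper e j)) (curve f x).
  move=> Ff; rewrite formE /lift_by valL_val linear_formZ; split.
    move=> /eqP; rewrite mulf_eq0 invr_eq0 (negbTE (avoid f Ff x _)) /= => /eqP H.
    exact/hyperplaneP.
  by move=> /hyperplaneP ->; rewrite mulr0.
have Dsig z : D z -> exists x : D, \val x = z.
  by move=> Dz; exists (SigSub (mem_set Dz)).
have tm : forall z, D z -> unit_near (U := U) phi z /\ tame (U := U) phi z.
  apply: (@tame_everywhere R _ U UU n 'I_n D phi c oD).
  - by rewrite card_ord.
  - exact: upper_position.
  - apply: filterS UF => f Ff k; split; first exact: holoL.
    move=> z /Dsig[x <-]; rewrite /phi /frame_lift /lift_by valL_val linear_formZ.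
    by apply: mulf_neq0; [rewrite invr_eq0|]; exact: avoid.
  (* The exceptional points of the j-th form are isolated. *)
  move=> z0 j Dz0; have [r r0 rD] := openCP oD Dz0.
  have [jt|tj] := leqP (upper e j).+1 t.
    have kj : (n + 2 <= (upper e j).+1 <= t)%N by rewrite jt /=; lia.
    (* The zero set is common to the family: all of D, or isolated points. *)
    have [f0 Ff0] := nF.
    have same f z : F f -> D z -> form phi c f j z = 0 <-> form phi c f0 j z = 0.
      move=> Ff /Dsig[x <-]; rewrite !formH//.
      by have := shared f f0 Ff Ff0 _ kj; rewrite predeqE => /(_ x).
    have fh : holo D (form phi c f0 j).
      have -> : form phi c f0 j = fun z => linear_form (a (upper e j)) (lift_by (curve f0) b z).
        by apply/funext => z; exact: formE.
      exact: holoL.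
    have [g0|ng] := pselect (germ0 (form phi c f0 j) z0).
      exists r => // w w0 wr; exists (r - normc (w - z0)); first by rewrite subr_gt0.
      apply: filterS UF => f Ff; right=> y yw.
      have Dy : D y.
        apply: rD; move: yw; rewrite /disc /=.
        by have := normc_trans w y z0; lra.
      by apply/(same _ _ Ff Dy); exact: identity_theorem oD cD fh Dz0 g0 _ Dy.
    have [s s0 sP] := isolated_zeros oD Dz0 fh ng.
    exists (Num.min s r); first by rewrite lt_min s0.
    move=> w w0; rewrite lt_min => /andP[ws wr].
    exists (Num.min (normc (w - z0)) (Num.min (s - normc (w - z0)) (r - normc (w - z0)))).
      by rewrite !lt_min w0 !subr_gt0 ws wr.
    apply: filterS UF => f Ff; left=> y; rewrite /disc /= !lt_min => /andP[y0 /andP[ys yr]].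
    have tr := normc_trans w y z0.
    have Dy : D y by apply: rD; rewrite /disc /=; lra.
    apply/eqP => /(same _ _ Ff Dy)/eqP; apply/negP; apply: sP; last by lra.
    have := normc_trans y w z0; rewrite (normc_sub_sym w y).
    by lra.
  (* The number of zeros in a closed disc is bounded over the family. *)
  have kj : (t + 1 <= (upper e j).+1 <= 2 * n + 1)%N.
    by apply/andP; split; [lia|exact: ltn_ord].
  have r2 : 0 < r / 2 by rewrite divr_gt0.
  have KD : cdisc z0 (r / 2) `<=` D.
    by move=> w; rewrite /cdisc /= => wr; apply: rD; rewrite /disc /=; lra.
  have [M MP] := volume _ (@compact_cdisc R z0 (r / 2)) KD.
  have [|s s0 sP] := @avoided_of_bounded R _ U UU (fun f z => form phi c f j z = 0) z0 (r / 2)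
    (Num.truncn M) r2.
    apply: filterS UF => f Ff l ul lP.
    have red : reduced_representation (curve f) (lift_by (curve f) b).
      by apply: lift_by_reduced => //; [exact: set_valP f|move=> x; exact: avoid].
    have := MP f Ff _ kj _ red.
    have := @zeros_count_ge R (pullback (lift_by (curve f) b) (a (upper e j)))
      (cdisc z0 (r / 2)) l ul.
    have lK x : x \in l -> cdisc z0 (r / 2) x /\
        pullback (lift_by (curve f) b) (a (upper e j)) x = 0.
      by move=> /lP[xr fx]; split; [exact: ltW|rewrite -fx formE].
    move=> /(_ lK)/le_trans H /H; rewrite lee_fin => lM.
    by rewrite -ltnS -(ltr_nat R); apply: le_lt_trans lM (truncnS_gt M).
  exists s => // w w0 ws; have [d d0 dP] := sP w w0 ws; exists d => //.
  by apply: filterS dP => f H; left=> y yd; apply/eqP; exact: H.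
have [i i0] := (tm x0 Dx0).2.
have lead z : D z -> unit_near (U := U) phi z /\ leading (U := U) phi i z.
  move=> Dz; split; first exact: (tm z Dz).1.
  by apply: leading_connected cD tm Dx0 i0 z Dz.
have avoidU : \forall f \near U, forall (x : D) k,
    linear_form (a (lower e k)) (coords (curve f x)) != 0.
  by apply: filterS UF => f; exact: avoid.
have gh : Hol n D (limit_curve (U := U) e a (i := i)).
  exact: (@limit_curve_holomorphic R n n _ e D a gp oD U UU i lead).
exists (SigSub (mem_set gh) : Hol n D) => x O oO Ox.
exact: (@limit_curve_cvg R n n _ e D a gp U UU i avoidU lead x O oO Ox).
Qed.
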